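(* Let $(\Delta,\Gamma)$ be a relative simplicial poset, let $V$ be the vertex set of $\Delta$, and let $\varsigma$ be a linear ordering of $V$. For an arbitrary field $\mathbb{K}$ and for all $i\geq 0$, $$\mu_i^{\varsigma}(\Delta,\Gamma;\mathbb{K})=\mu_i^{\mathrm{sd}(\varsigma)}(\mathrm{sd}(\Delta),\mathrm{sd}(\Gamma);\mathbb{K}).$$ In particular, the $\mu^\varsigma$-numbers of $(\Delta,\Gamma)$, and hence also the $\mu$-numbers of $(\Delta,\Gamma)$, satisfy the Morse inequalities: for all $i\ge 0$, $$\sum_{j=0}^i(-1)^{i-j}b_j(\Delta,\Gamma;\mathbb{K})\leq\sum_{j=0}^i(-1)^{i-j}\mu_j^\varsigma(\Delta,\Gamma;\mathbb{K})\quad\text{and}\quad\sum_{j=0}^i(-1)^{i-j}b_j(\Delta,\Gamma;\mathbb{K})\leq\sum_{j=0}^i(-1)^{i-j}\mu_j(\Delta,\Gamma;\mathbb{K}).$$ Furthermore, if $\Delta$ is connected, then $\mu_1(\Delta)-\mu_0(\Delta)+1\geq m(\Delta)$.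
   Context: A simplicial poset is a finite poset $(\Delta,\preceq)$ with a unique minimal element $\emptyset$ such that every interval $[\emptyset,F]$ is a Boolean lattice. Elements are called faces; the dimension of $F$ is the rank of $[\emptyset,F]$ minus $1$; vertices are faces of dimension $0$; $V(F)$ is the set of vertices $v\preceq F$. A simplicial poset is the face poset of a regular CW complex $|\Delta|$ whose closed cells are simplices; homology, connectedness and fundamental group of $\Delta$ refer to $|\Delta|$. Every finite simplicial complex is a simplicial poset under inclusion. For a set $W$ of vertices, $\Delta_W=\{F\in\Delta: V(F)\subseteq W\}$. The link of a vertex $v$ of $\Delta$ is $\mathrm{lk}(v,\Delta)=\{F\in\Delta: v\preceq F\}$, a simplicial poset with minimal element $v$; $\mathrm{lk}(v,\Delta)=\emptyset$ (void) if $v\notin\Delta$. A relative simplicial poset is a pair $(\Delta,\Gamma)$ where $\Delta$ is a simplicial poset and $\Gamma\subseteq\Delta$ is a (possibly void) lower ideal; $\Delta$ is identified with $(\Delta,\emptyset)$. $\tilde H_i(\Delta,\Gamma;\mathbb{K})$ denotes the reduced homology of the pair, computed from the quotient of the augmented cellular chain complexes (with the empty face in degree $-1$, the void poset having zero chain complex), and $\tilde b_i$ its dimension; $b_i(\Delta,\Gamma;\mathbb{K})$ is the dimension of the ordinary (unreduced) relative homology $H_i(\Delta,\Gamma;\mathbb{K})$. For $n=|V|$, $\mathcal{S}_V$ the set of linear orderings of $V$, and $\varsigma=(v_1,\dots,v_n)\in\mathcal{S}_V$, let $$\mu_i^\varsigma(\Delta,\Gamma;\mathbb{K})=\sum_{k=1}^n\tilde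 b_{i-1}\big(\mathrm{lk}(v_k,\Delta_{\{v_1,\dots,v_k\}}),\mathrm{lk}(v_k,\Gamma_{\{v_1,\dots,v_k\}});\mathbb{K}\big),\qquad \mu_i(\Delta,\Gamma;\mathbb{K})=\frac1{n!}\sum_{\varsigma\in\mathcal{S}_V}\mu_i^\varsigma(\Delta,\Gamma;\mathbb{K}).$$ For $i\le 1$ these do not depend on $\mathbb{K}$ and $\mathbb{K}$ is dropped from the notation. The barycentric subdivision $\mathrm{sd}(\Delta)$ is the order complex of $\Delta\setminus\{\emptyset\}$ (a simplicial complex whose vertices, the barycenters, correspond to the nonempty faces of $\Delta$); similarly for $\mathrm{sd}(\Gamma)$, with $\mathrm{sd}$ of the void poset being void. Given $\varsigma=(v_1,\dots,v_n)$, $\mathrm{sd}(\varsigma)$ denotes any ordering of the vertices of $\mathrm{sd}(\Delta)$ extending $\varsigma$ that is obtained by inserting, between $v_{k-1}$ and $v_k$ for each $k$, the barycenters of the faces of $\Delta_{\{v_1,\dots,v_k\}}$ of dimension $\ge 1$ that contain $v_k$, listed in increasing order of the dimension of their faces (the choice may not be unique; the lemma is for any such choice). For connected $\Delta$, $m(\Delta)$ is the minimum number of generators of the fundamental group of $|\Delta|$. *)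

(* Defs.v *)
From HB Require Import structures.
From mathcomp Require Import all_boot all_order all_algebra.

Set Implicit Arguments.
Unset Strict Implicit.
Unset Printing Implicit Defensive.

Import Order.TTheory GRing.Theory Num.Theory.
Import Order.DefaultSetSubsetOrder.

Local Open Scope ring_scope.

(* Simplicial posets are finite subsets X of an ambient finite poset P, with  *)
(* the induced order.  Then restrictions, links and lower ideals of X are     *)
(* again such subsets; the void poset is set0.                                *)
Section SimplicialPosets.
Context {disp : Order.disp_t} {P : finPOrderType disp}.
Implicit Types (X Y C W : {set P}) (F G v : P) (s : seq P).

Definition minimals X : {set P} :=
  [set F in X | [forall G in X, (G <= F)%O ==> (G == F)]].

Definition interval X F G : {set P} :=
  [set H in X | (F <= H)%O && (H <= G)%O].

(* [B, the induced order] is isomorphic to the lattice of subsets of 'I_n *)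
Definition boolean_lattice (B : {set P}) : Prop :=
  exists (n : nat) (phi : P -> {set 'I_n}),
    {in B &, forall F G, (F <= G)%O = (phi F \subset phi G)} /\
    (forall A : {set 'I_n}, exists2 F, F \in B & phi F = A).

Definition simplicial_poset X : Prop :=
  exists2 e, minimals X = [set e] &
    forall F, F \in X -> boolean_lattice (interval X e F).

Definition lower_ideal Y X : Prop :=
  Y \subset X /\
  (forall F G, F \in X -> G \in Y -> (F <= G)%O -> F \in Y).

Definition relative_simplicial_poset X Y : Prop :=
  simplicial_poset X /\ lower_ideal Y X.

Definition is_chain C : bool :=
  [forall F in C, forall G in C, (F >=< G)%O].

(* length of a longest chain of X ending at F, i.e. the rank of the interval  *)
(* from the minimal element of X to F                                         *)
Definition rank X F : nat :=
  (\max_(C : {set P} | is_chain C && (C \subset [set G in X | (G <= F)%O]))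
     #|C|).-1.

(* The dimension of F is (rank X F) - 1. *)
Definition vertices X : {set P} := [set v in X | rank X v == 1%N].

Definition vertices_of X F : {set P} := [set v in vertices X | (v <= F)%O].

Definition restrict X W : {set P} :=
  [set F in X | vertices_of X F \subset W].

Definition link X v : {set P} := [set F in X | (v <= F)%O].

Section Homology.
Variable K : fieldType.

Let chain_space := {ffun P -> K^o}.

Definition cell F : chain_space := [ffun G => (G == F)%:R].

Definition cell_span (A : {set P}) : {vspace chain_space} :=
  <<[seq cell F | F <- enum A]>>%VS.

(* Every cell is oriented by the order in which enum P lists its vertices.    *)
(* If G is a facet of F, then F has exactly one vertex w outside G, and the   *)
(* incidence number is (-1)^k where k is the position (from 0) of w in F.     *)
Definition incidence X F G : K :=
  if [&& F \in X, G \in X, (G < F)%O & rank X F == (rank X G).+1] then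
    (-1) ^+ (\sum_(w in vertices_of X F :\: vertices_of X G)
               #|[set u in vertices_of X F | (enum_rank u < enum_rank w)%N]|)
  else 0.

Definition boundary X : 'End(chain_space) :=
  linfun (fun c : chain_space => [ffun G => \sum_F c F * incidence X F G]
            : chain_space).

Definition rank_cells X Y (r : nat) : {set P} := [set F in Y | rank X F == r].

(* Relative cycles and boundaries in dimension r - 1, that is, preimages in   *)
(* the augmented chain complex of X of the cycles and the boundaries of its   *)
(* quotient by the subcomplex spanned by the cells of Y.                      *)
Definition rel_cycles X Y (r : nat) : {vspace chain_space} :=
  (cell_span (rank_cells X X r) :&: (boundary X @^-1: cell_span Y))%VS.

Definition rel_boundaries X Y (r : nat) : {vspace chain_space} :=
  (boundary X @: cell_span (rank_cells X X r.+1)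
   + cell_span (rank_cells X Y r))%VS.

(* reduced relative Betti number in dimension r - 1; r = 0 is the degree of   *)
(* the empty face                                                             *)
Definition reduced_betti_pred X Y (r : nat) : nat :=
  (\dim (rel_cycles X Y r) - \dim (rel_boundaries X Y r))%N.

(* Ordinary relative Betti number in dimension i: adding the empty face to    *)
(* the subcomplex turns the augmented complex into the unaugmented one.       *)
Definition betti X Y (i : nat) : nat :=
  reduced_betti_pred X (Y :|: minimals X) i.+1.

(* {v_1, ..., v_k} for s = (v_1, ..., v_n) and v = v_k *)
Definition upto s v : {set P} := [set w in take (index v s).+1 s].

Definition mu_ord X Y s (i : nat) : nat :=
  (\sum_(v <- s) reduced_betti_pred (link (restrict X (upto s v)) v)
                                   (link (restrict Y (upto s v)) v) i)%N.

Definition mu X Y (i : nat) : rat :=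
  (#|vertices X|`!%:R)^-1 *
  \sum_(s <- permutations (enum (vertices X))) (mu_ord X Y s i)%:R.

End Homology.

Definition vertex_ordering X s : Prop := perm_eq s (enum (vertices X)).

(* barycentric subdivision: the chains of nonempty faces, by inclusion *)
Definition sd X : {set {set P}} :=
  if X == set0 then set0
  else [set C : {set P} | is_chain C && (C \subset X :\: minimals X)].

(* The vertices of sd X are the singletons [set F], the barycenters.  Here    *)
(* b v_k lists the faces inserted between v_(k-1) and v_k.                    *)
Definition sd_ordering X s (t : seq {set P}) : Prop :=
  exists b : P -> seq P,
    (forall v, v \in s ->
       perm_eq (b v) (enum [set F in link (restrict X (upto s v)) v
                             | (1 < rank X F)%N]) /\
       sorted (fun F G => (rank X F <= rank X G)%N) (b v)) /\
    t = [seq [set F] | F <- flatten [seq rcons (b v) v | v <- s]].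

End SimplicialPosets.

Definition alt_sum (a : nat -> rat) (i : nat) : rat :=
  \sum_(j < i.+1) (-1) ^+ (i - j) * a j.

From mathcomp Require Import all_classical all_reals all_analysis.
Import numFieldNormedType.Exports.

Local Open Scope classical_set_scope.

Section Realization.
Context {disp : Order.disp_t} {P : finPOrderType disp}.
Variables (R : realType) (X : {set P}).

(* A point of |X| lies in the open cell of exactly one nonempty face, where   *)
(* it is given by its (positive) barycentric coordinates.                     *)
Record realization := Point {
  carrier : P;
  coord : {ptws P -> R};
  carrier_face : carrier \in X;
  coord_gt0 : forall v, v \in vertices_of X carrier -> 0 < coord v;
  coord_eq0 : forall v, v \notin vertices_of X carrier -> coord v = 0;
  coord_sum : \sum_v coord v = 1
}.

HB.instance Definition _ := gen_eqMixin realization.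
HB.instance Definition _ := gen_choiceMixin realization.

Definition closed_cell (F : P) : set realization :=
  [set x | (carrier x <= F)%O].

(* The CW topology: U is open iff its trace on every closed cell is open,     *)
(* where closed_cell F is the simplex on the vertices of F via coord.         *)
Definition realization_open (U : set realization) : Prop :=
  forall F, F \in X -> exists2 A : set {ptws P -> R}, open A &
    closed_cell F `&` U = closed_cell F `&` coord @^-1` A.

Let realization_openT : realization_open setT.
Proof. by move=> F _; exists setT; [exact: openT|]. Qed.

Let realization_openI : setI_closed realization_open.
Proof.
move=> U V oU oV F FX.
have [A oA UA] := oU F FX; have [B oB VB] := oV F FX.
exists (A `&` B); first exact: openI.
by rewrite setIIr UA VB -setIIr.
Qed.

Let realization_open_bigU (I : Type) (U : I -> set realization) :
  (forall i, realization_open (U i)) -> realization_open (\bigcup_i U i).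
Proof.
move=> oU F FX.
exists (\bigcup_(A in [set A | open A /\ exists i,
          closed_cell F `&` U i = closed_cell F `&` coord @^-1` A]) A).
  by apply: bigcup_open => A [].
apply/seteqP; split=> x [xF].
  move=> [i _ Uix]; have [A oA UA] := oU i F FX; split=> //.
  exists A; first by split=> //; exists i.
  have : (closed_cell F `&` U i) x by [].
  by rewrite UA => -[].
move=> [A [_ [i UA]] xO]; split=> //; exists i => //.
have : (closed_cell F `&` coord @^-1` A) x by [].
by rewrite -UA => -[].
Qed.

HB.instance Definition _ := isOpenTopological.Build realization
  realization_openT realization_openI realization_open_bigU.

End Realization.

Section FundamentalGroup.
Context {R : realType} {T : topologicalType}.
Implicit Types (x : T) (f g : R -> T).

(* Paths and homotopies are only relevant on [0, 1]. *)
Definition is_loop x f : Prop :=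
  [/\ {within `[0, 1], continuous f}, f 0 = x & f 1 = x].

Definition loop_homotopic x f g : Prop :=
  exists2 H : R * R -> T, {within `[0, 1] `*` `[0, 1], continuous H} &
    [/\ forall t, t \in `[0, 1] -> H (0, t) = f t,
        forall t, t \in `[0, 1] -> H (1, t) = g t,
        forall u, u \in `[0, 1] -> H (u, 0) = x &
        forall u, u \in `[0, 1] -> H (u, 1) = x].

Definition loop_concat f g : R -> T :=
  fun t => if t <= 2^-1 then f (2 * t) else g (2 * t - 1).

Definition loop_reverse f : R -> T := fun t => f (1 - t).

(* the loops at x whose class lies in the subgroup of the fundamental group   *)
(* generated by the classes of the loops g i                                  *)
Inductive generated_loop x (n : nat) (g : 'I_n -> R -> T) : (R -> T) -> Prop :=
| gen_base i : generated_loop x g (g i)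
| gen_cst : generated_loop x g (cst x)
| gen_concat f h : generated_loop x g f -> generated_loop x g h ->
    generated_loop x g (loop_concat f h)
| gen_reverse f : generated_loop x g f -> generated_loop x g (loop_reverse f)
| gen_homotopic f h : generated_loop x g f -> is_loop x h ->
    loop_homotopic x f h -> generated_loop x g h.

Definition pi1_generated x (n : nat) : Prop :=
  exists g : 'I_n -> R -> T, (forall i, is_loop x (g i)) /\
    (forall f, is_loop x f -> generated_loop x g f).

(* minimum number of generators of the fundamental group based at x, +oo if   *)
(* it is not finitely generated                                               *)
Definition pi1_min_generators x : \bar R :=
  ereal_inf [set (n%:R%:E : \bar R) | n in pi1_generated x].

End FundamentalGroup.

(* Main.v *)
(* Subdivision.  Two complexes carried by the same poset, whose carriers are acyclic away
   from the bottom, have the same relative Betti numbers: acyclic carriers yield chain maps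
   and homotopies that respect every lower ideal.  Sending a chain of faces to its largest
   element compares the link of the barycenter of [v] in the subdivision with the link of
   [v].  For the barycenter of a face [F] of positive dimension with last vertex [v], the
   link consists of the chains below [F] that avoid [v]; toggling [G] minus [v], for [G] the
   least element of the chain (with [F] added) containing [v], shows that it is acyclic.

   Morse inequalities.  The faces of [Delta] outside [Gamma] are filtered by their last
   vertex; the graded pieces are the links, up to a shift and a choice of signs.  Writing
   Betti numbers through ranks of boundary maps, the alternating sums telescope, and what
   remains is that a block triangular matrix has at least the rank of its diagonal blocks.

   Fundamental group.  From every component of every vertex link one edge is kept.  An edge
   is homotopic, modulo edges with a smaller last vertex, to the kept edge of its component,
   so the kept edges form a connected graph, and those outside a spanning tree generate.  A
   loop [f] is treated by comparing, for growing [t], the path [f] restricted to [0, t] with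
   the tree path to a vertex of the face carrying [f t]; whether the comparison succeeds is
   locally constant in [t] because open stars of vertices contract to the vertex. *)

From HB Require Import structures.
Require Import Defs.
From mathcomp Require Import all_boot all_order all_algebra zify ring lra.

Set Implicit Arguments.
Unset Strict Implicit.
Unset Printing Implicit Defensive.

Import Order.TTheory GRing.Theory Num.Theory.
Import Order.DefaultSetSubsetOrder.

Local Open Scope ring_scope.

(** * Chain complexes *)

(** Cells are oriented by the enumeration of the ambient type. A link thus carries signs of its own,
    unrelated to those of the poset around it, and the subdivision lives over another type
    altogether. Instead of matching signs cell by cell, chain complexes are built on an arbitrary
    incidence function, and complexes are compared up to homotopy by carriers; this serves both for
    two sign systems on one link and for a link and its subdivision. A face of a simplicial poset is
    not determined by its vertices: two edges may share both ends, and coordinates do not separate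
    the points of the realization. Arguments about faces or points are therefore made below one
    common face. The constant 1 in the bound on the fundamental group arises as follows. The number
    of components of a vertex link is at most its reduced Betti number in dimension 0, minus that in
    dimension -1, plus 1. Over [n] vertices the last summand gives [n], and [n - 1] of the kept
    edges lie in the spanning tree. *)

Lemma linfunE_linear (K : fieldType) (U V : vectType K) (f : U -> V) :
  linear f -> linfun f =1 f.
Proof.
move=> lin c; pose ff : {linear U -> V} := HB.pack f (GRing.isLinear.Build _ _ _ _ _ lin).
by rewrite -[f]/(ff : U -> V) lfunE.
Qed.

Section Chains.
Context {K : fieldType} {disp : Order.disp_t} {P : finPOrderType disp}.
Local Notation chain := {ffun P -> K^o}.
Implicit Types (X Y A B : {set P}) (F G : P) (c z : chain) (V : vectType K).

Lemma cellE F G : cell K F G = (G == F)%:R.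
Proof. by rewrite ffunE. Qed.

Lemma chain_sum_cell c : c = \sum_F c F *: cell K F.
Proof.
apply/ffunP => G; rewrite sum_ffunE (bigD1 G) //= big1 ?addr0.
  by rewrite ffunE cellE eqxx [RHS]mulr1.
by move=> F neFG; rewrite ffunE cellE eq_sym (negbTE neFG) [LHS]mulr0.
Qed.

Definition lin_ext V (f : P -> V) : 'Hom(chain, V) :=
  linfun (fun c : chain => \sum_F c F *: f F).

Lemma lin_extE V (f : P -> V) c : lin_ext f c = \sum_F c F *: f F.
Proof.
rewrite linfunE_linear // => a u v; rewrite scaler_sumr -big_split.
by apply: eq_bigr => F _; rewrite !ffunE scalerDl scalerA.
Qed.

Lemma lin_ext_cell V (f : P -> V) F : lin_ext f (cell K F) = f F.
Proof.
rewrite lin_extE (bigD1 F) //= big1 ?addr0 ?cellE ?eqxx ?scale1r //.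
by move=> G neGF; rewrite cellE (negbTE neGF) scale0r.
Qed.

Lemma lfun_sum_cell V (f : 'Hom(chain, V)) c : f c = \sum_F c F *: f (cell K F).
Proof. by rewrite {1}[c]chain_sum_cell linear_sum; apply: eq_bigr => F _; rewrite linearZ. Qed.

Lemma eq_lfun_cell V (f g : 'Hom(chain, V)) : (forall F, f (cell K F) = g (cell K F)) -> f = g.
Proof.
by move=> fg; apply/lfunP => c; rewrite !lfun_sum_cell; apply: eq_bigr => F _; rewrite fg.
Qed.

Lemma span_cells0 (s : seq P) c F :
  c \in <<[seq cell K F | F <- s]>>%VS -> F \notin s -> c F = 0.
Proof.
move=> cs Fs; have evE (z : chain) : lin_ext (fun G => (G == F)%:R : K^o) z = z F.
  rewrite lin_extE (bigD1 F) //= big1 ?addr0 ?eqxx ?[LHS]mulr1 // => G neGF.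
  by rewrite (negbTE neGF) scaler0.
have: (<<[seq cell K F | F <- s]>> <= lker (lin_ext (fun G => (G == F)%:R : K^o)))%VS.
  apply/span_subvP => _ /mapP[G Gs ->]; rewrite memv_ker evE cellE; apply/eqP.
  by case: eqP => // eFG; rewrite eFG Gs in Fs.
by move=> /subvP/(_ _ cs); rewrite memv_ker evE => /eqP.
Qed.

Lemma mem_cell_span A c :
  reflect (forall F, F \notin A -> c F = 0) (c \in cell_span K A).
Proof.
apply: (iffP idP) => [cA F FA | c0].
  by apply: (span_cells0 cA); rewrite mem_enum.
rewrite [c]chain_sum_cell; apply: memv_suml => F _.
have [FA|FA] := boolP (F \in A); last by rewrite c0 // scale0r mem0v.
by apply/memvZ/memv_span/map_f; rewrite mem_enum.
Qed.

Lemma cell_in_span A F : F \in A -> cell K F \in cell_span K A.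
Proof.
move=> FA; apply/mem_cell_span => G GA; rewrite cellE; case: eqP => // eGF.
by rewrite eGF FA in GA.
Qed.

Lemma cell_span_subset A B : A \subset B -> (cell_span K A <= cell_span K B)%VS.
Proof.
move=> /subsetP sAB; apply/subvP => c /mem_cell_span cA; apply/mem_cell_span => F FB.
by apply: cA; apply: contra FB => /sAB.
Qed.

Lemma lfun_cell_span V (f : 'Hom(chain, V)) A (W : {vspace V}) :
  (forall F, F \in A -> f (cell K F) \in W) -> (cell_span K A <= f @^-1: W)%VS.
Proof.
move=> fA; apply/span_subvP => _ /mapP[F FA ->]; rewrite mem_enum in FA.
by rewrite -memv_preim fA.
Qed.

Lemma lfun_cell_span_mem V (f : 'Hom(chain, V)) A (W : {vspace V}) c :
  (forall F, F \in A -> f (cell K F) \in W) -> c \in cell_span K A -> f c \in W.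
Proof. by move=> /lfun_cell_span/subvP fA /fA; rewrite memv_preim. Qed.

Lemma dim_cell_span A : \dim (cell_span K A) = #|A|.
Proof.
suff fr : free [seq cell K F | F <- enum A] by rewrite (eqP fr) size_map -cardE.
elim: (enum A) (enum_uniq A) => [_|F s IHs] /=; first exact: nil_free.
case/andP=> Fs us; rewrite free_cons IHs // andbT; apply/negP => cF.
by have /eqP := span_cells0 cF Fs; rewrite cellE eqxx oner_eq0.
Qed.

(** The incidence function is arbitrary, so that one definition serves a poset, the blocks of a
    filtration and links with signs inherited from outside. *)
Definition bd (inc : P -> P -> K) : 'End(chain) :=
  locked (lin_ext (fun F => [ffun G => inc F G] : chain)).

Lemma bdE inc c G : bd inc c G = \sum_F c F * inc F G.
Proof. by rewrite /bd -lock lin_extE sum_ffunE; apply: eq_bigr => F _; rewrite !ffunE. Qed.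

Lemma bd_cell inc F G : bd inc (cell K F) G = inc F G.
Proof. by rewrite /bd -lock lin_ext_cell ffunE. Qed.

Lemma boundaryE X : boundary K X = bd (incidence K X).
Proof.
apply/lfunP => c; apply/ffunP => G; rewrite bdE linfunE_linear ?ffunE // => a u v.
apply/ffunP => H; rewrite !ffunE -[RHS]/(a * _ + _) mulr_sumr -big_split; apply: eq_bigr => F _.
by rewrite !ffunE mulrDl -mulrA.
Qed.

End Chains.

(** * Relative Betti numbers through ranks of boundary maps *)

Section Complexes.
Context {K : fieldType} {disp : Order.disp_t} {P : finPOrderType disp}.
Local Notation chain := {ffun P -> K^o}.
Implicit Types (X Y D : {set P}) (F G : P) (c z : chain) (inc : P -> P -> K) (rk : P -> nat).

Definition cells rk Y r : {set P} := [set F in Y | rk F == r].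

Definition cycles inc X Y rk r : {vspace chain} :=
  (cell_span K (cells rk X r) :&: (bd inc @^-1: cell_span K Y))%VS.

Definition boundaries inc X Y rk r : {vspace chain} :=
  (bd inc @: cell_span K (cells rk X r.+1) + cell_span K (cells rk Y r))%VS.

Definition cbetti inc X Y rk r : nat :=
  (\dim (cycles inc X Y rk r) - \dim (boundaries inc X Y rk r))%N.

Lemma reduced_betti_predE X Y r :
  reduced_betti_pred K X Y r = cbetti (incidence K X) X Y (rank X) r.
Proof.
by rewrite /reduced_betti_pred /rel_cycles /rel_boundaries boundaryE.
Qed.

Definition complex inc X rk : Prop :=
  (forall F G, inc F G != 0 -> [/\ F \in X, G \in X & rk F = (rk G).+1]) /\
  (forall F H, \sum_G inc F G * inc G H = 0).

Definition subcomplex inc Y X : Prop :=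
  Y \subset X /\ (forall F G, F \in Y -> inc F G != 0 -> G \in Y).

(** For [D = X :\: Y] this is the differential of the quotient by [Y], written on the surviving
    cells; for a level of a filtration it is a diagonal block. *)
Definition mask inc D F G : K := if (F \in D) && (G \in D) then inc F G else 0.

Definition brank inc D rk r : nat :=
  \dim (bd (mask inc D) @: cell_span K (cells rk D r))%VS.

Lemma complex_bd_bd inc X rk c : complex inc X rk -> bd inc (bd inc c) = 0.
Proof.
case=> _ dd; apply/ffunP => H; rewrite bdE ffunE.
under eq_bigr => G _ do rewrite bdE mulr_suml.
rewrite exchange_big /= big1 // => F _.
under eq_bigr => G _ do rewrite -mulrA.
by rewrite -mulr_sumr dd mulr0.
Qed.

Lemma complex_bd_cells inc X rk r c : complex inc X rk ->
  c \in cell_span K (cells rk X r.+1) -> bd inc c \in cell_span K (cells rk X r).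
Proof.
case=> inc0 _ /mem_cell_span c0; apply/mem_cell_span => G GX; rewrite bdE big1 // => F _.
have [FX|/c0->] := boolP (F \in cells rk X r.+1); last by rewrite mul0r.
have [->|/inc0[_ GX' rkF]] := eqVneq (inc F G) 0; first by rewrite mulr0.
by move: FX GX; rewrite !inE GX' rkF eqSS => /andP[_ ->].
Qed.

Lemma subcomplex_bd inc X Y c : subcomplex inc Y X ->
  c \in cell_span K Y -> bd inc c \in cell_span K Y.
Proof.
case=> _ Ycl /mem_cell_span c0; apply/mem_cell_span => G GY; rewrite bdE big1 // => F _.
have [FY|/c0->] := boolP (F \in Y); last by rewrite mul0r.
have [->|/(Ycl _ _ FY)] := eqVneq (inc F G) 0; first by rewrite mulr0.
by rewrite (negbTE GY).
Qed.

Lemma boundaries_sub_cycles inc X Y rk r : complex inc X rk -> subcomplex inc Y X ->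
  (boundaries inc X Y rk r <= cycles inc X Y rk r)%VS.
Proof.
move=> cX sY; apply/subvP => _ /memv_addP[_ /memv_imgP[c cX1 ->] [z zY ->]].
have sYX : cells rk Y r \subset cells rk X r.
  by apply/subsetP => F; rewrite !inE => /andP[/(subsetP sY.1)->].
have zY' : z \in cell_span K Y.
  by apply: (subvP (cell_span_subset _)) zY; apply/subsetP => F; rewrite inE => /andP[].
rewrite memv_cap -memv_preim linearD /= (complex_bd_bd _ cX) add0r.
by rewrite (subcomplex_bd sY) // memvD ?(complex_bd_cells cX) ?(subvP (cell_span_subset sYX)).
Qed.

Definition cproj D : 'End(chain) := lin_ext (fun F => if F \in D then cell K F else 0).

Lemma cprojE D c F : cproj D c F = if F \in D then c F else 0.
Proof.
rewrite lin_extE sum_ffunE (bigD1 F) //= big1 ?addr0 => [|G neGF].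
  by case: ifP => _; rewrite ?scaler0 !ffunE // eqxx [LHS]mulr1.
by case: ifP => _; rewrite ?scaler0 !ffunE // eq_sym (negbTE neGF) [LHS]mulr0.
Qed.

(** A boundary that starts in [Y] stays in [Y] and is forgotten by the projection; only coefficients
    between surviving cells remain. *)
Lemma cproj_bd_img inc X Y rk r : complex inc X rk -> subcomplex inc Y X ->
  \dim ((cproj (X :\: Y) \o bd inc) @: cell_span K (cells rk X r)) =
  brank inc (X :\: Y) rk r.
Proof.
move=> [inc0 _] [sYX Ycl]; set D := X :\: Y.
have key c : c \in cell_span K (cells rk X r) ->
    (cproj D \o bd inc)%VF c = bd (mask inc D) (cproj D c).
  move=> /mem_cell_span c0; apply/ffunP => G; rewrite comp_lfunE /= cprojE !bdE.
  case: ifP => GD; last first.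
    by rewrite big1 // => F _; rewrite /mask GD andbF mulr0.
  apply: eq_bigr => F _; rewrite cprojE /mask GD andbT; case: ifP => // FD.
  rewrite mulr0; have [-> |nz] := eqVneq (inc F G) 0; first exact: mulr0.
  have [FX GX _] := inc0 _ _ nz.
  move: FD GD; rewrite !in_setD FX GX !andbT => /negbFE FY GY.
  by rewrite (Ycl _ _ FY nz) in GY.
congr (\dim _); apply/eqP; rewrite eqEsubv; apply/andP; split; apply/subvP => _ /memv_imgP[c cc ->].
  rewrite key //; apply: memv_img; apply/mem_cell_span => F.
  rewrite inE negb_and cprojE; case: (boolP (F \in D)) => //= FD Fr.
  by move/mem_cell_span: cc; apply; rewrite inE (negbTE Fr) andbF.
have cX : c \in cell_span K (cells rk X r).
  apply: (subvP (cell_span_subset _)) cc.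
  by apply/subsetP => F; rewrite !inE -andbA => /and3P[_ -> ->].
suff cE : c = cproj D c by rewrite cE -key // memv_img.
apply/ffunP => F; rewrite cprojE; case: ifP => // FD.
by move/mem_cell_span: cc => -> //; rewrite inE FD.
Qed.

(** Relative cycles are the kernel of the boundary followed by the projection off [Y]; rank and
    nullity give the count. *)
Lemma dim_cycles inc X Y rk r : complex inc X rk -> subcomplex inc Y X ->
  (\dim (cycles inc X Y rk r) + brank inc (X :\: Y) rk r = #|cells rk X r|)%N.
Proof.
move=> cX sY; rewrite -(cproj_bd_img r cX sY) -(dim_cell_span (K := K)).
rewrite -[RHS](limg_ker_dim (cproj (X :\: Y) \o bd inc)); congr (\dim _ + _)%N.
apply/eqP; rewrite eqEsubv; apply/andP; split; apply/subvP => c.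
  all: rewrite !memv_cap -memv_preim memv_ker comp_lfunE => /andP[cX1]; rewrite cX1 /=.
  move=> /mem_cell_span cY; apply/eqP/ffunP => F; rewrite cprojE ffunE.
  by case: ifP => //; rewrite inE => /andP[/cY].
move=> /eqP c0; apply/mem_cell_span => F FY; have := congr1 (fun f : chain => f F) c0.
rewrite cprojE ffunE !inE FY /=; case: ifP => // FX _.
rewrite bdE big1 // => G _.
have [->|/cX.1[_ FX' _]] := eqVneq (inc G F) 0; first by rewrite mulr0.
by rewrite FX' in FX.
Qed.

(** Rank and nullity for the projection off [Y]: on the relative boundaries its kernel is spanned by
    the cells of [Y], and its image is the space of boundaries of the quotient. *)
Lemma dim_boundaries inc X Y rk r : complex inc X rk -> subcomplex inc Y X ->
  \dim (boundaries inc X Y rk r) = (#|cells rk Y r| + brank inc (X :\: Y) rk r.+1)%N.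
Proof.
move=> cX sY; rewrite -(cproj_bd_img r.+1 cX sY) -(dim_cell_span (K := K)).
rewrite -[LHS](limg_ker_dim (cproj (X :\: Y))); congr addn; last first.
  congr (\dim _); rewrite limgD limg_comp; apply/addv_idPl/subvP => _ /memv_imgP[c /mem_cell_span cY ->].
  suff -> : cproj (X :\: Y) c = 0 by rewrite mem0v.
  apply/ffunP => F; rewrite cprojE ffunE; case: ifP => //; rewrite inE => /andP[FY _].
  by rewrite cY // inE (negbTE FY).
congr (\dim _); apply/eqP; rewrite eqEsubv; apply/andP; split; apply/subvP => c; last first.
  move=> cY; rewrite memv_cap memv_ker; apply/andP; split; first by rewrite memvE (subv_trans _ (addvSr _ _)).
  apply/eqP/ffunP => F; rewrite cprojE ffunE; case: ifP => //; rewrite inE => /andP[FY _].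
  by move/mem_cell_span: cY => -> //; rewrite inE (negbTE FY).
rewrite memv_cap memv_ker => /andP[/(subvP (boundaries_sub_cycles _ cX sY))].
rewrite memv_cap => /andP[/mem_cell_span cr _] /eqP c0.
apply/mem_cell_span => F FY; have := congr1 (fun f : chain => f F) c0.
rewrite cprojE ffunE inE; have [FX|FX] := boolP (F \in X); last by rewrite cr // inE (negbTE FX).
rewrite andbT; case: ifP => // /negbT/negPn FY' _.
by apply: cr; move: FY; rewrite !inE FX FY'.
Qed.

(** Stated as a sum because subtraction on [nat] is truncated. It turns Betti numbers into ranks,
    which can be compared block by block. *)
Lemma cbetti_brank inc X Y rk r : complex inc X rk -> subcomplex inc Y X ->
  (cbetti inc X Y rk r + brank inc (X :\: Y) rk r + brank inc (X :\: Y) rk r.+1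
   = #|cells rk (X :\: Y) r|)%N.
Proof.
move=> cX sY; have le := dimvS (boundaries_sub_cycles r cX sY).
have dB := dim_boundaries r cX sY; have dZ := dim_cycles r cX sY.
have cD : (#|cells rk X r| = #|cells rk (X :\: Y) r| + #|cells rk Y r|)%N.
  rewrite -(cardsID Y (cells rk X r)) addnC; congr (_ + _)%N.
    by apply: eq_card => F; rewrite !inE andbA.
  apply: eq_card => F; rewrite !inE; case: (boolP (F \in Y)) => [/(subsetP sY.1)->|]; rewrite ?andbF //.
  by rewrite andbT.
by rewrite /cbetti; lia.
Qed.

End Complexes.

(** * Acyclic carriers *)

(** An embedding of quotients expressed through dimensions: the vectors of [Z] sent into [B'] form a
    subspace [W] of [B], and [f] embeds [Z / W] in [Z' / B']. *)
Lemma dim_quotient_le (K : fieldType) (U V : vectType K) (f : 'Hom(U, V))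
    (Z B : {vspace U}) (Z' B' : {vspace V}) :
  (B <= Z)%VS -> (B' <= Z')%VS -> (f @: Z <= Z')%VS ->
  (forall z, z \in Z -> f z \in B' -> z \in B) ->
  (\dim Z - \dim B <= \dim Z' - \dim B')%N.
Proof.
move=> BZ BZ' fZ finj; set W := (Z :&: f @^-1: B')%VS.
have WB : (W <= B)%VS.
  by apply/subvP => z; rewrite memv_cap -memv_preim => /andP[/finj].
have WZ : (W <= Z)%VS by exact: capvSl.
have fW : (f @: W = f @: Z :&: B')%VS.
  apply/eqP; rewrite eqEsubv; apply/andP; split.
    apply/subvP => _ /memv_imgP[z + ->]; rewrite !memv_cap -memv_preim => /andP[zZ ->].
    by rewrite memv_img.
  apply/subvP => y; rewrite memv_cap => /andP[/memv_imgP[z zZ ->] fzB].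
  by apply: memv_img; rewrite memv_cap zZ -memv_preim.
have kW : (W :&: lker f = Z :&: lker f)%VS.
  rewrite /W -capvA; congr (_ :&: _)%VS; apply/capv_idPr.
  by apply/subvP => z; rewrite memv_ker -memv_preim => /eqP->; rewrite mem0v.
have dW := limg_ker_dim f W; have dZ := limg_ker_dim f Z.
have sub : (f @: Z + B' <= Z')%VS by rewrite subv_add fZ.
have := dimv_add_leqif (f @: Z)%VS B'.
have := dimv_sum_cap (f @: Z)%VS B'; rewrite -fW => dS _.
rewrite kW in dW; have := dimvS sub; have := dimvS WB; have := dimvS BZ'; have := dimvS BZ.
lia.
Qed.

Section Carried.
Context {K : fieldType} {disp : Order.disp_t} {L : finPOrderType disp}.
Context {d : Order.disp_t} {P : finPOrderType d}.

Definition carried (X : {set P}) (rk : P -> nat)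
    (lam : P -> L) l r : {vspace {ffun P -> K^o}} :=
  cell_span K [set F in X | (lam F <= l)%O & rk F == r].

Definition monotone_carrier
    (inc : P -> P -> K) (lam : P -> L) : Prop :=
  forall F G, inc F G != 0 -> (lam G <= lam F)%O.

(** Exactness is asked in every rank, including rank 0, the degree of the empty face: acyclicity is
    meant in the reduced sense. *)
Definition acyclic_below (X : {set P})
    (inc : P -> P -> K) (rk : P -> nat) (lam : P -> L) l : Prop :=
  forall r z, z \in carried X rk lam l r -> bd inc z = 0 ->
    exists2 w, w \in carried X rk lam l r.+1 & bd inc w = z.

Lemma carried_le (X : {set P}) rk lam l l' r :
  (l <= l')%O -> (carried X rk lam l r <= carried X rk lam l' r)%VS.
Proof.
move=> ll'; apply: cell_span_subset; apply/subsetP => F; rewrite !inE => /and3P[-> Fl ->].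
by rewrite (le_trans Fl).
Qed.

Lemma carried_cell (X : {set P}) rk (lam : P -> L) F :
  F \in X -> cell K F \in carried X rk lam (lam F) (rk F).
Proof. by move=> FX; apply: cell_in_span; rewrite inE FX lexx eqxx. Qed.

Lemma carried_bd_cell (X : {set P}) inc rk lam F r :
  complex inc X rk -> monotone_carrier inc lam -> rk F = r.+1 ->
  bd inc (cell K F) \in carried X rk lam (lam F) r.
Proof.
move=> [inc0 _] mon rkF; apply/mem_cell_span => G; rewrite bd_cell inE.
have [//|nz] := eqVneq (inc F G) 0; have [_ -> rkG] := inc0 _ _ nz.
by move: rkG; rewrite rkF mon // => -[->]; rewrite eqxx.
Qed.

Lemma bd_cell_rank0 (X : {set P}) (inc : P -> P -> K) rk F :
  complex inc X rk -> rk F = 0%N -> bd inc (cell K F) = 0.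
Proof.
move=> [inc0 _] rkF; apply/ffunP => G; rewrite bd_cell ffunE; apply/eqP/negP.
by move=> /negP/inc0[_ _]; rewrite rkF.
Qed.

End Carried.

Section Carrier.
Context {K : fieldType}.
Context {disp1 : Order.disp_t} {P1 : finPOrderType disp1}.
Context {disp2 : Order.disp_t} {P2 : finPOrderType disp2}.
Context {disp : Order.disp_t} {L : finPOrderType disp}.
Local Notation C1 := {ffun P1 -> K^o}.
Local Notation C2 := {ffun P2 -> K^o}.

Variables (X1 : {set P1}) (inc1 : P1 -> P1 -> K) (rk1 : P1 -> nat) (lam1 : P1 -> L).
Variables (X2 : {set P2}) (inc2 : P2 -> P2 -> K) (rk2 : P2 -> nat) (lam2 : P2 -> L).
Hypothesis (c1 : complex inc1 X1 rk1) (c2 : complex inc2 X2 rk2).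
Hypothesis (m1 : monotone_carrier inc1 lam1) (m2 : monotone_carrier inc2 lam2).
Hypothesis acyc2 : forall F, F \in X1 -> rk1 F != 0%N -> acyclic_below X2 inc2 rk2 lam2 (lam1 F).

Lemma carrier_img (psi : 'Hom(C1, C2)) d l r c :
  (forall F, F \in X1 -> rk1 F = r -> psi (cell K F) \in carried X2 rk2 lam2 (lam1 F) d) ->
  c \in carried X1 rk1 lam1 l r -> psi c \in carried X2 rk2 lam2 l d.
Proof.
move=> psiP; apply: lfun_cell_span_mem => F; rewrite inE => /and3P[FX Fl /eqP rF].
by apply: (subvP (carried_le _ _ _ _ Fl)); apply: psiP.
Qed.

(* With [g = 0] this produces chain maps and with [eps = -1] chain homotopies. *)
Lemma carrier_extension (g : 'Hom(C1, C2)) (eps : K) (d : nat) (u : P1 -> C2) :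
  (forall F r, F \in X1 -> rk1 F = r.+1 ->
     g (cell K F) \in carried X2 rk2 lam2 (lam1 F) (r + d)%N) ->
  (forall F, F \in X1 ->
     bd inc2 (g (cell K F)) + eps *: g (bd inc1 (cell K F)) = 0) ->
  (forall F, F \in X1 -> rk1 F = 0%N ->
     u F \in carried X2 rk2 lam2 (lam1 F) d /\ bd inc2 (u F) = g (cell K F)) ->
  exists psi : 'Hom(C1, C2),
    [/\ forall F, F \in X1 -> psi (cell K F) \in carried X2 rk2 lam2 (lam1 F) (rk1 F + d)%N,
        forall F, F \in X1 ->
          bd inc2 (psi (cell K F)) = g (cell K F) + eps *: psi (bd inc1 (cell K F)) &
        forall F, F \in X1 -> rk1 F = 0%N -> psi (cell K F) = u F].
Proof.
move=> gcar gbd ucar.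
pose good (f : P1 -> C2) F := [/\
  f F \in carried X2 rk2 lam2 (lam1 F) (rk1 F + d)%N,
  bd inc2 (f F) = g (cell K F) + eps *: lin_ext f (bd inc1 (cell K F)) &
  rk1 F = 0%N -> f F = u F].
(* The map is built rank by rank: at stage [n] it is fixed on all cells of rank below [n]. *)
suff /(_ (\max_F rk1 F).+1)[f fP] : forall n, exists f, forall F, F \in X1 -> (rk1 F < n)%N -> good f F.
  have {}fP F : F \in X1 -> good f F by move=> FX; apply: fP => //; rewrite ltnS; apply: leq_bigmax.
  exists (lin_ext f); split=> F FX; have [h1 h2 h3] := fP F FX; rewrite lin_ext_cell; auto.

elim=> [|n [f IH]]; first by exists (fun _ => 0).
have ext (h : P1 -> C2) F : (forall G, (rk1 G < n)%N -> h G = f G) -> (rk1 F <= n)%N ->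
    lin_ext h (bd inc1 (cell K F)) = lin_ext f (bd inc1 (cell K F)).
  move=> hf rF; rewrite !lin_extE; apply: eq_bigr => G _; rewrite bd_cell.
  have [->|nz] := eqVneq (inc1 F G) 0; first by rewrite !scale0r.
  by rewrite hf //; have [_ _ <-] := c1.1 _ _ nz.
have bdf F : F \in X1 -> (rk1 F < n)%N -> bd inc2 (f F) = g (cell K F) + eps *: lin_ext f (bd inc1 (cell K F)).
  by move=> FX /(IH F FX)[].
have: forall F, exists w : C2, [/\ (rk1 F < n)%N -> w = f F,
    F \in X1 -> rk1 F = n -> w \in carried X2 rk2 lam2 (lam1 F) (rk1 F + d)%N,
    F \in X1 -> rk1 F = n -> bd inc2 w = g (cell K F) + eps *: lin_ext f (bd inc1 (cell K F)) &
    F \in X1 -> rk1 F = n -> rk1 F = 0%N -> w = u F].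
  move=> F; have [rF|rF] := eqVneq (rk1 F) n; last first.
    by exists (f F); split=> // _ rF'; rewrite rF' eqxx in rF.
  have [FX|FX] := boolP (F \in X1); last first.
    by exists (f F); split=> //; rewrite (negbTE FX).
  (* In rank 0 the value is the prescribed [u F], as acyclicity of the carrier is only available in
     positive rank. *)
  have [rF0|rF0] := eqVneq (rk1 F) 0%N.
    have [uF buF] := ucar F FX rF0; exists (u F); split=> //.
    - by rewrite rF ltnn.
    - by rewrite rF0.
    by rewrite (bd_cell_rank0 c1) // linear0 scaler0 addr0.
  have [m rm] : exists m, rk1 F = m.+1 by exists (rk1 F).-1; rewrite prednK // lt0n.
  have fcar : lin_ext f (bd inc1 (cell K F)) \in carried X2 rk2 lam2 (lam1 F) (m + d)%N.
    apply: (carrier_img (r := m)); last exact: carried_bd_cell.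
    move=> G GX rG; rewrite lin_ext_cell -rG.
    by have [] := IH G GX; rewrite // rG -ltnS -rm rF.
  case: (acyc2 FX rF0 (r := (m + d)%N) (z := g (cell K F) + eps *: lin_ext f (bd inc1 (cell K F)))).
  - by rewrite memvD ?memvZ // gcar.
  - rewrite linearD linearZ /=.
    (* The right-hand side is a cycle: by the recursion on smaller cells its second term has
       boundary [eps] times [g (bd inc1 (cell K F))], which cancels the boundary of the first term
       by [gbd]. *)
    suff -> : bd inc2 (lin_ext f (bd inc1 (cell K F))) = g (bd inc1 (cell K F)) by exact: gbd.
    have step : (bd inc2 \o lin_ext f)%VF (bd inc1 (cell K F))
        = (g + eps *: (lin_ext f \o bd inc1))%VF (bd inc1 (cell K F)).
      rewrite [LHS]lfun_sum_cell [RHS]lfun_sum_cell; apply: eq_bigr => G _; rewrite bd_cell.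
      have [->|nz] := eqVneq (inc1 F G) 0; first by rewrite !scale0r.
      have [_ GX rG] := c1.1 _ _ nz; rewrite add_lfunE scale_lfunE !comp_lfunE lin_ext_cell.
      by rewrite bdf // -rF rG.
    move: step; rewrite add_lfunE scale_lfunE !comp_lfunE => ->.
    by rewrite (complex_bd_bd _ c1) linear0 scaler0 addr0.
  move=> w wcar wbd; exists w; split=> //.
  - by rewrite rF ltnn.
  - by move=> _ _; rewrite rm.
  by move=> _ _ /eqP; rewrite (negbTE rF0).
move=> /fin_all_exists[h hP]; exists h => F FX; rewrite ltnS => rF.
have hf G : (rk1 G < n)%N -> h G = f G by have [] := hP G.
move: (rF); rewrite leq_eqVlt => /orP[/eqP rFn|rFn].
  by have [_ h1 h2 h3] := hP F; split; rewrite ?ext //; auto.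
by have [f1 f2 f3] := IH F FX rFn; split; rewrite ?ext ?hf.
Qed.

End Carrier.

Lemma lfun_eq_span (K : fieldType) {d : Order.disp_t} {P : finPOrderType d} (V : vectType K)
    (f g : 'Hom({ffun P -> K^o}, V)) (A : {set P}) c :
  (forall F, F \in A -> f (cell K F) = g (cell K F)) -> c \in cell_span K A -> f c = g c.
Proof.
move=> fg /mem_cell_span cA; rewrite lfun_sum_cell [RHS]lfun_sum_cell; apply: eq_bigr => F _.
by have [/fg->|/cA->] := boolP (F \in A); rewrite ?scale0r.
Qed.

Section CarrierBetti.
Context {K : fieldType} {disp : Order.disp_t} {L : finPOrderType disp}.
Variables (S Y : {set L}).
Hypothesis Ylow : forall l l', l \in S -> l' \in Y -> (l <= l')%O -> l \in Y.

(** The single bottom cell, labelled [l0], fixes the augmentation: chain maps are normalised there,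
    and acyclic carriers are needed only above it. *)
Definition carrier_complex {d : Order.disp_t} {P : finPOrderType d} (X : {set P})
    (inc : P -> P -> K) (rk : P -> nat) (lam : P -> L) (l0 : L) : Prop :=
  [/\ complex inc X rk, monotone_carrier inc lam, forall F, F \in X -> lam F \in S &
      exists e, [/\ e \in X, rk e = 0%N, lam e = l0 &
                    forall F, F \in X -> rk F = 0%N -> F = e]].

Definition over {d : Order.disp_t} {P : finPOrderType d} (X : {set P}) (lam : P -> L) : {set P} :=
  [set F in X | lam F \in Y].

Lemma over_subcomplex {d : Order.disp_t} {P : finPOrderType d} (X : {set P}) inc rk (lam : P -> L) l0 :
  carrier_complex X inc rk lam l0 -> subcomplex inc (over X lam) X.
Proof.
case=> [[inc0 _] mon XS _]; split; first by apply/subsetP => F; rewrite inE => /andP[].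
move=> F G; rewrite !inE => /andP[FX FY] nz; have [_ GX _] := inc0 _ _ nz.
by rewrite GX (Ylow _ FY) ?XS // mon.
Qed.

Lemma carried_over {d : Order.disp_t} {P : finPOrderType d} (X : {set P}) inc rk (lam : P -> L) l0 l r :
  carrier_complex X inc rk lam l0 -> l \in Y ->
  (carried X rk lam l r <= cell_span K (cells rk (over X lam) r))%VS.
Proof.
case=> [_ _ XS _] lY; apply: cell_span_subset; apply/subsetP => F.
by rewrite !inE => /and3P[FX Fl ->]; rewrite FX (Ylow _ lY) ?XS.
Qed.

Lemma carried_cells {d : Order.disp_t} {P : finPOrderType d} (X : {set P}) rk (lam : P -> L) l r :
  (carried X rk lam l r <= cell_span K (cells rk X r))%VS.
Proof.
by apply: cell_span_subset; apply/subsetP => F; rewrite !inE => /and3P[-> _ ->].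
Qed.

Definition lfunEs := (add_lfunE, opp_lfunE, comp_lfunE, id_lfunE, zero_lfunE, scale_lfunE).

Section Comparison.
Context {d1 : Order.disp_t} {P1 : finPOrderType d1} {d2 : Order.disp_t} {P2 : finPOrderType d2}.
Variables (X1 : {set P1}) (inc1 : P1 -> P1 -> K) (rk1 : P1 -> nat) (lam1 : P1 -> L).
Variables (X2 : {set P2}) (inc2 : P2 -> P2 -> K) (rk2 : P2 -> nat) (lam2 : P2 -> L).
Variable l0 : L.
Hypothesis cc1 : carrier_complex X1 inc1 rk1 lam1 l0.
Hypothesis cc2 : carrier_complex X2 inc2 rk2 lam2 l0.
Hypothesis acyc12 : forall F, F \in X1 -> rk1 F != 0%N -> acyclic_below X2 inc2 rk2 lam2 (lam1 F).

Lemma carrier_chain_map : exists phi : 'Hom({ffun P1 -> K^o}, {ffun P2 -> K^o}),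
  [/\ forall F, F \in X1 -> phi (cell K F) \in carried X2 rk2 lam2 (lam1 F) (rk1 F),
      forall c, c \in cell_span K X1 -> bd inc2 (phi c) = phi (bd inc1 c) &
      forall e1 e2, e1 \in X1 -> e2 \in X2 -> rk1 e1 = 0%N -> rk2 e2 = 0%N ->
        phi (cell K e1) = cell K e2].
Proof.
have [c1 m1 _ [e1 [e1X rk1e1 lam1e1 e1u]]] := cc1.
have [c2 m2 _ [e2 [e2X rk2e2 lam2e2 e2u]]] := cc2.
case: (carrier_extension c1 m1 acyc12 (g := 0) (eps := 1) (d := 0%N) (u := fun _ => cell K e2)).
- by move=> F r _ _; rewrite zero_lfunE mem0v.
- by move=> F _; rewrite !zero_lfunE linear0 scaler0 addr0.
- move=> F FX rF; rewrite zero_lfunE (e1u F FX rF) lam1e1 -lam2e2 -rk2e2.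
  by rewrite carried_cell // (bd_cell_rank0 c2).
move=> phi [phic phibd phie]; exists phi; split.
- by move=> F FX; rewrite -[rk1 F]addn0 phic.
- move=> c cX; have : (bd inc2 \o phi)%VF c = (phi \o bd inc1)%VF c.
    apply: lfun_eq_span cX => F FX.
    by rewrite !comp_lfunE phibd // zero_lfunE add0r scale1r.
  by rewrite !comp_lfunE.
by move=> e e' eX e'X re re'; rewrite phie // (e2u e').
Qed.
End Comparison.

Lemma cell_span_cells {d : Order.disp_t} {P : finPOrderType d} (X : {set P}) rk r :
  (cell_span K (cells rk X r) <= cell_span K X)%VS.
Proof. by apply: cell_span_subset; apply/subsetP => F; rewrite inE => /andP[]. Qed.

(** There are chain maps in both directions and a homotopy from the round trip to the identity, all
    respecting carriers. They preserve the part over any lower set [Y], so [phi] is injective on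
    relative homology. *)
Lemma carrier_cbetti_le {d1 : Order.disp_t} {P1 : finPOrderType d1}
    {d2 : Order.disp_t} {P2 : finPOrderType d2}
    (X1 : {set P1}) (inc1 : P1 -> P1 -> K) (rk1 : P1 -> nat) (lam1 : P1 -> L)
    (X2 : {set P2}) (inc2 : P2 -> P2 -> K) (rk2 : P2 -> nat) (lam2 : P2 -> L) (l0 : L) r :
  carrier_complex X1 inc1 rk1 lam1 l0 -> carrier_complex X2 inc2 rk2 lam2 l0 ->
  (forall F, F \in X1 -> rk1 F != 0%N -> acyclic_below X1 inc1 rk1 lam1 (lam1 F)) ->
  (forall F, F \in X1 -> rk1 F != 0%N -> acyclic_below X2 inc2 rk2 lam2 (lam1 F)) ->
  (forall F, F \in X2 -> rk2 F != 0%N -> acyclic_below X1 inc1 rk1 lam1 (lam2 F)) ->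
  (cbetti inc1 X1 (over X1 lam1) rk1 r <= cbetti inc2 X2 (over X2 lam2) rk2 r)%N.
Proof.
move=> cc1 cc2 ac11 ac12 ac21.
have [phi [phic phibd phie]] := carrier_chain_map cc1 cc2 ac12.
have [psi [psic psibd psie]] := carrier_chain_map cc2 cc1 ac21.
have [c1 m1 X1S [e1 [e1X rk1e1 lam1e1 e1u]]] := cc1.
have [c2 m2 X2S [e2 [e2X rk2e2 lam2e2 e2u]]] := cc2.
have phiX k c : c \in cell_span K (cells rk1 X1 k) -> phi c \in cell_span K (cells rk2 X2 k).
  apply: lfun_cell_span_mem => F; rewrite inE => /andP[FX /eqP<-].
  by apply: (subvP (carried_cells _ _ _ (lam1 F) _)); apply: phic.
have psiX k c : c \in cell_span K (cells rk2 X2 k) -> psi c \in cell_span K (cells rk1 X1 k).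
  apply: lfun_cell_span_mem => F; rewrite inE => /andP[FX /eqP<-].
  by apply: (subvP (carried_cells _ _ _ (lam2 F) _)); apply: psic.
have bdX k F : F \in X1 -> rk1 F = k.+1 -> bd inc1 (cell K F) \in cell_span K (cells rk1 X1 k).
  by move=> FX rF; rewrite (complex_bd_cells c1) // cell_in_span // inE FX rF /=.
(* The homotopy starts with 0 because the round trip fixes the bottom cell exactly. *)
case: (carrier_extension c1 m1 ac11 (g := (psi \o phi - \1)%VF) (eps := -1) (d := 1%N)
    (u := fun _ => 0)).
- move=> F k FX rF; rewrite addn1 -rF !lfunEs; apply: rpredB; last exact: carried_cell.
  apply: (carrier_img (rk1 := rk2) (lam1 := lam2) (r := rk1 F) _ (phic F FX)).
  by move=> G GX rG; rewrite -rG psic.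
- move=> F FX; rewrite !lfunEs linearB /= scaleN1r opprB.
  have cF : cell K F \in cell_span K X1 by exact: cell_in_span.
  rewrite psibd ?phibd ?subrKA ?subrr // (subvP (cell_span_cells _ rk2 (rk1 F))) //.
  by rewrite phiX // cell_in_span // inE FX /=.
- move=> F FX rF; rewrite mem0v linear0 !lfunEs; split=> //.
  by rewrite (phie F e2) // (psie e2 F) // subrr.
move=> D [Dc Dbd _].
(* The homotopy identity solved for [c]. For a relative cycle whose image is a relative boundary,
   each of the three terms is itself a relative boundary. *)
have Dbd' c : c \in cell_span K X1 -> c = psi (phi c) - bd inc1 (D c) - D (bd inc1 c).
  move=> cX; have -> : bd inc1 (D c) = psi (phi c) - c - D (bd inc1 c).
    have: (bd inc1 \o D)%VF c = (psi \o phi - \1 - (D \o bd inc1))%VF c.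
      apply: lfun_eq_span cX => F FX.
      by rewrite !lfunEs Dbd // ?lfunEs scaleN1r.
    by rewrite !lfunEs => ->.
  by rewrite !opprB addrCA addrAC subrr add0r addrC subrK.
have s1 := over_subcomplex cc1; have s2 := over_subcomplex cc2.
apply: (dim_quotient_le (f := phi)); try exact: boundaries_sub_cycles.
  apply/subvP => _ /memv_imgP[z + ->]; rewrite !memv_cap -!memv_preim => /andP[zX zY].
  rewrite phiX //= phibd; last exact: (subvP (cell_span_cells _ rk1 r)).
  apply: lfun_cell_span_mem zY => F; rewrite inE => /andP[FX FY].
  apply: (subvP (cell_span_cells _ rk2 (rk1 F))).
  by apply: (subvP (carried_over _ cc2 FY)); apply: phic.
move=> z; rewrite memv_cap -memv_preim => /andP[zr zY] zB.
have zX := subvP (cell_span_cells _ rk1 r) _ zr.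
rewrite (Dbd' z zX); apply: rpredB; first apply: rpredB.
- case/memv_addP: zB => _ /memv_imgP[w wX ->] [y yY ->]; rewrite linearD /=.
  apply: memv_add.
    rewrite -psibd; last exact: (subvP (cell_span_cells _ rk2 r.+1)).
    by rewrite memv_img // psiX.
  apply: lfun_cell_span_mem yY => F; rewrite inE => /andP[+ /eqP<-].
  rewrite inE => /andP[FX FY].
  by apply: (subvP (carried_over _ cc1 FY)); apply: psic.
- apply: (subvP (addvSl _ _)); apply: memv_img.
  apply: lfun_cell_span_mem zr => F; rewrite inE => /andP[FX /eqP<-].
  by apply: (subvP (carried_cells _ _ _ (lam1 F) _)); rewrite -addn1; apply: Dc.
apply: (subvP (addvSr _ _)).
(* [bd inc1 z] lies over [Y], one rank below [z], and [D] raises it back to rank [r] over [Y].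
   Writing [(rk1 F).+1 == r] avoids a predecessor at [r = 0]. *)
have: bd inc1 z \in cell_span K [set F in over X1 lam1 | (rk1 F).+1 == r].
  apply/mem_cell_span => F; rewrite inE negb_and => /orP[|rF]; first by move/mem_cell_span: zY; apply.
  rewrite bdE big1 // => G _; have [->|nz] := eqVneq (inc1 G F) 0; first by rewrite mulr0.
  have [GX FX rG] := c1.1 _ _ nz.
  by move/mem_cell_span: zr => ->; rewrite ?mul0r // inE rG negb_and rF orbT.
apply: lfun_cell_span_mem => F; rewrite inE => /andP[+ /eqP<-].
rewrite inE => /andP[FX FY].
by apply: (subvP (carried_over _ cc1 FY)); rewrite -addn1; apply: Dc.
Qed.

Lemma carrier_cbetti_eq {d1 : Order.disp_t} {P1 : finPOrderType d1}
    {d2 : Order.disp_t} {P2 : finPOrderType d2}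
    (X1 : {set P1}) (inc1 : P1 -> P1 -> K) (rk1 : P1 -> nat) (lam1 : P1 -> L)
    (X2 : {set P2}) (inc2 : P2 -> P2 -> K) (rk2 : P2 -> nat) (lam2 : P2 -> L) (l0 : L) r :
  carrier_complex X1 inc1 rk1 lam1 l0 -> carrier_complex X2 inc2 rk2 lam2 l0 ->
  (forall l, l \in S -> l != l0 -> acyclic_below X1 inc1 rk1 lam1 l) ->
  (forall l, l \in S -> l != l0 -> acyclic_below X2 inc2 rk2 lam2 l) ->
  (forall F, F \in X1 -> rk1 F != 0%N -> lam1 F != l0) ->
  (forall F, F \in X2 -> rk2 F != 0%N -> lam2 F != l0) ->
  cbetti inc1 X1 (over X1 lam1) rk1 r = cbetti inc2 X2 (over X2 lam2) rk2 r.
Proof.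
move=> cc1 cc2 ac1 ac2 n1 n2; have [_ _ S1 _] := cc1; have [_ _ S2 _] := cc2.
by apply/eqP; rewrite eqn_leq !(carrier_cbetti_le _ (l0 := l0)) // => F FX rF;
   auto.
Qed.

End CarrierBetti.

(** * Acyclic matchings and block triangular boundaries *)

Section Matching.
Context {K : fieldType} {disp : Order.disp_t} {P : finPOrderType disp}.
Local Notation chain := {ffun P -> K^o}.
Implicit Types (X D Z : {set P}) (F G H : P) (inc : P -> P -> K) (rk lam : P -> nat).

Definition signed_thin inc : Prop :=
  (forall F G, inc F G != 0 -> inc F G * inc F G = 1) /\
  (forall F G G' H, G != G' -> inc F G != 0 -> inc G H != 0 -> inc F G' != 0 -> inc G' H != 0 ->
     inc F G * inc G H + inc F G' * inc G' H = 0).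

(* Matching [F] with [tau F] gives a homotopy that contracts the complex up to cells of
   larger [lam]; as [lam] is bounded, finitely many corrections make a cycle a boundary. *)
Lemma graded_matching_acyclic inc X Z rk lam (U : pred P) (tau : P -> P) :
  complex inc X rk -> subcomplex inc Z X -> signed_thin inc ->
  (forall F G, F \in Z -> inc F G != 0 -> (lam F <= lam G)%N) ->
  (forall F, F \in Z -> [/\ tau F \in Z, tau (tau F) = F, U (tau F) = ~~ U F & lam (tau F) = lam F]) ->
  (forall F, F \in Z -> U F -> inc (tau F) F != 0) ->
  (forall F G, F \in Z -> U F -> inc F G != 0 -> lam G = lam F -> U G /\ inc (tau F) (tau G) != 0) ->
  (forall F G, F \in Z -> ~~ U F -> inc F G != 0 -> lam G = lam F -> G != tau F ->
     ~~ U G /\ inc (tau F) (tau G) != 0) ->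
  forall r z, z \in cell_span K (cells rk Z r) -> bd inc z = 0 ->
    exists2 w, w \in cell_span K (cells rk Z r.+1) & bd inc w = z.
Proof.
move=> cX [ZX Zcl] [sq dia] mon tauP inc_tau lowU upD r.
(* The contraction given by the matching: a lower cell goes to its partner with the sign of their
   incidence, an upper cell to 0. *)
pose h : 'End(chain) :=
  lin_ext (fun F => if (F \in Z) && U F then inc (tau F) F *: cell K (tau F) else 0).
have hcell F G : h (cell K F) G = if [&& F \in Z, U F & G == tau F] then inc (tau F) F else 0.
  rewrite lin_ext_cell andbA; case: ifP => _; last by rewrite ffunE.
  by rewrite !ffunE; case: eqP => _; [exact: mulr1 | exact: mulr0].
have bdh F G : bd inc (h (cell K F)) G =
    if (F \in Z) && U F then inc (tau F) F * inc (tau F) G else 0.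
  rewrite bdE (bigD1 (tau F)) //= big1 ?addr0 => [|H neH].
    by rewrite hcell eqxx andbT; case: ifP => _; rewrite ?mul0r.
  by rewrite hcell (negbTE neH) !andbF mul0r.
have hbd F G : h (bd inc (cell K F)) G =
    if (G \in Z) && ~~ U G then inc F (tau G) * inc G (tau G) else 0.
  rewrite lfun_sum_cell sum_ffunE; case: ifP => [/andP[GZ UG] | GZU]; last first.
    rewrite big1 // => H _; rewrite ffunE hcell; case: ifP => [/and3P[HZ UH /eqP eG]|_]; last exact: mulr0.
    by move: GZU; rewrite eG; have [-> _ -> _] := tauP H HZ; rewrite UH.
  have [tGZ ttG UtG _] := tauP G GZ.
  rewrite (bigD1 (tau G)) //= big1 ?addr0 => [|H neH].
    by rewrite ffunE hcell bd_cell tGZ UtG UG ttG eqxx.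
  rewrite ffunE hcell; case: ifP => [/and3P[HZ UH /eqP eG]|_]; last exact: mulr0.
  by rewrite eG in neH; have [_ e _ _] := tauP H HZ; rewrite e eqxx in neH.
(* The operator [bd h + h bd] is the identity up to cells of strictly larger [lam]; the coefficients
   at those cells are left open. *)
have key F G : F \in Z -> (lam G <= lam F)%N ->
    bd inc (h (cell K F)) G + h (bd inc (cell K F)) G = (G == F)%:R.
  move=> FZ GF; rewrite bdh hbd FZ /=; have [tFZ ttF UtF ltF] := tauP F FZ.
  have [UF|UF] := boolP (U F).
    have itF := inc_tau F FZ UF.
    have [->|neGF] := eqVneq G F; first by rewrite UF andbF addr0 sq.
    have [it0|it0] := eqVneq (inc (tau F) G) 0.
      rewrite it0 mulr0 add0r; case: ifP => // /andP[GZ UG]; have [tGZ ttG UtG ltG] := tauP G GZ.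
      have [->|iFtG] := eqVneq (inc F (tau G)) 0; first by rewrite mul0r.
      have ltG' : lam (tau G) = lam F by apply/eqP; rewrite eqn_leq {1}ltG GF mon.
      by have [_] := lowU F (tau G) FZ UF iFtG ltG'; rewrite ttG it0 eqxx.
    (* Here [G] is a second facet of [tau F]. The square formed by [tau F], [F], [G] and [tau G] has
       opposite signs along its two sides, so the two contributions cancel. *)
    have lG : lam G = lam (tau F) by apply/eqP; rewrite eqn_leq ltF GF -ltF mon.
    have GZ : G \in Z by apply: Zcl tFZ it0.
    have [UG iFtG] : ~~ U G /\ inc F (tau G) != 0.
      by rewrite -{1}ttF; apply: upD; rewrite ?UtF ?UF ?ttF.
    rewrite GZ UG /=; have [tGZ ttG UtG ltG] := tauP G GZ.
    have iGtG : inc G (tau G) != 0 by rewrite -{1}ttG inc_tau // UtG.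
    have neFG : F != G by rewrite eq_sym.
    have d := dia (tau F) F G (tau G) neFG itF iFtG it0 iGtG.
    have s1 := sq _ _ itF; have s2 := sq _ _ iGtG.
    have := congr1 (fun x => inc (tau F) F * inc G (tau G) * x) d; rewrite /= mulr0 => d'.
    transitivity (0 : K); last by []; rewrite -d'.
    transitivity ((inc G (tau G) * inc G (tau G)) * (inc (tau F) F * inc (tau F) G) +
      (inc (tau F) F * inc (tau F) F) * (inc F (tau G) * inc G (tau G))); last by ring.
    by rewrite s1 s2 !mul1r.
  rewrite add0r; have [eGF|neGF] := eqVneq G F.
    by rewrite eGF FZ UF sq // -{1}ttF inc_tau // UtF.
  case: ifP => // /andP[GZ UG]; have [tGZ ttG UtG ltG] := tauP G GZ.
  have [->|iFtG] := eqVneq (inc F (tau G)) 0; first by rewrite mul0r.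
  have ltG' : lam (tau G) = lam F by apply/eqP; rewrite eqn_leq {1}ltG GF mon.
  have [|nU _] := upD F (tau G) FZ UF iFtG ltG'; last by rewrite UtG UG in nU.
  by apply: contra neGF => /eqP e; rewrite -ttG e ttF.
(* [k] counts the levels still to be cleared: subtracting [bd inc (h z)] moves the support of a
   cycle one level up, and at [k = 0] no cell is left because [lam] stays below [M]. *)
pose M := (\max_F lam F).+1.
suff main k z : z \in cell_span K [set F in cells rk Z r | (M - k <= lam F)%N] -> bd inc z = 0 ->
    exists2 w, w \in cell_span K (cells rk Z r.+1) & bd inc w = z.
  move=> z zZ; apply: (main M); apply/mem_cell_span => F; rewrite inE subnn leq0n andbT.
  by move/mem_cell_span: zZ; apply.
elim: k z => [|k IHk] z zZ bz.
  exists 0; rewrite ?mem0v ?linear0 //; apply/esym/ffunP => F; rewrite ffunE.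
  move/mem_cell_span: zZ => -> //; rewrite inE negb_and subn0 -ltnNge ltnS.
  by apply/orP; right; apply: leq_bigmax.
have zr : z \in cell_span K (cells rk Z r).
  by apply: (subvP (cell_span_subset _)) zZ; apply/subsetP => F; rewrite inE => /andP[].
have hz : h z \in cell_span K (cells rk Z r.+1).
  apply: lfun_cell_span_mem zr => F; rewrite inE => /andP[FZ /eqP rF]; rewrite lin_ext_cell FZ /=.
  case: ifP => [UF|_]; last exact: mem0v.
  apply/memvZ/cell_in_span; rewrite inE; have [-> _ _ _] := tauP F FZ.
  by have [_ _ ->] := cX.1 _ _ (inc_tau F FZ UF); rewrite rF /=.
have bhz : bd inc (h z) \in cell_span K (cells rk Z r).
  apply/mem_cell_span => G; rewrite bdE inE => GZr; rewrite big1 // => F _.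
  have [FZ|FZ] := boolP (F \in cells rk Z r.+1); last by move/mem_cell_span: hz => ->; rewrite ?mul0r.
  have [->|nz] := eqVneq (inc F G) 0; first by rewrite mulr0.
  move: FZ; rewrite inE; have [_ _ ->] := cX.1 _ _ nz; rewrite eqSS => /andP[FZ rG].
  by rewrite (Zcl F G FZ nz) rG in GZr.
case: (IHk (z - bd inc (h z))).
- apply/mem_cell_span => G; rewrite inE negb_and => /orP[GZr|].
    by move: (rpredB zr bhz) => /mem_cell_span; apply.
  rewrite -ltnNge => lG; rewrite !ffunE.
  have lG' : (lam G <= M - k.+1)%N by rewrite -ltnS (leq_trans lG) //; lia.
  have -> : bd inc (h z) G = bd inc (h z) G + h (bd inc z) G by rewrite bz linear0 ffunE addr0.
  have -> : bd inc (h z) G = \sum_F z F * bd inc (h (cell K F)) G.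
    have := congr1 (fun f : chain => f G) (lfun_sum_cell (bd inc \o h)%VF z).
    rewrite sum_ffunE /= !comp_lfunE => ->; apply: eq_bigr => F _.
    by rewrite ffunE comp_lfunE.
  have -> : h (bd inc z) G = \sum_F z F * h (bd inc (cell K F)) G.
    have := congr1 (fun f : chain => f G) (lfun_sum_cell (h \o bd inc)%VF z).
    rewrite sum_ffunE /= !comp_lfunE => ->; apply: eq_bigr => F _.
    by rewrite ffunE comp_lfunE.
  rewrite -big_split /= (eq_bigr (fun F => z F * (G == F)%:R)) => [|F _].
    rewrite (bigD1 G) //= big1 ?addr0 ?eqxx ?mulr1 ?subrr // => F neF.
    by rewrite eq_sym (negbTE neF) mulr0.
  rewrite -mulrDr; have [FZ|FZ] := boolP (F \in [set F in cells rk Z r | (M - k.+1 <= lam F)%N]).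
    move: FZ; rewrite !inE => /andP[/andP[FZ _] lF].
    by rewrite key // (leq_trans lG').
  by move/mem_cell_span: zZ => -> //; rewrite !mul0r.
- by rewrite linearB /= bz (complex_bd_bd _ cX) subrr.
move=> w wZ bw; exists (w + h z); first exact: rpredD.
by rewrite linearD /= bw subrK.
Qed.

(** The boundaries of cells of smaller [lam] lie in the kernel of the projection to level [m], while
    that projection maps the boundaries of level [m] onto the image of the diagonal block. Rank and
    nullity for the projection add the two. *)
Lemma brank_blocks inc D rk lam r n :
  (forall F G, F \in D -> G \in D -> inc F G != 0 -> (lam G <= lam F)%N) ->
  (\sum_(k < n) brank inc [set F in D | lam F == k] rk r <= brank inc D rk r)%N.
Proof.
move=> mon; pose D' m := [set F in D | (lam F < m)%N].
set f := bd (mask inc D).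
suff blk m : (\sum_(k < m) brank inc [set F in D | lam F == k] rk r <=
             \dim (f @: cell_span K (cells rk (D' m) r)))%N.
  apply: (leq_trans (blk n)); apply/dimvS/limgS/cell_span_subset/subsetP => F.
  by rewrite !inE -andbA => /and3P[-> _ ->].
elim: m => [|m IHm]; first by rewrite big_ord0.
rewrite big_ord_recr /= -(limg_ker_dim (cproj [set F in D | lam F == m])).
apply: leq_add; [apply: (leq_trans IHm)|]; apply: dimvS; apply/subvP => _ /memv_imgP[c cD ->].
  rewrite memv_cap memv_ker memv_img /=; last first.
    apply: (subvP (cell_span_subset _)) cD; apply/subsetP => F; rewrite !inE => /andP[/andP[-> lF] ->].
    by rewrite ltnW.
  apply/eqP/ffunP => G; rewrite cprojE ffunE inE; case: ifP => // /andP[GD /eqP lG].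
  rewrite bdE big1 // => F _; have [FD|FD] := boolP (F \in cells rk (D' m) r); last first.
    by move/mem_cell_span: cD => ->; rewrite ?mul0r.
  move: FD; rewrite /mask !inE => /andP[/andP[FD lF] _]; rewrite FD GD /=.
  have [->|nz] := eqVneq (inc F G) 0; first by rewrite mulr0.
  by have := mon F G FD GD nz; rewrite lG leqNgt lF.
have -> : bd (mask inc [set F in D | lam F == m]) c = cproj [set F in D | lam F == m] (f c).
  apply/ffunP => G; rewrite cprojE !bdE; case: ifP => GD; last first.
    by rewrite big1 // => F _; rewrite /mask GD andbF mulr0.
  apply: eq_bigr => F _; have [FD|FD] := boolP (F \in cells rk [set F in D | lam F == m] r); last first.
    by move/mem_cell_span: cD => ->; rewrite ?mul0r.
  move: FD; rewrite /mask inE => /andP[FD _]; rewrite FD GD /=.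
  by move: FD GD; rewrite !inE => /andP[-> _] /andP[-> _].
apply/memv_img/memv_img; apply: (subvP (cell_span_subset _)) cD.
by apply/subsetP => F; rewrite !inE => /andP[/andP[-> /eqP->] ->]; rewrite ltnSn.
Qed.

End Matching.

(** * Simplicial posets *)

Section LocallyBoolean.
Context {disp : Order.disp_t} {P : finPOrderType disp}.
Implicit Types (X Z C W : {set P}) (F G H v w e : P).

(** The faces below [F] are the subsets of [V F]. No least face is named, so the notion passes to
    lower ideals and, once the labels of [v] are removed, to links. *)
Definition boolean_labels (X : {set P}) (F : P) (T : finType) (V : P -> {set T}) : Prop :=
  (forall G H, G \in X -> H \in X -> (G <= F)%O -> (H <= F)%O ->
     (G <= H)%O = (V G \subset V H)) /\
  (forall A : {set T}, A \subset V F -> exists G, [/\ G \in X, (G <= F)%O & V G = A]).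

Definition locally_boolean X : Prop :=
  forall F, F \in X -> exists (T : finType) (V : P -> {set T}), boolean_labels X F V.

Lemma boolean_labels_below X F G (T : finType) (V : P -> {set T}) :
  F \in X -> G \in X -> (G <= F)%O -> boolean_labels X F V -> boolean_labels X G V.
Proof.
move=> FX GX GF [Vle Vsub]; split.
  by move=> H H' HX H'X HG H'G; apply: Vle => //; apply: le_trans GF.
move=> A AG; have GFV : V G \subset V F by rewrite -Vle.
have [H [HX HF VH]] := Vsub A (subset_trans AG GFV).
by exists H; split=> //; rewrite Vle ?VH.
Qed.

Lemma minimals_bottom X e : minimals X = [set e] ->
  e \in X /\ (forall F, F \in X -> (e <= F)%O).
Proof.
move=> mX; have : e \in minimals X by rewrite mX set11.
rewrite inE => /andP[eX _]; split=> // F FX.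
have [n] := ubnP #|[set G in X | (G <= F)%O]|; elim: n F FX => // n IHn F FX.
rewrite ltnS => le_n; have [FM|] := boolP (F \in minimals X).
  by move: FM; rewrite mX inE => /eqP->.
rewrite inE FX /= negb_forall => /existsP[G]; rewrite !negb_imply => /and3P[GX GF neq].
apply: (le_trans _ GF); apply: IHn => //; apply: leq_trans le_n; apply: proper_card.
apply/properP; split; first by apply/subsetP => H; rewrite !inE => /andP[-> /le_trans->].
exists F; rewrite !inE ?FX ?lexx //=; apply: contra neq => FG.
by rewrite eq_le GF FG.
Qed.

Lemma simplicial_locally_boolean X : simplicial_poset X -> locally_boolean X.
Proof.
move=> [e /minimals_bottom[eX e_le] bool] F FX; have [n [phi [phile phisub]]] := bool F FX.
exists 'I_n, phi; split=> [G H GX HX GF HF|A AF].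
  by apply: phile; rewrite inE ?GX ?HX ?GF ?HF e_le.
have [G] := phisub A; rewrite inE => /and3P[GX _ GF] <-.
by exists G.
Qed.

Lemma rank_below X Z F : [set G in X | (G <= F)%O] = [set G in Z | (G <= F)%O] ->
  rank X F = rank Z F.
Proof. by rewrite /rank => ->. Qed.

Lemma rank_lower X Z F : lower_ideal Z X -> F \in Z -> rank Z F = rank X F.
Proof.
move=> [ZX Zlow] FZ; apply: rank_below; apply/setP => G; rewrite !inE.
have [GF|] := boolP (G <= F)%O; rewrite ?andbF ?andbT //.
by apply/idP/idP => [/(subsetP ZX)|/Zlow]; [|apply; eauto].
Qed.

Lemma vertices_of_lower X Z F : lower_ideal Z X -> F \in Z -> vertices_of Z F = vertices_of X F.
Proof.
move=> ZX FZ; apply/setP => v; rewrite !inE; have [vF|] := boolP (v <= F)%O; rewrite ?andbF ?andbT //.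
apply/andP/andP => -[vX]; first by rewrite (rank_lower ZX vX) => ->; rewrite (subsetP ZX.1).
have vZ : v \in Z by apply: (ZX.2) vF.
by rewrite -(rank_lower ZX vZ) vZ.
Qed.

Lemma lower_locally_boolean X Z : lower_ideal Z X -> locally_boolean X -> locally_boolean Z.
Proof.
move=> [ZX Zlow] lb F FZ; have [T [V [Vle Vsub]]] := lb F (subsetP ZX _ FZ).
exists T, V; split=> [G H GZ HZ|A AF]; first by apply: Vle; apply: (subsetP ZX).
by have [G [GX GF VG]] := Vsub A AF; exists G; split=> //; apply: Zlow GF.
Qed.

Lemma lower_restrict X W : lower_ideal (restrict X W) X.
Proof.
split=> [|F G FX]; first by apply/subsetP => F; rewrite inE => /andP[].
rewrite !inE FX => /andP[GX GW] FG; apply: subset_trans GW; apply/subsetP => v.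
by rewrite !inE => /andP[-> /le_trans->].
Qed.

(** Along a chain the label sets grow strictly, so their sizes are distinct and bounded by that of
    [V F]; conversely, removing labels one at a time gives a chain with [#|V F|.+1] members. *)
Lemma rank_labels X F (T : finType) (V : P -> {set T}) :
  F \in X -> boolean_labels X F V -> rank X F = #|V F|.
Proof.
move=> FX bl; have [Vle Vsub] := bl; rewrite /rank; set m := \max_(_ | _) _.
suff -> : m = #|V F|.+1 by [].
apply/eqP; rewrite eqn_leq; apply/andP; split.
  apply/bigmax_leqP => C /andP[chC /subsetP CF].
  have inj : {in C &, injective (fun G => inord #|V G| : 'I_(#|V F|.+1))}.
    move=> G H GC HC /(congr1 val); have := CF G GC; have := CF H HC; rewrite !inE.
    move=> /andP[HX HF] /andP[GX GF].
    have cG : (#|V G| < #|V F|.+1)%N by rewrite ltnS subset_leq_card // -Vle.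
    have cH : (#|V H| < #|V F|.+1)%N by rewrite ltnS subset_leq_card // -Vle.
    rewrite /= !inordK // => eGH; have := forall_inP (forall_inP chC G GC) H HC.
    have VV : (V G \subset V H) || (V H \subset V G) -> V G = V H.
      by case/orP => sub; [|apply/esym]; apply/eqP; rewrite eqEcard sub eGH /=.
    rewrite /Order.comparable (Vle G H) // (Vle H G) // => /VV e.
    by apply/le_anti; rewrite (Vle G H) // (Vle H G) // e subxx.
  by rewrite -(card_in_imset inj) -[leqRHS]card_ord max_card.
have chain G : G \in X -> (G <= F)%O -> exists C : {set P},
    [/\ is_chain C, C \subset [set H in X | (H <= G)%O] & #|C| = #|V G|.+1].
  have [n] := ubnP #|V G|; elim: n G => // n IHn G; rewrite ltnS => leVG GX GF.
  have [x xG | VG0] := pickP [pred x | x \in V G]; last first.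
    exists [set G]; split.
    - by apply/forall_inP => H /set1P->; apply/forall_inP => H' /set1P->; rewrite comparablexx.
    - by rewrite sub1set inE GX lexx.
    by rewrite cards1 (eq_card0 VG0).
  have GFV : V G :\ x \subset V F.
    by apply: subset_trans (subsetDl _ _) _; rewrite -Vle.
  have [H [HX HF VH]] := Vsub _ GFV.
  have HG : (H <= G)%O by rewrite Vle // VH subsetDl.
  have cG : #|V G| = #|V H|.+1 by rewrite (cardsD1 x) [x \in _]xG -VH.
  have [|C [chC CH cC]] := IHn H _ HX HF; first by rewrite -ltnS -cG ltnS.
  have GC : G \notin C.
    apply/negP => /(subsetP CH); rewrite inE => /andP[_ GH].
    have /le_anti e : (G <= H <= G)%O by rewrite GH HG.
    by move: cG; rewrite e => /eqP; rewrite eqn_leq ltnn andbF.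
  exists (G |: C); split; last by rewrite cardsU1 GC cC cG.
    have cmp H' : H' \in C -> (H' <= G)%O.
      by move=> /(subsetP CH); rewrite inE => /andP[_ /le_trans->].
    apply/forall_inP => A /setU1P[->|AC]; apply/forall_inP => B /setU1P[->|BC].
    - exact: comparablexx.
    - by rewrite /Order.comparable cmp // orbT.
    - by rewrite /Order.comparable cmp.
    - exact: (forall_inP (forall_inP chC A AC)).
  rewrite subUset sub1set inE GX lexx /=; apply: subset_trans CH _.
  by apply/subsetP => H'; rewrite !inE => /andP[-> /le_trans->].
have [C [chC CF cC]] := chain F FX (lexx F).
by rewrite -cC /m; apply: leq_bigmax_cond; rewrite chC.
Qed.

Section Vertices.
Variables (X : {set P}).
Hypothesis lbX : locally_boolean X.
Local Notation vs := (vertices_of X).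

Lemma atom_labels F : F \in X -> exists (T : finType) (V : P -> {set T}) (at_ : T -> P),
  [/\ boolean_labels X F V, {in V F &, injective at_} &
      forall G, G \in X -> (G <= F)%O -> vs G = at_ @: V G].
Proof.
move=> FX; have [T [V bl]] := lbX FX; have [Vle Vsub] := bl.
have [at_ atP] : exists at_ : T -> P, forall x, x \in V F -> [/\ at_ x \in X, (at_ x <= F)%O & V (at_ x) = [set x]].
  apply: (@fin_all_exists _ (fun _ => P) (fun x p => x \in V F -> [/\ p \in X, (p <= F)%O & V p = [set x]])) => x.
  have [xF|xF] := boolP (x \in V F); last by exists F.
  by have [|G GP] := Vsub [set x]; [rewrite sub1set|exists G].
exists T, V, at_; split=> //.
  move=> x y xF yF e; have [_ _ ex] := atP x xF; have [_ _ ey] := atP y yF.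
  by apply/set1P; rewrite -ey -e ex set11.
move=> G GX GF; have GFV : V G \subset V F by rewrite -Vle.
apply/setP => v; rewrite !inE; apply/andP/imsetP.
  move=> [/andP[vX /eqP rv] vG]; have vF := le_trans vG GF.
  move: rv; rewrite (rank_labels vX (boolean_labels_below FX vX vF bl)) => /eqP/cards1P[x Vv].
  have xG : x \in V G by rewrite -sub1set -Vv -Vle.
  exists x => //; have [aX aF Va] := atP x (subsetP GFV _ xG).
  by apply/le_anti; rewrite (Vle v) // (Vle (at_ x)) // Va Vv subxx.
move=> [x xG ->]; have [aX aF Va] := atP x (subsetP GFV _ xG).
rewrite aX (rank_labels aX (boolean_labels_below FX aX aF bl)) Va cards1 eqxx.
by rewrite Vle // Va sub1set.
Qed.

Lemma rank_card F : F \in X -> rank X F = #|vs F|.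
Proof.
move=> FX; have [T [V [at_ [bl inj vsE]]]] := atom_labels FX.
by rewrite (rank_labels FX bl) vsE // card_in_imset.
Qed.

Lemma vertices_of_labels F : F \in X -> boolean_labels X F vs.
Proof.
move=> FX; have [T [V [at_ [[Vle Vsub] inj vsE]]]] := atom_labels FX.
have sub G : G \in X -> (G <= F)%O -> V G \subset V F by move=> GX GF; rewrite -Vle.
split=> [G H GX HX GF HF|A AF].
  rewrite Vle // !vsE //; apply/idP/idP => [|/subsetP s]; first exact: imsetS.
  apply/subsetP => x xG; have /imsetP[y yH e] := s _ (imset_f at_ xG).
  by rewrite (inj x y) ?(subsetP (sub _ _ _) _ yH) ?(subsetP (sub _ _ _) _ xG).
have [|G [GX GF VG]] := Vsub [set x in V F | at_ x \in A].
  by apply/subsetP => x; rewrite inE => /andP[].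
exists G; split=> //; rewrite vsE // VG; apply/setP => v; apply/imsetP/idP.
  by case=> x; rewrite inE => /andP[_ xA ->].
move=> vA; have := subsetP AF v vA; rewrite vsE // => /imsetP[x xF e].
by exists x; rewrite // inE xF -e.
Qed.

Lemma vertices_of_le F G H : F \in X -> G \in X -> H \in X -> (G <= F)%O -> (H <= F)%O ->
  (G <= H)%O = (vs G \subset vs H).
Proof. by move=> FX GX HX GF HF; have [+ _] := vertices_of_labels FX; apply. Qed.

Lemma face_exists F (A : {set P}) : F \in X -> A \subset vs F ->
  exists G, [/\ G \in X, (G <= F)%O & vs G = A].
Proof. by move=> FX AF; have [_] := vertices_of_labels FX; apply. Qed.

Lemma vertices_of_inj F G H : F \in X -> G \in X -> H \in X -> (G <= F)%O -> (H <= F)%O ->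
  vs G = vs H -> G = H.
Proof.
move=> FX GX HX GF HF e; apply/le_anti/andP.
by split; rewrite (vertices_of_le FX) // e.
Qed.

Lemma vertices_ofS F G : (G <= F)%O -> vs G \subset vs F.
Proof. by move=> GF; apply/subsetP => v; rewrite !inE => /andP[-> /le_trans->]. Qed.

End Vertices.
End LocallyBoolean.

Lemma card_setD1 (T : finType) (A B : {set T}) : B \subset A -> #|A| = #|B|.+1 ->
  exists2 w, w \in A & B = A :\ w.
Proof.
move=> sub cA; have /eqP/cards1P[w Dw] : #|A :\: B| = 1%N.
  by rewrite cardsD (setIidPr sub) cA subSnn.
exists w; first by have : w \in A :\: B by [rewrite Dw set11]; rewrite inE => /andP[].
by rewrite -Dw setDDr setDv set0U (setIidPr sub).
Qed.

(** * Signs of incidences *)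

Section Incidence.
Context {K : fieldType} {disp : Order.disp_t} {P : finPOrderType disp}.
Implicit Types (F G H v w : P).
Variable X : {set P}.
Hypothesis lbX : locally_boolean X.
Local Notation vs := (vertices_of X).
Local Notation inc := (incidence K X).

Definition facet F G := [&& F \in X, G \in X, (G < F)%O & rank X F == (rank X G).+1].

Definition position F w := #|[set u in vs F | (enum_rank u < enum_rank w)%N]|.

Lemma incidence_neq0 F G : (inc F G != 0) = facet F G.
Proof.
by rewrite /incidence -/(facet F G); case: ifP => // _; rewrite ?signr_eq0 ?eqxx.
Qed.

Lemma facetP F G : reflect
  (exists w, [/\ F \in X, G \in X, (G <= F)%O, w \in vs F & vs G = vs F :\ w]) (facet F G).
Proof.
apply: (iffP and4P) => [[FX GX GF /eqP rF] | [w [FX GX GF wF vG]]]; last first.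
  have rF : rank X F = (rank X G).+1 by rewrite !rank_card // vG (cardsD1 w) wF.
  split=> //; last by rewrite rF.
  by rewrite lt_neqAle GF andbT; apply/eqP => e; move: rF; rewrite e; lia.
have [|w wF vG] := card_setD1 (vertices_ofS X (ltW GF)); first by rewrite -!rank_card.
by exists w; split=> //; apply: ltW.
Qed.

Lemma incidenceE F G w : facet F G -> w \in vs F -> vs G = vs F :\ w ->
  inc F G = (-1) ^+ position F w.
Proof.
move=> fFG wF vG; rewrite /incidence -/(facet F G) fFG.
have -> : vs F :\: vs G = [set w].
  apply/setP => x; rewrite vG in_setD in_setD1 in_set1 negb_and negbK.
  by case: eqVneq => [->|_] //=; case: (x \in vs F).
by rewrite big_set1.
Qed.

(** Deleting [w] moves [u] by one place exactly when [w] precedes it. This is the only source of the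
    sign change when two vertices are deleted in either order. *)
Lemma position_swap F G w u : w != u -> u \in vs F -> w \in vs F -> vs G = vs F :\ w ->
  position F u = (position G u + (enum_rank w < enum_rank u))%N.
Proof.
move=> neq uF wF vG; rewrite /position (cardsD1 w) inE wF addnC /=; congr (_ + _)%N.
by apply: eq_card => x; rewrite [LHS]in_setD1 [in LHS]inE [in RHS]inE vG in_setD1 andbA.
Qed.

(** Deleting the two vertices in the other order gives the second face between [F] and [H]. *)
Lemma facet_facet F G H a b : facet F G -> facet G H -> a \in vs F -> vs G = vs F :\ a ->
  b \in vs G -> vs H = vs G :\ b ->
  exists G', [/\ facet F G', facet G' H, G != G', vs G' = vs F :\ b & vs H = vs G' :\ a].
Proof.
move=> fFG fGH aF vG bG vH; have [wa [FX GX GF _ _]] := facetP _ _ fFG.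
have [_ [_ HX HG _ _]] := facetP _ _ fGH.
have bF : b \in vs F by move: bG; rewrite vG in_setD1 => /andP[].
have ab : a != b by move: bG; rewrite vG in_setD1 eq_sym => /andP[].
have [G' [G'X G'F vG']] := face_exists lbX FX (subsetDl (vs F) [set b]).
have HF := le_trans HG GF; exists G'.
have vH' : vs H = vs G' :\ a by rewrite vH vG vG'; apply/setP => x; rewrite !in_setD1; case: eqP; case: eqP.
have aG' : a \in vs G' by rewrite vG' in_setD1 ab.
split=> //.
- by apply/facetP; exists b.
- apply/facetP; exists a; split=> //.
  by rewrite (vertices_of_le lbX FX) // vH' subsetDl.
by apply: contraTneq aG' => <-; rewrite vG in_setD1 eqxx.
Qed.

Lemma incidence_signed_thin : signed_thin inc.
Proof.
split=> [F G nz|F G G' H ne].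
  rewrite incidence_neq0 in nz; have [w [_ _ _ wF vG]] := facetP _ _ nz.
  by rewrite (incidenceE nz wF vG) -expr2 sqrr_sign.
rewrite !incidence_neq0 => fFG fGH fFG' fG'H.
have [a [FX GX GF aF vG]] := facetP _ _ fFG; have [b [_ HX HG bG vH]] := facetP _ _ fGH.
have [b' [_ G'X G'F b'F vG']] := facetP _ _ fFG'; have [a' [_ _ HG' a'G' vH']] := facetP _ _ fG'H.
have bF : b \in vs F by move: bG; rewrite vG in_setD1 => /andP[].
have ab : a != b by move: bG; rewrite vG in_setD1 eq_sym => /andP[].
have ab' : a != b'.
  apply: contraNneq ne => e; apply/eqP/(vertices_of_inj lbX FX) => //.
  by rewrite vG vG' e.
have e2 : b' = b.
  have: b' \notin vs H by rewrite vH' vG' !in_setD1 eqxx /= andbF.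
  by rewrite vH vG !in_setD1 b'F (eq_sym b' a) ab' /= andbT negbK => /eqP.
have e1 : a' = a.
  have: a \notin vs H by rewrite vH vG !in_setD1 eqxx /= andbF.
  by rewrite vH' vG' e2 !in_setD1 aF ab /= andbT negbK => /eqP.
subst b' a'.
rewrite (incidenceE fFG aF vG) (incidenceE fGH bG vH) (incidenceE fFG' bF vG') (incidenceE fG'H a'G' vH').
rewrite (position_swap ab bF aF vG) (position_swap _ aF bF vG') 1?eq_sym //.
(* Exactly one of [a] and [b] precedes the other, so the two products differ by a single sign. *)
rewrite !exprD; have : (enum_rank a : nat) != enum_rank b.
  by apply: contra ab => /eqP/val_inj/enum_rank_inj->.
set x := _ ^+ position G b; set y := _ ^+ position G' a.
by case: ltngtP => //= _ _; rewrite ?expr0 ?expr1 ?mulr1 ?mulrN1 ?mulNr [y * x]mulrC ?subrr ?addNr.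
Qed.

Lemma incidence_complex : complex inc X (rank X).
Proof.
split=> [F G|F H].
  by rewrite incidence_neq0 => /and4P[FX GX _ /eqP].
have [G /andP[nFG nGH]|none] := pickP [pred G | (inc F G != 0) && (inc G H != 0)]; last first.
  rewrite big1 // => G _; apply/eqP; rewrite mulf_eq0 -[_ || _]negbK negb_or.
  by have /= -> := none G.
have [sq dia] := incidence_signed_thin.
have fFG := nFG; have fGH := nGH; rewrite !incidence_neq0 in fFG fGH.
have [a [FX GX GF aF vG]] := facetP _ _ fFG; have [b [_ HX HG bG vH]] := facetP _ _ fGH.
have [G' [fFG' fG'H ne vG' vH']] := facet_facet fFG fGH aF vG bG vH.
rewrite (bigD1 G) //= (bigD1 G') 1?eq_sym //= big1 ?addr0 => [|G'' /andP[n1 n2]].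
  by apply: dia; rewrite ?incidence_neq0.
apply/eqP; rewrite mulf_eq0 -[_ || _]negbK negb_or !incidence_neq0; apply/negP => /andP[f1 f2].
have [w [_ G''X G''F wF vG'']] := facetP _ _ f1; have [u [_ _ _ uG vH'']] := facetP _ _ f2.
have wH : w \notin vs H by rewrite vH'' vG'' !in_setD1 eqxx /= andbF.
move: wH; rewrite vH vG !in_setD1 wF andbT negb_and !negbK => /orP[] /eqP ew.
  case/eqP: n2; apply: (vertices_of_inj lbX FX) => //; last by rewrite vG'' vG' ew.
    by case/and4P: fFG'.
  by have [? []] := facetP _ _ fFG'.
by case/eqP: n1; apply: (vertices_of_inj lbX FX) => //; rewrite vG'' vG ew.
Qed.

End Incidence.

(** Abstracts the choice of signs. A link has two choices of interest: its own incidences and those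
    inherited from the ambient poset. *)
Definition orientation {K : fieldType} {disp : Order.disp_t} {P : finPOrderType disp}
    (X : {set P}) (inc : P -> P -> K) : Prop :=
  [/\ complex inc X (rank X), signed_thin inc & forall F G, (inc F G != 0) = facet X F G].

Lemma incidence_orientation (K : fieldType) {disp : Order.disp_t} {P : finPOrderType disp}
    (X : {set P}) : locally_boolean X -> orientation X (incidence K X).
Proof.
move=> lbX; split; [exact: incidence_complex | exact: incidence_signed_thin|].
exact: incidence_neq0.
Qed.

(** * Acyclicity by toggling a label *)

Section Orientation.
Context {K : fieldType} {disp : Order.disp_t} {P : finPOrderType disp}.
Implicit Types (F G H v w : P).
Variables (X : {set P}) (inc : P -> P -> K).
Hypothesis lbX : locally_boolean X.
Hypothesis oX : orientation X inc.
Local Notation vs := (vertices_of X).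
Local Notation facet := (facet X).

(** Order-theoretic form of the graded matching: partners differ in the single label [a F], and
    comparable faces of equal [lam] toggle the same label. The shift [d] is 0 for the faces of a
    poset and 1 in the link of a barycenter, where every chain also counts the barycenter itself. *)
Lemma toggle_acyclic (T : finType) (V : P -> {set T}) (d : nat) (Z : {set P})
    (a : P -> T) (tau : P -> P) (lam : P -> nat) :
  lower_ideal Z X ->
  (forall F G H, F \in Z -> G \in Z -> H \in Z -> (G <= F)%O -> (H <= F)%O ->
     (G <= H)%O = (V G \subset V H)) ->
  (forall F, F \in Z -> (rank X F + d)%N = #|V F|) ->
  (forall F, F \in Z -> [/\ tau F \in Z, tau (tau F) = F, a (tau F) = a F & lam (tau F) = lam F]) ->
  (forall F, F \in Z -> V (tau F) = if a F \in V F then V F :\ a F else a F |: V F) ->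
  (forall F, F \in Z -> a F \notin V F -> (F <= tau F)%O) ->
  (forall F G, F \in Z -> G \in Z -> (G <= F)%O -> (lam F <= lam G)%N) ->
  (forall F G, F \in Z -> G \in Z -> (G <= F)%O -> lam G = lam F ->
     a G = a F /\ ((a F \in V F) = (a G \in V G) -> (tau G <= tau F)%O)) ->
  forall r z, z \in cell_span K (cells (rank X) Z r) -> bd inc z = 0 ->
    exists2 w, w \in cell_span K (cells (rank X) Z r.+1) & bd inc w = z.
Proof.
have [cX thin neq0] := oX; move=> [ZX Zlow] Vle rV tauP Vtau le_tau lam_le loc.
have inZ F : F \in Z -> F \in X by move/(subsetP ZX).
have facetV F G : F \in Z -> facet F G ->
    exists w : T, [/\ G \in Z, (G <= F)%O, w \in V F & V G = V F :\ w].
  move=> FZ /and4P[FX GX GF /eqP rF]; have GZ : G \in Z by apply: Zlow (ltW GF).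
  have sub : V G \subset V F by rewrite -(Vle F) // ltW.
  have [|w wF VG] := card_setD1 sub; first by rewrite -!rV // rF addSn.
  by exists w; split=> //; apply: ltW.
have facetI F G : F \in Z -> G \in Z -> (G <= F)%O -> #|V F| = #|V G|.+1 -> facet F G.
  move=> FZ GZ GF; rewrite -!rV // => rF; rewrite /facet !inZ //=.
  by rewrite -(eqn_add2r d) rF addSn eqxx andbT lt_neqAle GF andbT; apply: contra_eqN rF => /eqP->; lia.
have cardtau F : F \in Z -> a F \notin V F -> #|V (tau F)| = #|V F|.+1.
  by move=> FZ aF; rewrite Vtau // (negbTE aF) cardsU1 aF.
have cardtau' F : F \in Z -> a F \in V F -> #|V F| = #|V (tau F)|.+1.
  by move=> FZ aF; rewrite Vtau // aF (cardsD1 (a F) (V F)) aF.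
have Utau F : F \in Z -> (a (tau F) \notin V (tau F)) = ~~ (a F \notin V F).
  move=> FZ; have [_ _ -> _] := tauP F FZ; rewrite Vtau //; case: ifP => /= _.
    by rewrite in_setD1 eqxx.
  by rewrite in_setU1 eqxx.
apply: (@graded_matching_acyclic _ _ _ inc X Z (rank X) lam (fun F => a F \notin V F) tau).
- exact: cX.
- split=> // F G FZ; rewrite neq0 => fFG.
  by have [w []] := facetV F G FZ fFG.
- exact: thin.
- move=> F G FZ; rewrite neq0 => fFG.
  by have [w [GZ GF _ _]] := facetV F G FZ fFG; apply: lam_le.
- by move=> F FZ; have [? ? ? ?] := tauP F FZ; split=> //; apply: Utau.
- move=> F FZ aF; rewrite neq0; have [tZ _ _ _] := tauP F FZ.
  by apply: facetI; rewrite ?le_tau ?cardtau.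
- move=> F G FZ aF; rewrite neq0 => fFG lG.
  have [w [GZ GF wF VG]] := facetV F G FZ fFG; have [aG le_t] := loc F G FZ GZ GF lG.
  have aVG : a G \notin V G by rewrite aG VG in_setD1 (negbTE aF) andbF.
  split=> //; rewrite neq0; have [tF _ _ _] := tauP F FZ; have [tG _ _ _] := tauP G GZ.
  apply: facetI => //; first by rewrite le_t // (negbTE aF) (negbTE aVG).
  by rewrite !cardtau // VG (cardsD1 w (V F)) wF.
move=> F G FZ; rewrite negbK => aF; rewrite neq0 => fFG lG neG.
have [w [GZ GF wF VG]] := facetV F G FZ fFG; have [aG le_t] := loc F G FZ GZ GF lG.
have [tFZ ttF atF _] := tauP F FZ; have [tGZ _ _ _] := tauP G GZ.
have tFF : (tau F <= F)%O by rewrite -{2}ttF le_tau // Utau // negbK.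
have wa : w != a F.
  apply: contra neG => /eqP ew; apply/eqP/le_anti/andP.
  by split; rewrite (Vle F) // Vtau // aF VG ew.
have aVG : a G \in V G by rewrite aG VG in_setD1 eq_sym wa.
rewrite aVG; split=> //; rewrite neq0; apply: facetI => //; first by rewrite le_t // aF aVG.
by apply/eqP; rewrite -eqSS -!cardtau' // VG (cardsD1 w (V F)) wF.
Qed.

(** A simplex is a cone over any of its vertices: toggle a fixed [w], with [lam] constant. *)
Lemma cone_acyclic F : F \in X -> rank X F != 0%N ->
  acyclic_below X inc (rank X) (fun G => G) F.
Proof.
move=> FX; rewrite rank_card // cards_eq0 => /set0Pn[w wF].
set Z := [set G in X | (G <= F)%O].
have ZX : lower_ideal Z X.
  split=> [|G H GX]; first by apply/subsetP => G; rewrite inE => /andP[].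
  by rewrite !inE GX => /andP[_ HF] /le_trans->.
have inZ G : G \in Z -> G \in X /\ (G <= F)%O by rewrite inE => /andP.
pose A G := if w \in vs G then vs G :\ w else w |: vs G.
have [tau tauP] : exists tau : P -> P, forall G, G \in Z -> [/\ tau G \in X, (tau G <= F)%O & vs (tau G) = A G].
  apply: (@fin_all_exists _ (fun _ => P) (fun G p => G \in Z -> [/\ p \in X, (p <= F)%O & vs p = A G])) => G.
  have [/inZ[GX GF]|] := boolP (G \in Z); last by exists F.
  case: (face_exists lbX (F := F) (A := A G)) => // [|H HP]; last by exists H.
  rewrite /A; case: ifP => _; first by rewrite (subset_trans _ (vertices_ofS X GF)) // subsetDl.
  by rewrite subUset sub1set wF vertices_ofS.
have AA G : G \in Z -> A (tau G) = vs G.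
  move=> GZ; have [_ _ vt] := tauP G GZ; rewrite /A vt /A; case: (boolP (w \in vs G)) => wG.
    by rewrite in_setD1 eqxx /= setD1K.
  by rewrite in_setU1 eqxx /= setU1K.
have tauZ G : G \in Z -> tau G \in Z by move=> GZ; have [tX tF _] := tauP G GZ; rewrite inE tX.
have ac := @toggle_acyclic _ vs 0 Z (fun _ => w) tau (fun _ => 0%N) ZX.
move=> r z zc bz; case: (ac _ _ _ _ _ _ _ r z) => //.
- by move=> G H H' /inZ[GX _] /inZ[HX _] /inZ[H'X _]; apply: vertices_of_le.
- by move=> G /inZ[GX _]; rewrite addn0 rank_card.
- move=> G GZ; split=> //; first exact: tauZ.
  have [GX GF] := inZ G GZ; have [tX tF _] := tauP _ GZ; have [ttX ttF e] := tauP _ (tauZ G GZ).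
  by apply: (vertices_of_inj lbX FX); rewrite // e AA.
- by move=> G GZ; have [] := tauP G GZ.
- move=> G GZ wG; have [GX GF] := inZ G GZ; have [tX tF vt] := tauP G GZ.
  by rewrite (vertices_of_le lbX FX) // vt /A (negbTE wG) subsetUr.
- move=> G H GZ HZ HG _; split=> // wGH; have [tGX tGF vtG] := tauP G GZ; have [tHX tHF vtH] := tauP H HZ.
  rewrite (vertices_of_le lbX FX) // vtG vtH /A -wGH; have s := vertices_ofS X HG.
  by case: ifP => _; [apply: setSD | apply: setUS].
- apply: (subvP (cell_span_subset _)) zc; apply/subsetP => G; rewrite !inE.
  by move=> /and3P[-> -> ->].
move=> y yc by_; exists y => //; apply: (subvP (cell_span_subset _)) yc.
by apply/subsetP => G; rewrite !inE => /andP[/andP[-> ->] ->].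
Qed.

End Orientation.

(** * Vertex links and the Morse inequalities *)

Section Links.
Context {disp : Order.disp_t} {P : finPOrderType disp}.
Implicit Types (X Y W : {set P}) (F G v : P).

Lemma link_labels X v F (T : finType) (V : P -> {set T}) : v \in X -> F \in link X v ->
  boolean_labels X F V -> boolean_labels (link X v) F (fun G => V G :\: V v).
Proof.
move=> vX; rewrite inE => /andP[FX vF] [Vle Vsub].
have vS G : G \in X -> (G <= F)%O -> (v <= G)%O = (V v \subset V G) by move=> *; apply: Vle.
split=> [G H|A AF].
  rewrite !inE => /andP[GX vG] /andP[HX vH] GF HF; rewrite Vle //.
  have sG : V v \subset V G by rewrite -vS.
  have sH : V v \subset V H by rewrite -vS.
  apply/idP/idP => [|sub]; first exact: setSD.
  by rewrite -(setID (V G) (V v)) (setIidPr sG) subUset sH (subset_trans sub) ?subsetDl.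
have [|G [GX GF VG]] := Vsub (A :|: V v).
  by rewrite subUset (subset_trans AF) ?subsetDl // -vS.
exists G; split=> //; first by rewrite inE GX vS // VG subsetUr.
rewrite VG setDUl setDv setU0; apply/setDidPl; rewrite disjoints_subset.
by apply: subset_trans AF _; rewrite setDE subsetIr.
Qed.

Lemma link_locally_boolean X v : v \in X -> locally_boolean X -> locally_boolean (link X v).
Proof.
move=> vX lbX F FL; have FX : F \in X by move: FL; rewrite inE => /andP[].
have [T [V bl]] := lbX F FX; exists T, (fun G => V G :\: V v).
exact: link_labels.
Qed.

Lemma rank_link X v F : v \in X -> locally_boolean X -> F \in link X v ->
  (rank (link X v) F + rank X v)%N = rank X F.
Proof.
move=> vX lbX FL; have := FL; rewrite inE => /andP[FX vF].
have [T [V bl]] := lbX F FX; rewrite (rank_labels FL (link_labels vX FL bl)).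
rewrite (rank_labels vX (boolean_labels_below FX vX vF bl)) (rank_labels FX bl).
by rewrite cardsD (setIidPr _) ?subnK ?subset_leq_card // -bl.1.
Qed.

End Links.

Definition vlink {disp : Order.disp_t} {P : finPOrderType disp} (X : {set P}) (s : seq P)
    (v : P) : {set P} := link (restrict X (upto s v)) v.

(** * The filtration by the last vertex *)

Section Morse.
Context {disp : Order.disp_t} {P : finPOrderType disp}.
Variables (K : fieldType) (X Y : {set P}) (e : P) (s : seq P).
Hypothesis lbX : locally_boolean X.
Hypothesis minX : minimals X = [set e].
Hypothesis YX : lower_ideal Y X.
Hypothesis sP : vertex_ordering X s.
Implicit Types (F G v w : P).
Local Notation vs := (vertices_of X).
Local Notation vlinkY := (vlink Y s).
Local Notation vlink := (vlink X s).
Local Notation inc := (incidence K X).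

Lemma mem_ordering v : (v \in s) = (v \in vertices X).
Proof. by rewrite (perm_mem sP) mem_enum. Qed.

Lemma uniq_ordering : uniq s.
Proof. by rewrite (perm_uniq sP) enum_uniq. Qed.

Lemma mem_upto (r : seq P) v w : w \in r -> (w \in upto r v) = (index w r <= index v r)%N.
Proof.
move=> wr; rewrite inE -ltnS; have [le|lt] := leqP (size r) (index v r).+1.
  rewrite take_oversize // wr; apply/esym; apply: leq_trans le; by rewrite index_mem.
by rewrite in_take_leq // ltnW.
Qed.

Lemma vs_vertices F v : v \in vs F -> v \in vertices X.
Proof. by rewrite inE => /andP[]. Qed.

Lemma mem_vs v F : v \in vertices X -> (v \in vs F) = (v <= F)%O.
Proof. by move=> vV; rewrite inE vV. Qed.

Lemma vertex_in_X v : v \in vertices X -> v \in X.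
Proof. by rewrite inE => /andP[]. Qed.

Lemma rank_vertex v : v \in vertices X -> rank X v = 1%N.
Proof. by rewrite inE => /andP[_ /eqP]. Qed.

Lemma vs_vertex v : v \in vertices X -> vs v = [set v].
Proof.
move=> vV; have vX := vertex_in_X vV; have := rank_vertex vV.
rewrite (rank_card lbX) // => /eqP/cards1P[w e1]; suff : v \in vs v by rewrite e1 => /set1P->.
by rewrite inE vV lexx.
Qed.

Lemma mem_vlink v F : v \in s ->
  (F \in vlink v) = [&& F \in X, v \in vs F & [forall w in vs F, (index w s <= index v s)%N]].
Proof.
rewrite mem_ordering => vV; rewrite inE [F \in restrict _ _]inE mem_vs // -andbA; case: (F \in X) => //=.
rewrite andbC; congr (_ && _); apply/subsetP/forall_inP => h w wF.
  by rewrite -mem_upto ?h // mem_ordering (vs_vertices wF).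
by rewrite mem_upto ?h // mem_ordering (vs_vertices wF).
Qed.

Lemma mem_vlinkY v F : v \in s -> (F \in vlinkY v) = (F \in vlink v) && (F \in Y).
Proof.
move=> vs_; rewrite !inE; have [FY|] := boolP (F \in Y); rewrite ?andbF //=.
by rewrite (subsetP YX.1 _ FY) (vertices_of_lower YX FY) andbT.
Qed.

Lemma vlink_lower v : lower_ideal (restrict X (upto s v)) X.
Proof. exact: lower_restrict. Qed.

Lemma vertex_in_restrict v : v \in s -> v \in restrict X (upto s v).
Proof.
move=> vs_; have vV : v \in vertices X by rewrite -mem_ordering.
by rewrite inE vertex_in_X // vs_vertex // sub1set mem_upto ?leqnn.
Qed.

Lemma vlink_locally_boolean v : v \in s -> locally_boolean (vlink v).
Proof.
move=> vs_; apply: link_locally_boolean; first exact: vertex_in_restrict.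
exact: lower_locally_boolean (vlink_lower v) lbX.
Qed.

Lemma rank_vlink v F : v \in s -> F \in vlink v -> rank X F = (rank (vlink v) F).+1.
Proof.
move=> vs_ FL; have FR : F \in restrict X (upto s v) by move: FL; rewrite inE => /andP[].
rewrite -(rank_lower (vlink_lower v) FR).
rewrite -(rank_link (vertex_in_restrict vs_) (lower_locally_boolean (vlink_lower v) lbX) FL).
rewrite (rank_lower (vlink_lower v) (vertex_in_restrict vs_)) rank_vertex ?addn1 //.
by rewrite -mem_ordering.
Qed.

Lemma vlink_vertex v : v \in s -> v \in vlink v.
Proof. by move=> vs_; rewrite inE vertex_in_restrict ?lexx. Qed.

Lemma vlink_le v F : F \in vlink v -> (v <= F)%O.
Proof. by rewrite inE => /andP[]. Qed.

Lemma vlink_rank0 v F : v \in s -> F \in vlink v -> rank (vlink v) F = 0%N -> F = v.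
Proof.
move=> vs_ FL r0; have vF := vlink_le FL; have FX : F \in X by move: FL; rewrite mem_vlink // => /and3P[].
have vV : v \in vertices X by rewrite -mem_ordering.
have := rank_vlink vs_ FL; rewrite r0 (rank_card lbX FX) => /eqP/cards1P[w eF].
apply: (vertices_of_inj lbX FX); rewrite ?lexx ?(vertex_in_X vV) //.
rewrite (vs_vertex vV) eF; have : v \in vs F by rewrite inE vV.
by rewrite eF => /set1P->.
Qed.

Lemma rank_vlink_vertex v : v \in s -> rank (vlink v) v = 0%N.
Proof.
move=> vs_; have := rank_vlink vs_ (vlink_vertex vs_).
by rewrite rank_vertex -?mem_ordering // => -[].
Qed.

Lemma facet_vlink v F G : v \in s -> facet (vlink v) F G = [&& F \in vlink v, G \in vlink v & facet X F G].
Proof.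
move=> vs_; rewrite /facet; case: (boolP (F \in vlink v)) => // FL; case: (boolP (G \in vlink v)) => //= GL.
have -> : F \in X by move: FL; rewrite mem_vlink // => /and3P[].
have -> : G \in X by move: GL; rewrite mem_vlink // => /and3P[].
by rewrite !(rank_vlink vs_) // eqSS.
Qed.

Lemma vlink_convex v F G H : v \in s -> F \in vlink v -> H \in vlink v -> G \in X ->
  (H <= G)%O -> (G <= F)%O -> G \in vlink v.
Proof.
rewrite mem_ordering => vV; rewrite !inE => /andP[/andP[FX FW] _] /andP[_ vH] GX HG GF.
by rewrite GX (le_trans vH HG) andbT; apply: subset_trans (vertices_ofS X GF) FW.
Qed.

(** The link is convex in [X]: every face between two of its faces belongs to it, so masking loses
    no term of [bd bd = 0]. *)
Lemma mask_orientation v : v \in s -> orientation (vlink v) (mask inc (vlink v)).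
Proof.
move=> vs_; have [[inc0 dd] [sq dia] neq0] := incidence_orientation K lbX.
have nz F G : (mask inc (vlink v) F G != 0) = facet (vlink v) F G.
  by rewrite facet_vlink // /mask -neq0; case: (F \in _); case: (G \in _); rewrite ?eqxx.
have incm F G : mask inc (vlink v) F G != 0 -> mask inc (vlink v) F G = inc F G.
  by rewrite /mask; case: ifP; rewrite ?eqxx.
have incn F G : mask inc (vlink v) F G != 0 -> inc F G != 0 by move=> h; rewrite -incm.
split=> //; [split|split].
- by move=> F G; rewrite nz => /and4P[? ? _ /eqP].
- move=> F H; have [FL|FL] := boolP (F \in vlink v); last first.
    by rewrite big1 // => G _; rewrite /mask (negbTE FL) mul0r.
  have [HL|HL] := boolP (H \in vlink v); last first.
    by rewrite big1 // => G _; rewrite /mask (negbTE HL) andbF mulr0.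
  rewrite -[RHS](dd F H); apply: eq_bigr => G _; rewrite /mask FL HL /= andbT.
  case: (boolP (G \in vlink v)) => // GL; rewrite mul0r; apply/esym/eqP; rewrite mulf_eq0.
  apply: contraNT GL; rewrite negb_or !neq0 => /andP[/and4P[_ GX GF _] /and4P[_ _ HG _]].
  by apply: (vlink_convex vs_ FL HL GX); apply: ltW.
- by move=> F G h; rewrite incm // sq // incn.
move=> F G G' H ne h1 h2 h3 h4.
by rewrite (incm _ _ h1) (incm _ _ h2) (incm _ _ h3) (incm _ _ h4) dia // incn.
Qed.

Lemma vlink_carrier v (o : P -> P -> K) : v \in s -> orientation (vlink v) o ->
  carrier_complex (vlink v) (vlink v) o (rank (vlink v)) (fun F => F) v.
Proof.
move=> vs_ [cL _ neq0]; split=> //.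
  by move=> F G; rewrite neq0 => /and4P[_ _ /ltW].
exists v; split; [exact: vlink_vertex | exact: rank_vlink_vertex | by [] |].
by move=> F; apply: vlink_rank0.
Qed.

Lemma vlinkY_low v : v \in s ->
  forall F G, F \in vlink v -> G \in vlinkY v -> (F <= G)%O -> F \in vlinkY v.
Proof.
move=> vs_ F G FL; rewrite !mem_vlinkY // FL => /andP[_ GY] FG; apply: (YX.2) GY FG.
by move: FL; rewrite mem_vlink // => /and3P[].
Qed.

Lemma over_vlinkY v : v \in s -> over (vlinkY v) (vlink v) (fun F => F) = vlinkY v.
Proof. by move=> vs_; apply/setP => F; rewrite inE mem_vlinkY //; case: (F \in vlink v). Qed.

Lemma vlink_acyclic v (o : P -> P -> K) F : v \in s -> orientation (vlink v) o ->
  F \in vlink v -> F != v -> acyclic_below (vlink v) o (rank (vlink v)) (fun G => G) F.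
Proof.
move=> vs_ oL FL nF; apply: cone_acyclic => //; first exact: vlink_locally_boolean.
by apply: contra nF => /eqP/(vlink_rank0 vs_ FL)->.
Qed.

(** Inherited and intrinsic signs give different boundary maps on the same poset. With every face as
    its own carrier, the carriers above [v] are simplices, hence acyclic for both, and the Betti
    numbers agree. *)
Lemma betti_vlink v r : v \in s ->
  cbetti (mask inc (vlink v)) (vlink v) (vlinkY v) (rank (vlink v)) r =
  reduced_betti_pred K (vlink v) (vlinkY v) r.
Proof.
move=> vs_; rewrite reduced_betti_predE.
have o1 := mask_orientation vs_.
have o2 := incidence_orientation K (vlink_locally_boolean vs_).
have := carrier_cbetti_eq (vlinkY_low vs_) r (vlink_carrier vs_ o1) (vlink_carrier vs_ o2)
  (fun l lL => vlink_acyclic vs_ o1 lL) (fun l lL => vlink_acyclic vs_ o2 lL).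
have r0 F : F \in vlink v -> rank (vlink v) F != 0%N -> F != v.
  by move=> _; apply: contra => /eqP->; rewrite rank_vlink_vertex.
by rewrite over_vlinkY // => ->.
Qed.

Let D := X :\: (Y :|: [set e]).

Let block v := vlink v :\: vlinkY v.

(** A face of rank [r] in the link of [v] has rank [r.+1] in [X], whence the shift of the
    indices. *)
Lemma betti_vlink_brank v j : v \in s ->
  (reduced_betti_pred K (vlink v) (vlinkY v) j + brank inc (block v) (rank X) j.+1
    + brank inc (block v) (rank X) j.+2 = #|cells (rank X) (block v) j.+1|)%N.
Proof.
move=> vs_; rewrite -betti_vlink //; have [cL _ _] := mask_orientation vs_.
have sub : subcomplex (mask inc (vlink v)) (vlinkY v) (vlink v).
  by rewrite -[X in subcomplex _ X _](over_vlinkY vs_); apply: (over_subcomplex (vlinkY_low vs_) (vlink_carrier vs_ (mask_orientation vs_))).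
have cellsE r : cells (rank (vlink v)) (block v) r = cells (rank X) (block v) r.+1.
  apply/setP => F; rewrite [LHS]inE [RHS]inE; case: (boolP (F \in block v)) => //.
  by move=> /setDP[FL _]; rewrite (rank_vlink vs_) // eqSS.
have brankE r : brank (mask inc (vlink v)) (block v) (rank (vlink v)) r = brank inc (block v) (rank X) r.+1.
  rewrite /brank cellsE; congr (\dim (_ @: _)).
  apply: eq_lfun_cell => F; apply/ffunP => G; rewrite !bd_cell /mask.
  by case: (boolP (F \in block v)) => //= /setDP[-> _]; case: (boolP (G \in block v)) => //= /setDP[-> _].
by rewrite -!brankE -cellsE -(cbetti_brank j cL sub).
Qed.

(** Dimension [j] is rank [j.+1], and adding [e] to the subcomplex removes the augmentation. *)
Lemma betti_brank j : (betti K X Y j + brank inc D (rank X) j.+1 + brank inc D (rank X) j.+2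
  = #|cells (rank X) D j.+1|)%N.
Proof.
rewrite /betti minX reduced_betti_predE; apply: cbetti_brank; first exact: incidence_complex.
split; first by rewrite subUset YX.1 sub1set (minimals_bottom minX).1.
move=> F G; rewrite !in_setU !in_set1 incidence_neq0 => FY /and4P[FX GX /ltW GF _].
apply/orP; case/orP: FY => [FY|/eqP Fe]; [left|right].
  exact: (YX.2) FY GF.
by rewrite -Fe eq_le GF Fe (minimals_bottom minX).2.
Qed.

(** The maximum over no vertices is 0, so the empty face gets the value of the first vertex; this is
    why [F != e] accompanies it below. *)
Definition last_index F : nat := \max_(v in vs F) index v s.

Lemma vs_bottom : vs e = set0.
Proof.
have [eX ele] := minimals_bottom minX.
have [G [GX Ge vG]] := face_exists lbX eX (sub0set (vs e)).
by rewrite -vG; congr (vs _); apply/le_anti; rewrite Ge ele.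
Qed.

Lemma vs_eq0 F : F \in X -> (vs F == set0) = (F == e).
Proof.
move=> FX; have [eX ele] := minimals_bottom minX.
apply/eqP/eqP => [vF|->]; last exact: vs_bottom.
by apply: (vertices_of_inj lbX FX); rewrite ?ele ?vF ?vs_bottom.
Qed.

Lemma last_index_vertex F : F \in X -> F != e -> exists w, [/\ w \in s, w \in vs F & last_index F = index w s].
Proof.
move=> FX; rewrite -vs_eq0 // => /set0Pn[w0 w0F].
rewrite /last_index; have [|w wF ->] := @eq_bigmax_cond _ [in vs F] (fun w => index w s).
  by apply/card_gt0P; exists w0.
by exists w; split=> //; rewrite mem_ordering (vs_vertices wF).
Qed.

Lemma vlink_last_index v F : v \in s ->
  (F \in vlink v) = [&& F \in X, F != e & last_index F == index v s].
Proof.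
move=> vs_; rewrite mem_vlink //; case: (boolP (F \in X)) => //= FX.
apply/andP/andP => -[].
  move=> vF /forall_inP le_v; split; first by rewrite -vs_eq0 //; apply/set0Pn; exists v.
  rewrite eqn_leq; apply/andP; split; first by apply/bigmax_leqP.
  exact: (leq_bigmax_cond (F := fun w => index w s)).
move=> Fe /eqP e1; have [w [ws wF e2]] := last_index_vertex FX Fe.
have ewv : w = v by rewrite -(nth_index e ws) -e2 e1 nth_index.
rewrite -ewv; split=> //; apply/forall_inP => u uF; rewrite -e2.
exact: (leq_bigmax_cond (F := fun w => index w s)).
Qed.

Lemma block_last_index v : v \in s -> block v = [set F in D | last_index F == index v s].
Proof.
move=> vs_; apply/setP => F; rewrite in_setD mem_vlinkY // vlink_last_index //.
rewrite /D in_set in_setD in_setU in_set1.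
by case: (F \in X); case: (F \in Y); case: (F == e); case: (last_index F == _).
Qed.

Lemma last_index_lt F : F \in D -> (last_index F < size s)%N.
Proof.
rewrite !inE negb_or => /andP[/andP[_ Fe] FX].
by have [w [ws _ ->]] := last_index_vertex FX Fe; rewrite index_mem.
Qed.

Lemma last_index_mono F G : facet X F G -> (last_index G <= last_index F)%N.
Proof.
move=> /and4P[_ _ /ltW/(vertices_ofS X)/subsetP GF _]; apply/bigmax_leqP => w /GF wF.
exact: (leq_bigmax_cond (F := fun w => index w s)).
Qed.

Lemma sum_ordering (f : P -> nat) : (\sum_(v <- s) f v = \sum_(k < size s) f (nth e s k))%N.
Proof. by rewrite (big_nth e) big_mkord. Qed.

(** Passing to a facet cannot raise the last vertex, so the boundary is block triangular. *)
Lemma sum_block_brank r :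
  (\sum_(v <- s) brank inc (block v) (rank X) r <= brank inc D (rank X) r)%N.
Proof.
rewrite sum_ordering; under eq_bigr => k _ do
  rewrite block_last_index ?mem_nth // index_uniq ?uniq_ordering //.
by apply: brank_blocks => F G _ _; rewrite incidence_neq0; apply: last_index_mono.
Qed.

Lemma sum_block_cells r :
  (\sum_(v <- s) #|cells (rank X) (block v) r| = #|cells (rank X) D r|)%N.
Proof.
rewrite sum_ordering; under eq_bigr => k _ do
  rewrite block_last_index ?mem_nth // index_uniq ?uniq_ordering //.
(* Without vertices [D] is empty. Otherwise the first ordinal can serve as the default of [insubd],
   which is never taken on [D]. *)
have [/size0nil s0|sz] := posnP (size s).
  rewrite s0 big_ord0; apply/esym/eqP; rewrite cards_eq0 -subset0; apply/subsetP => F.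
  by rewrite inE => /andP[/last_index_lt]; rewrite s0.
rewrite -[RHS]sum1_card (partition_big (fun F => insubd (Ordinal sz) (last_index F)) predT) //=.
apply: eq_bigr => k _; rewrite -sum1_card; apply: eq_bigl => F.
rewrite inE [F \in [set _ in _ | _]]inE [in RHS]inE.
have [FD|//] := boolP (F \in D).
by rewrite -val_eqE /= val_insubd (last_index_lt FD) andbC.
Qed.

(** The only facet of a vertex is the empty face, absent from [A]. This lets the telescoping start
    from 0. *)
Lemma brank1 (A : {set P}) : e \notin A -> brank inc A (rank X) 1 = 0%N.
Proof.
move=> eA; apply/eqP; rewrite dimv_eq0 -subv0; apply/subvP => _ /memv_imgP[c cA ->].
rewrite memv0; apply/eqP/ffunP => G; rewrite bdE ffunE big1 // => F _.
have [FA|FA] := boolP (F \in cells (rank X) A 1); last by move/mem_cell_span: cA => ->; rewrite ?mul0r.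
rewrite /mask; case: ifP => [/andP[_ GA]|]; last by rewrite mulr0.
have [->|] := eqVneq (inc F G) 0; first by rewrite mulr0.
rewrite incidence_neq0 => /and4P[_ GX _]; move: FA; rewrite inE => /andP[_ /eqP->].
rewrite eqSS eq_sym (rank_card lbX) // cards_eq0 vs_eq0 // => /eqP eG.
by rewrite -eG GA in eA.
Qed.

End Morse.

Lemma alt_sum_rec a i : alt_sum a i.+1 = a i.+1 - alt_sum a i.
Proof.
rewrite /alt_sum big_ord_recr /= subnn expr0 mul1r addrC -sumrN; congr (_ + _).
apply: eq_bigr => j _; rewrite subSn; last by rewrite -ltnS.
by rewrite exprS mulN1r mulNr.
Qed.

(** For [a] the Betti numbers, [c] the cell counts and [p] the ranks of the boundary maps:
    neighbouring ranks cancel, and only the last one survives, with a minus sign. *)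
Lemma alt_sum_telescope (a p c : nat -> rat) i :
  (forall j, a j + p j + p j.+1 = c j) -> p 0%N = 0 -> alt_sum a i = alt_sum c i - p i.+1.
Proof.
move=> apc p0; elim: i => [|i IHi].
  by rewrite /alt_sum !big_ord1 subnn !expr0 !mul1r -apc p0 addr0 addrK.
by rewrite !alt_sum_rec IHi -(apc i.+1); ring.
Qed.

Lemma morse_inequality {disp : Order.disp_t} {P : finPOrderType disp} (K : fieldType)
    (X Y : {set P}) (s : seq P) i :
  relative_simplicial_poset X Y -> vertex_ordering X s ->
  alt_sum (fun j => (betti K X Y j)%:R) i <= alt_sum (fun j => (mu_ord K X Y s j)%:R) i.
Proof.
move=> [sX YX] sP; have lbX := simplicial_locally_boolean sX; have [e minX _] := sX.
pose D := X :\: (Y :|: [set e]); pose block v := vlink X s v :\: vlink Y s v.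
pose rho r : rat := (brank (incidence K X) D (rank X) r)%:R.
pose rhos r : rat := (\sum_(v <- s) brank (incidence K X) (block v) (rank X) r)%N%:R.
pose c j : rat := #|cells (rank X) D j.+1|%:R.
have eD : e \notin D by rewrite !inE eqxx orbT.
(* Both sides become the same alternating cell count minus one rank, so what remains is to compare
   [rhos] with [rho] in the last degree. *)
rewrite (@alt_sum_telescope _ (fun j => rho j.+1) c); first last.
- by rewrite /rho (brank1 K lbX minX eD).
- by move=> j; rewrite -!natrD (betti_brank K lbX minX YX).
rewrite (@alt_sum_telescope (fun j => (mu_ord K X Y s j)%:R) (fun j => rhos j.+1) c); first last.
- apply/eqP; rewrite pnatr_eq0 -leqn0; apply: leq_trans (sum_block_brank K lbX minX YX sP 1) _.
  by rewrite (brank1 K lbX minX eD).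
- move=> j /=; rewrite /rhos /mu_ord -!natrD; rewrite -!big_split /= /c -(sum_block_cells lbX minX YX sP).
  congr _%:R; apply: eq_big_seq => v vs_.
  exact: betti_vlink_brank.
by rewrite lerD2l lerN2 ler_nat; apply: sum_block_brank.
Qed.

Lemma mu_morse_inequality {disp : Order.disp_t} {P : finPOrderType disp} (K : fieldType)
    (X Y : {set P}) i :
  relative_simplicial_poset X Y ->
  alt_sum (fun j => (betti K X Y j)%:R) i <= alt_sum (fun j => mu K X Y j) i.
Proof.
move=> rXY; set V := enum (vertices X); set N : rat := (#|vertices X|`!)%:R.
have N_gt0 : 0 < N by rewrite ltr0n fact_gt0.
have szP : (size (permutations V))%:R = N.
  by rewrite /N size_permutations ?enum_uniq // -cardE.
have -> : alt_sum (fun j => mu K X Y j) i =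
    N^-1 * \sum_(s <- permutations V) alt_sum (fun j => (mu_ord K X Y s j)%:R) i.
  rewrite /alt_sum exchange_big /= mulr_sumr; apply: eq_bigr => j _.
  by rewrite -mulr_sumr /mu mulrCA.
rewrite ler_pdivlMl // -szP; set B := alt_sum _ i.
have -> : (size (permutations V))%:R * B = \sum_(s <- permutations V) B.
  by rewrite big_const_seq count_predT iter_addr_0 mulr_natl.
rewrite big_seq [leRHS]big_seq; apply: ler_sum => s; rewrite mem_permutations => sP.
exact: morse_inequality.
Qed.

(** * Barycentric subdivision *)

Section Chains.
Context {disp : Order.disp_t} {P : finPOrderType disp}.
Implicit Types (C D X : {set P}) (F G : P).

Lemma leEsubset C D : (C <= D)%O = (C \subset D).
Proof. by []. Qed.

Lemma is_chainP C : reflect {in C &, forall F G, (F >=< G)%O} (is_chain C).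
Proof.
apply: (iffP forall_inP) => [h F G FC GC | h F FC]; first exact: (forall_inP (h F FC)).
by apply/forall_inP => G GC; apply: h.
Qed.

Lemma is_chainS C D : D \subset C -> is_chain C -> is_chain D.
Proof. by move=> /subsetP DC /is_chainP h; apply/is_chainP => F G /DC FC /DC; apply: h. Qed.

Lemma is_chainU1 C F : is_chain C -> (forall G, G \in C -> (F >=< G)%O) -> is_chain (F |: C).
Proof.
move=> /is_chainP h hF; apply/is_chainP => G H /setU1P[->|GC] /setU1P[->|HC].
- exact: comparablexx.
- exact: hF.
- by rewrite comparable_sym hF.
exact: h.
Qed.

Lemma chain_max C F : is_chain C -> F \in C -> exists2 G, G \in C & forall H, H \in C -> (H <= G)%O.
Proof.
move=> /is_chainP h FC; pose f G := #|[set H in C | (H <= G)%O]|.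
case: (@arg_maxnP _ F [in C] f FC) => G GC maxG; exists G => // H HC.
have /orP[//|GH] := h H G HC GC; have := maxG H HC; rewrite /f /= leqNgt => /negP; have [->//|ne] := eqVneq H G.
case; apply: proper_card; apply/properP; split.
  by apply/subsetP => A; rewrite !inE => /andP[-> /le_trans->].
exists H; rewrite !inE HC ?lexx //=; apply: contra ne => HG.
by rewrite eq_le HG GH.
Qed.

Lemma chain_min C F : is_chain C -> F \in C -> exists2 G, G \in C & forall H, H \in C -> (G <= H)%O.
Proof.
move=> /is_chainP h FC; pose f G := #|[set H in C | (H <= G)%O]|.
case: (@arg_minnP _ F [in C] f FC) => G GC minG; exists G => // H HC.
have /orP[//|HG] := h G H GC HC; have := minG H HC; rewrite /f /= leqNgt => /negP; have [->//|ne] := eqVneq H G.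
case; apply: proper_card; apply/properP; split.
  by apply/subsetP => A; rewrite !inE => /andP[-> /le_trans->].
exists G; rewrite !inE GC ?lexx //=; apply: contra ne => GH.
by rewrite eq_le HG GH.
Qed.

End Chains.

(** * Links of barycenters in the subdivision *)

Section Subdivision.
Context {disp : Order.disp_t} {P : finPOrderType disp}.
Variables (K : fieldType) (X Y : {set P}) (e : P) (s : seq P) (b : P -> seq P).
Hypothesis lbX : locally_boolean X.
Hypothesis minX : minimals X = [set e].
Hypothesis YX : lower_ideal Y X.
Hypothesis sP : vertex_ordering X s.
Hypothesis bP : forall v, v \in s ->
  perm_eq (b v) (enum [set F in link (restrict X (upto s v)) v | (1 < rank X F)%N]) /\
  sorted (fun F G => (rank X F <= rank X G)%N) (b v).
Implicit Types (F G H v w : P) (C D : {set P}).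
Local Notation vs := (vertices_of X).
Local Notation vlinkY := (vlink Y s).
Local Notation vlink := (vlink X s).
Local Notation last_index := (last_index X s).

Let faces := flatten [seq rcons (b v) v | v <- s].
Let t := [seq [set F] | F <- faces].
Let sdlink F := link (restrict (sd X) (upto t [set F])) [set F].
Let sdlinkY F := link (restrict (sd Y) (upto t [set F])) [set F].

Let eX : e \in X. Proof. exact: (minimals_bottom minX).1. Qed.
Let ele F : F \in X -> (e <= F)%O. Proof. exact: (minimals_bottom minX).2. Qed.

Lemma mem_sd C : (C \in sd X) = is_chain C && (C \subset X :\ e).
Proof.
have /negbTE X0 : X != set0 by apply/set0Pn; exists e.
by rewrite /sd X0 inE minX.
Qed.

(** The empty chain is excluded because it lies in [sd X] but not in the subdivision of the void
    poset. *)
Lemma mem_sdY C : C != set0 -> (C \in sd Y) = (C \in sd X) && (C \subset Y).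
Proof.
move=> C0; rewrite mem_sd /sd; have [->|Y0] := eqVneq Y set0.
  by rewrite inE subset0 (negbTE C0) andbF.
have eY : e \in Y.
  by have [F FY] := set0Pn _ Y0; apply: (YX.2) FY (ele (subsetP YX.1 _ FY)).
have -> : minimals Y = [set e].
  apply/setP => F; rewrite !inE; apply/andP/eqP => [[FY /forall_inP h]|->].
    by apply/esym/eqP; move: (h e eY); rewrite ele // (subsetP YX.1).
  split=> //; apply/forall_inP => G GY; apply/implyP => Ge.
  by apply/eqP/le_anti; rewrite Ge ele // (subsetP YX.1).
rewrite inE -andbA; case: (is_chain C) => //=; apply/subsetP/andP => [h|[/subsetP h1 /subsetP h2] F FC].
  by split; apply/subsetP => F /h; rewrite !inE => /andP[Fe FY]; rewrite ?Fe ?(subsetP YX.1).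
by have := h1 F FC; rewrite !inE => /andP[-> _]; rewrite h2.
Qed.

Lemma sd_locally_boolean : locally_boolean (sd X).
Proof.
move=> C; rewrite mem_sd => /andP[chC CX]; exists P, id; split=> [D D' _ _ _ _|A AC].
  by rewrite leEsubset.
by exists A; rewrite mem_sd (is_chainS AC) // (subset_trans AC) // leEsubset.
Qed.

Lemma rank_sd C : C \in sd X -> rank (sd X) C = #|C|.
Proof.
move=> CX; have := CX; rewrite mem_sd => /andP[chC CXe].
apply: (rank_labels (V := id) CX); split=> [D D' _ _ _ _|A AC].
  by rewrite leEsubset.
by exists A; rewrite mem_sd (is_chainS AC) // (subset_trans AC) // leEsubset.
Qed.

Lemma vertices_of_sd C : C \in sd X -> vertices_of (sd X) C = [set [set F] | F in C].
Proof.
move=> CX; apply/setP => D; rewrite !inE; apply/andP/imsetP.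
  move=> [/andP[DX]]; rewrite rank_sd // => /cards1P[F ->].
  by rewrite leEsubset sub1set => FC; exists F.
case=> F FC ->; have sX : [set F] \in sd X.
  have := CX; rewrite !mem_sd sub1set => /andP[chC /subsetP/(_ F FC)->]; rewrite andbT.
  by apply: is_chainS chC; rewrite sub1set.
by rewrite sX rank_sd // cards1 leEsubset sub1set.
Qed.

Lemma mem_upto_faces F G : ([set G] \in upto t [set F]) = (G \in take (index F faces).+1 faces).
Proof. by rewrite inE /t index_map ?map_take //; [rewrite -map_take mem_map // |]; apply: set1_inj. Qed.

Lemma mem_sdlink F C : (C \in sdlink F) =
  [&& is_chain C, C \subset X :\ e, F \in C & [forall G in C, G \in take (index F faces).+1 faces]].
Proof.
rewrite /sdlink /link inE [C \in restrict _ _]inE leEsubset sub1set mem_sd -!andbA.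
case chC: (is_chain C) => //=; case CX: (C \subset X :\ e) => //=.
rewrite vertices_of_sd ?mem_sd ?chC // andbC; congr (_ && _).
apply/subsetP/forall_inP => [h G GC|h _ /imsetP[G GC ->]]; last by rewrite mem_upto_faces h.
by rewrite -mem_upto_faces h // imset_f.
Qed.

Lemma mem_sdlinkY F C : (C \in sdlinkY F) = (C \in sdlink F) && (C \subset Y).
Proof.
have lowY : lower_ideal (sd Y) (sd X).
  have sub : sd Y \subset sd X.
    apply/subsetP => D; have [->|D0] := eqVneq D set0; last by rewrite mem_sdY // => /andP[].
    by move=> _; rewrite mem_sd sub0set andbT; apply/is_chainP => ?; rewrite inE.
  split=> // D D' DX D'Y; rewrite leEsubset => DD'; have [D0|D0] := eqVneq D set0.
    move: D'Y; rewrite /sd; case: ifP; rewrite !inE // => _ _.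
    by rewrite D0 sub0set andbT; apply/is_chainP => ?; rewrite inE.
  have D'0 : D' != set0 by apply: contraNneq D0 => e1; rewrite e1 subset0 in DD'.
  by move: D'Y; rewrite !mem_sdY // DX => /andP[_]; apply: subset_trans.
rewrite /sdlinkY /sdlink /link !inE leEsubset sub1set; case FC: (F \in C); rewrite ?andbF // !andbT.
have C0 : C != set0 by apply/set0Pn; exists F.
have := mem_sdY C0; case CY: (C \in sd Y) => /esym.
  by move=> /andP[-> ->]; rewrite (vertices_of_lower lowY CY) andbT.
by case: (C \in sd X) => //= ->; rewrite andbF.
Qed.

Lemma mem_b v F : v \in s -> (F \in b v) = (F \in vlink v) && (1 < rank X F)%N.
Proof. by move=> vs_; have [/perm_mem-> _] := bP vs_; rewrite mem_enum inE. Qed.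

Lemma mem_block v F : v \in s -> (F \in rcons (b v) v) = (F \in vlink v).
Proof.
move=> vs_; rewrite mem_rcons inE mem_b //; have [->|ne] /= := eqVneq F v; first by rewrite vlink_vertex.
case: (boolP (F \in vlink v)) => //= FL; rewrite (rank_vlink lbX sP vs_ FL) ltnS lt0n.
by apply: contra ne => /eqP/(vlink_rank0 lbX sP vs_ FL)->.
Qed.

Lemma mem_prefix v F : v \in s ->
  (F \in flatten [seq rcons (b w) w | w <- take (index v s) s]) =
  [&& F \in X, F != e & (last_index F < index v s)%N].
Proof.
move=> vs_; apply/flatten_mapP/and3P.
  move=> [w wt]; have ws := mem_take wt; rewrite mem_block // (vlink_last_index lbX minX sP) //.
  by move=> /and3P[-> -> /eqP->]; split=> //; rewrite -(in_take _ ws).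
move=> [FX Fe lF]; have [w [ws wF lw]] := last_index_vertex lbX minX sP FX Fe.
exists w; first by rewrite in_take // -lw.
by rewrite mem_block // (vlink_last_index lbX minX sP) // FX Fe lw eqxx.
Qed.

Lemma faces_split v : v \in s -> exists r, faces =
  flatten [seq rcons (b w) w | w <- take (index v s) s] ++ b v ++ v :: r.
Proof.
move=> vs_; exists (flatten [seq rcons (b w) w | w <- drop (index v s).+1 s]).
by rewrite /faces -{1}(cat_take_drop (index v s) s) map_cat flatten_cat drop_index //= cat_rcons.
Qed.

Lemma mem_take_index (pre post : seq P) F G : F \notin pre ->
  (G \in take (index F (pre ++ F :: post)).+1 (pre ++ F :: post)) = (G \in pre) || (G == F).
Proof.
move=> Fpre; rewrite index_cat (negbTE Fpre) /= eqxx addn0 -cat_rcons take_size_cat ?size_rcons //.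
by rewrite mem_rcons inE orbC.
Qed.

Lemma last_index_ge F v : v \in s -> (v <= F)%O -> (index v s <= last_index F)%N.
Proof.
rewrite (mem_ordering sP) => vV vF.
by apply: (leq_bigmax_cond (F := fun w => index w s)); rewrite mem_vs.
Qed.

(** The barycenter of [v] closes its block, so a chain in its link uses only faces whose last vertex
    is at most [v]. Being nonempty and comparable with [v], these faces contain [v], hence have last
    vertex exactly [v]. *)
Lemma mem_sdlink_vertex v C : v \in s ->
  (C \in sdlink v) = [&& is_chain C, C \subset vlink v & v \in C].
Proof.
move=> vs_; rewrite mem_sdlink; case chC: (is_chain C) => //=.
have vV : v \in vertices X by rewrite -(mem_ordering sP).
have vX := vertex_in_X vV; have [r faceE] := faces_split vs_.
have vpre : v \notin flatten [seq rcons (b w) w | w <- take (index v s) s] ++ b v.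
  rewrite mem_cat mem_prefix // mem_b // (rank_vertex vV) ltnn andbF orbF.
  by rewrite ltnNge last_index_ge // !andbF.
have before G : (G \in take (index v faces).+1 faces) =
    [&& G \in X, G != e & (last_index G <= index v s)%N].
  rewrite faceE catA mem_take_index // mem_cat mem_prefix // -orbA.
  have -> : (G \in b v) || (G == v) = (G \in rcons (b v) v) by rewrite mem_rcons inE orbC.
  rewrite mem_block // (vlink_last_index lbX minX sP) // [(last_index G <= index v s)%N]leq_eqVlt.
  by case: (G \in X); case: (G == e) => //=; rewrite orbC.
apply/and3P/andP => [[/subsetP CX vC /forall_inP CU]|[/subsetP CL vC]].
  split=> //; apply/subsetP => G GC; have := CU G GC; rewrite before => /and3P[GX Ge lG].
  rewrite (vlink_last_index lbX minX sP) // GX Ge eqn_leq lG /=; apply: last_index_ge => //.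
  have /orP[//|Gv] := is_chainP _ chC _ _ vC GC.
  have : vs G \subset vs v by exact: vertices_ofS.
  rewrite (vs_vertex lbX vV) subset1 (vs_eq0 lbX minX) // (negbTE Ge) orbF => /eqP vG.
  have : v \in vs G by rewrite vG set11.
  by rewrite mem_vs.
split=> //.
  apply/subsetP => G /CL; rewrite (vlink_last_index lbX minX sP) // => /and3P[GX Ge _].
  by rewrite in_setD1 Ge.
apply/forall_inP => G /CL; rewrite (vlink_last_index lbX minX sP) // before => /and3P[-> -> /eqP->].
by rewrite leqnn.
Qed.

(** A face above [F] has a later last vertex or, inside the block of [v], a larger dimension, so it
    is listed after [F]; and [v] ends the block. What precedes [F] and is comparable with it is thus
    a nonempty proper face of [F] other than [v]. *)
Lemma mem_sdlink_face v F C : v \in s -> F \in b v ->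
  (C \in sdlink F) = [&& is_chain C, C \subset X :\ e, F \in C & [forall G in C, (G <= F)%O && (G != v)]].
Proof.
move=> vs_ Fb; rewrite mem_sdlink; case chC: (is_chain C) => //=; case CX: (C \subset X :\ e) => //=.
case FC: (F \in C) => //=; apply: eq_forallb_in => G GC.
have /andP[Ge GX] : (G != e) && (G \in X) by rewrite -in_setD1; apply: (subsetP CX).
have /andP[Fe FX] : (F != e) && (F \in X) by rewrite -in_setD1; apply: (subsetP CX).
have cFG := is_chainP _ chC _ _ FC GC.
have [perm srt] := bP vs_; have ub : uniq (b v) by rewrite (perm_uniq perm) enum_uniq.
have vV : v \in vertices X by rewrite -(mem_ordering sP).
have := Fb; rewrite mem_b // => /andP[FL rF]; have vF := vlink_le FL.
have [r faceE] := faces_split vs_.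
set pre0 := flatten _ in faceE.
have [b1 [b2 bE]] : exists b1 b2, b v = b1 ++ F :: b2.
  by exists (take (index F (b v)) (b v)), (drop (index F (b v)).+1 (b v)); rewrite -drop_index ?cat_take_drop.
have Fb1 : F \notin b1 by move: ub; rewrite bE uniq_catC /= mem_cat negb_or => /andP[/andP[_ ->]].
have pre0E H : (H \in pre0) = [&& H \in X, H != e & (last_index H < index v s)%N] by exact: mem_prefix.
have lF : last_index F = index v s by move: FL; rewrite (vlink_last_index lbX minX sP) // => /and3P[_ _ /eqP].
have Fpre : F \notin pre0 ++ b1 by rewrite mem_cat negb_or Fb1 pre0E lF ltnn !andbF.
have -> : (G \in take (index F faces).+1 faces) = [|| G \in pre0, G \in b1 | G == F].
  by rewrite faceE bE -catA /= catA mem_take_index // mem_cat -orbA.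
have : pairwise (fun F G => (rank X F <= rank X G)%N) (b v).
  by rewrite -sorted_pairwise // => ? ? ?; apply: leq_trans.
rewrite bE pairwise_cat pairwise_cons => /and3P[/allrelP r1 _ /andP[/allP r2 _]].
have rank_lt H H' : H \in X -> H' \in X -> (H < H')%O -> (rank X H < rank X H')%N.
  move=> HX H'X lt; rewrite !(rank_card lbX) //; apply: proper_card.
  rewrite properE vertices_ofS ?ltW //=.
  by rewrite -(vertices_of_le lbX H'X H'X HX (lexx _) (ltW lt)) lt_geF.
have nv H : (1 < rank X H)%N -> H != v by apply: contraTneq => ->; rewrite (rank_vertex vV).
have lastE H : H \in X -> (H <= F)%O -> (last_index H <= last_index F)%N.
  move=> HX HF; apply/bigmax_leqP => w wH.
  by apply: (leq_bigmax_cond (F := fun w => index w s)); apply: (subsetP (vertices_ofS X HF)).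
apply/or3P/andP => [[|Gb|/eqP->]|[GF Gv]].
- rewrite pre0E => /and3P[_ _ lG]; split.
    have /orP[FG|//] := cFG.
    by move: lG; rewrite ltnNge last_index_ge // (le_trans vF FG).
  by apply: contraTneq lG => ->; rewrite -leqNgt last_index_ge.
- have Gbv : G \in b v by rewrite bE mem_cat Gb.
  split; last by move: Gbv; rewrite mem_b // => /andP[_ /nv].
  have /orP[FG|//] := cFG.
  have le_ : (F < G)%O by rewrite lt_neqAle FG andbT; apply: contraNneq Fb1 => ->.
  by have := rank_lt _ _ FX GX le_; rewrite ltnNge r1 // mem_head.
- by rewrite lexx nv.
have := lastE G GX GF; rewrite lF leq_eqVlt => /orP[/eqP lG|lG]; last by constructor; rewrite pre0E GX Ge.
have : G \in rcons (b v) v by rewrite mem_block // (vlink_last_index lbX minX sP) // GX Ge lG eqxx.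
rewrite mem_rcons inE (negbTE Gv) /= bE mem_cat inE => /or3P[h|h|/r2].
- by constructor 2.
- by constructor 3.
rewrite leqNgt => /negP h; have [->|ne] := eqVneq G F; first by constructor 3.
by case: h; apply: rank_lt => //; rewrite lt_neqAle ne.
Qed.

(** The default [v] is never taken on a chain of the link, which is nonempty and so has a largest
    member. *)
Let top v C := odflt v [pick G in C | [forall H in C, (H <= G)%O]].

Lemma topP v C : C \in sdlink v -> top v C \in C /\ forall H, H \in C -> (H <= top v C)%O.
Proof.
rewrite mem_sdlink => /and4P[chC _ vC _]; rewrite /top; case: pickP => [G /andP[GC /forall_inP]//|none].
by have [G GC Gmax] := chain_max chC vC; have := none G; rewrite /= GC => /forall_inP.
Qed.

Lemma top_le v C l : C \in sdlink v -> (top v C <= l)%O = [forall G in C, (G <= l)%O].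
Proof.
move=> CL; have [tC tmax] := topP CL; apply/idP/forall_inP => [tl G /tmax|h]; last exact: h.
by move=> /le_trans; apply.
Qed.

Let sdlink_set1 v : v \in s -> [set v] \in sdlink v.
Proof.
move=> vs_; rewrite mem_sdlink_vertex // set11 andbT sub1set vlink_vertex // andbT.
by apply/is_chainP => F G /set1P-> /set1P->; rewrite comparablexx.
Qed.

Lemma sdlink_locally_boolean F : [set F] \in sdlink F -> locally_boolean (sdlink F).
Proof.
rewrite inE => /andP[FR _]; apply: link_locally_boolean => //.
exact: lower_locally_boolean (lower_restrict _ _) sd_locally_boolean.
Qed.

Lemma rank_sdlink F C : [set F] \in sdlink F -> C \in sdlink F -> (rank (sdlink F) C + 1)%N = #|C|.
Proof.
move=> FL CL; have := FL; have := CL; rewrite inE => /andP[CR _]; rewrite inE => /andP[FR _].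
have lbR := lower_locally_boolean (lower_restrict (sd X) (upto t [set F])) sd_locally_boolean.
have := rank_link FR lbR CL; rewrite !(rank_lower (lower_restrict _ _)) // !rank_sd ?cards1 //.
  by move: CR; rewrite inE => /andP[].
by move: FR; rewrite inE => /andP[].
Qed.

Lemma sdlink_carrier v : v \in s ->
  carrier_complex (vlink v) (sdlink v) (incidence K (sdlink v)) (rank (sdlink v)) (top v) v.
Proof.
move=> vs_; have v1 := sdlink_set1 vs_; have lbL := sdlink_locally_boolean v1.
have top_vlink C : C \in sdlink v -> top v C \in vlink v.
  move=> CL; have [tC _] := topP CL; move: CL; rewrite mem_sdlink_vertex // => /and3P[_ /subsetP h _].
  exact: h.
split=> //; first exact: incidence_complex.
  move=> C D; rewrite incidence_neq0 => /and4P[CL DL /ltW + _]; rewrite leEsubset => /subsetP DC.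
  by have [tD _] := topP DL; have [_ ] := topP CL; apply; apply: DC.
exists [set v]; split=> //.
- by apply/eqP; rewrite -(eqn_add2r 1) rank_sdlink // cards1.
- by have [/set1P] := topP v1.
move=> C CL r0; have := rank_sdlink v1 CL; rewrite r0 => /esym/eqP/cards1P[G eC].
by move: CL; rewrite mem_sdlink_vertex // eC => /and3P[_ _ /set1P->].
Qed.

(** The chains through [v] with all members below [l] form a cone with apex [l], so [l] is toggled;
    [l != v] keeps [v] in every chain. *)
Lemma sdlink_acyclic v l : v \in s -> l \in vlink v -> l != v ->
  acyclic_below (sdlink v) (incidence K (sdlink v)) (rank (sdlink v)) (top v) l.
Proof.
move=> vs_ lL lv; have v1 := sdlink_set1 vs_; have lbL := sdlink_locally_boolean v1.
pose Z := [set C in sdlink v | [forall G in C, (G <= l)%O]].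
have inZ C : C \in Z -> C \in sdlink v by rewrite inE => /andP[].
have ZL : lower_ideal Z (sdlink v).
  split=> [|C D CL]; first by apply/subsetP.
  rewrite leEsubset [D \in Z]inE [C \in Z]inE CL => /andP[_ /forall_inP h] /subsetP CD.
  by apply/forall_inP => G /CD/h.
pose tau C := if l \in C then C :\ l else l |: C.
have tauK C : tau (tau C) = C.
  rewrite {2}/tau; case: ifP => lC; rewrite /tau; first by rewrite setD11 setD1K.
  by rewrite setU11 setU1K ?lC.
have tauZ C : C \in Z -> tau C \in Z.
  rewrite [C \in Z]inE [tau C \in Z]inE !mem_sdlink_vertex // => /andP[/and3P[chC CL vC] /forall_inP Cl].
  rewrite /tau; case: ifP => lC.
    rewrite (is_chainS _ chC) ?subsetDl // (subset_trans _ CL) ?subsetDl // in_setD1 eq_sym lv vC /=.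
    by apply/forall_inP => G /setD1P[_ /Cl].
  rewrite subUset sub1set lL CL in_setU1 vC orbT andbT /= andbT.
  rewrite is_chainU1 //=; last by move=> G /Cl Gl; rewrite /Order.comparable Gl orbT.
  by apply/forall_inP => G /setU1P[->|/Cl].
have ac := @toggle_acyclic _ _ _ _ _ (incidence_orientation K lbL) _ id 1 Z (fun _ => l) tau (fun _ => 0%N) ZL.
move=> r z zc bz; case: (ac _ _ _ _ _ _ _ r z) => //.
- by move=> C /inZ CL; rewrite rank_sdlink.
- by move=> C CZ; split=> //; apply: tauZ.
- by move=> C CZ lC; rewrite /tau (negbTE lC) leEsubset subsetUr.
- move=> C D _ _; rewrite leEsubset => DC _; split=> // eCD; rewrite /tau -eCD leEsubset.
  by case: ifP => _; [apply: setSD | apply: setUS].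
- apply: (subvP (cell_span_subset _)) zc; apply/subsetP => C; rewrite in_set => /and3P[CL + rC].
  by rewrite in_set rC andbT in_set CL top_le.
move=> y yc by_; exists y => //; apply: (subvP (cell_span_subset _)) yc.
apply/subsetP => C /setIdP[/setIdP[CL h] rC].
by rewrite in_set CL rC top_le // h.
Qed.

Lemma sdlink_vertex_betti v r : v \in s ->
  reduced_betti_pred K (sdlink v) (sdlinkY v) r = reduced_betti_pred K (vlink v) (vlinkY v) r.
Proof.
move=> vs_; rewrite !reduced_betti_predE.
have oL := incidence_orientation K (vlink_locally_boolean lbX sP vs_).
have := carrier_cbetti_eq (vlinkY_low YX sP vs_) r (sdlink_carrier vs_) (vlink_carrier lbX sP vs_ oL)
  (fun l => sdlink_acyclic vs_) (fun l lL => vlink_acyclic lbX sP vs_ oL lL).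
(* As [Y] is a lower ideal, a chain lies in [Y] exactly when its largest face does. *)
rewrite over_vlinkY //; have -> : over (vlinkY v) (sdlink v) (top v) = sdlinkY v.
  apply/setP => C; rewrite inE mem_sdlinkY; case: (boolP (C \in sdlink v)) => //= CL.
  have [tC tmax] := topP CL; move: (CL); rewrite mem_sdlink_vertex // => /and3P[_ /subsetP CL' _].
  rewrite (mem_vlinkY YX) // CL' //=; apply/idP/subsetP => [tY G GC|h]; last exact: h.
  apply: (YX.2) tY (tmax G GC).
  by have := CL' G GC; rewrite mem_vlink // => /and3P[].
apply=> F FL; first last.
  by apply: contra => /eqP->; rewrite (rank_vlink_vertex lbX sP).
have v1 := sdlink_set1 vs_; apply: contra => /eqP tF; rewrite -(eqn_add2r 1) rank_sdlink //.
have [_ tmax] := topP FL; move: FL; rewrite mem_sdlink_vertex // => /and3P[_ /subsetP FL vF].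
suff -> : F = [set v] by rewrite cards1.
apply/setP => G; rewrite in_set1; apply/idP/eqP => [GF|->//].
by apply/le_anti; rewrite -{1}tF tmax //= (vlink_le (FL G GF)).
Qed.

Let sdlink_set1_face v F : v \in s -> F \in b v -> [set F] \in sdlink F.
Proof.
move=> vs_ Fb; rewrite (mem_sdlink_face _ vs_ Fb) set11 sub1set /=.
have := Fb; rewrite mem_b // => /andP[]; rewrite (vlink_last_index lbX minX sP) // => /and3P[FX Fe _] rF.
rewrite in_setD1 Fe FX /=; apply/andP; split.
  by apply/is_chainP => G H /set1P-> /set1P->; rewrite comparablexx.
apply/forall_inP => G /set1P->; rewrite lexx; apply: contraTneq rF => ->.
by rewrite (rank_vertex (X := X)) // -(mem_ordering sP).
Qed.

(* Every chain through [F] is matched by toggling [G] minus [v], where [G] is the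
   least element of the chain that contains [v]. *)
Lemma sdlink_face_acyclic v F r z : v \in s -> F \in b v ->
  z \in cell_span K (cells (rank (sdlink F)) (sdlink F) r) -> bd (incidence K (sdlink F)) z = 0 ->
  exists2 w, w \in cell_span K (cells (rank (sdlink F)) (sdlink F) r.+1) &
    bd (incidence K (sdlink F)) w = z.
Proof.
move=> vs_ Fb; have F1 := sdlink_set1_face vs_ Fb; have lbL := sdlink_locally_boolean F1.
have vV : v \in vertices X by rewrite -(mem_ordering sP).
have vX := vertex_in_X vV.
have := Fb; rewrite mem_b // => /andP[FL rF]; have vF := vlink_le FL.
have FX : F \in X by move: FL; rewrite mem_vlink // => /and3P[].
have [del delP] : exists del : P -> P, forall G, G \in X -> [/\ del G \in X, (del G <= G)%O & vs (del G) = vs G :\ v].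
  apply: (@fin_all_exists _ (fun _ => P) (fun G p => G \in X -> [/\ p \in X, (p <= G)%O & vs p = vs G :\ v])) => G.
  have [GX|] := boolP (G \in X); last by exists F.
  by have [H HP] := face_exists lbX GX (subsetDl (vs G) [set v]); exists H.
have LP C : C \in sdlink F -> [/\ is_chain C, F \in C &
    forall G, G \in C -> [/\ G \in X, G != e, (G <= F)%O & G != v]].
  rewrite (mem_sdlink_face _ vs_ Fb) => /and4P[chC /subsetP CX FC /forall_inP CF]; split=> // G GC.
  by have /andP[? ?] := CF G GC; have := CX G GC; rewrite in_setD1 => /andP[].
pose g C := odflt F [pick G in C | (v <= G)%O && [forall H in C, (v <= H)%O ==> (G <= H)%O]].
have gP C : C \in sdlink F -> [/\ g C \in C, (v <= g C)%O & forall H, H \in C -> (v <= H)%O -> (g C <= H)%O].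
  move=> /LP[chC FC _]; rewrite /g; case: pickP => [G /and3P[GC vG /forall_inP Gm]|none].
    by split=> // H HC vH; have /implyP := Gm H HC; apply.
  pose C' := [set G in C | (v <= G)%O].
  have chC' : is_chain C' by apply: is_chainS chC; apply/subsetP => G; rewrite inE => /andP[].
  have FC' : F \in C' by rewrite inE FC.
  have [G /setIdP[GC vG] Gm] := chain_min chC' FC'.
  have := none G; rewrite /= GC vG /= => /negP[]; apply/forall_inP => H HC.
  by apply/implyP => vH; apply: Gm; rewrite inE HC.
pose a C := del (g C).
have aP C : C \in sdlink F -> [/\ a C \in X, a C != e, (a C <= g C)%O, ~~ (v <= a C)%O & vs (a C) = vs (g C) :\ v].
  move=> CL; have [gC vg gm] := gP C CL; have [_ _ /(_ _ gC)[gX ge gF gv]] := LP C CL.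
  have [aX ag va] := delP _ gX; split=> //; last by rewrite -(mem_vs _ vV) va setD11.
  apply: contra gv => /eqP ae; apply/eqP/(vertices_of_inj lbX gX) => //.
  have : vs (g C) :\ v = set0 by rewrite -va -/(a C) ae (vs_bottom lbX minX).
  move=> /eqP; rewrite setD_eq0 subset1 (vs_eq0 lbX minX) // (negbTE ge) orbF => /eqP->.
  by rewrite (vs_vertex lbX vV).
pose tau C := if a C \in C then C :\ a C else a C |: C.
(* [a C] misses [v], so toggling it does not change the least member through [v]. *)
have gtau C : C \in sdlink F -> tau C \in sdlink F -> g (tau C) = g C.
  move=> CL tL; have [gC vg gm] := gP C CL; have [gt vgt gmt] := gP _ tL.
  have [aX ae ag nva va] := aP C CL.
  have ne : g C != a C by apply: contraNneq nva => <-.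
  have ne' : g (tau C) != a C by apply: contraNneq nva => <-.
  apply/le_anti/andP; split; [apply: gmt|apply: gm] => //.
    by rewrite /tau; case: ifP => _; rewrite !inE ?ne ?gC ?orbT.
  have tsub H : H \in tau C -> H != a C -> H \in C.
    by rewrite /tau; case: ifP => _; [case/setD1P|case/setU1P => [->|//]; rewrite eqxx].
  exact: tsub.
have tauL C : C \in sdlink F -> tau C \in sdlink F.
  move=> CL; have [gC vg gm] := gP C CL; have [aX ae ag nva va] := aP C CL.
  have [chC FC CP] := LP C CL; have aF : (a C <= F)%O by apply: le_trans ag _; apply: gm.
  have neF : F != a C by apply: contraNneq nva => <-.
  rewrite (mem_sdlink_face _ vs_ Fb) /tau; case: ifP => aC; apply/and4P; split.
  - by apply: is_chainS chC; apply: subsetDl.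
  - by apply/subsetP => G /setD1P[_ /CP[GX Ge _ _]]; rewrite in_setD1 Ge.
  - by rewrite in_setD1 neF.
  - by apply/forall_inP => G /setD1P[_ /CP[_ _ -> ->]].
  (* A member containing [v] lies above [g C]; one missing [v] lies below [g C], hence below [g C]
     minus [v]. Either way it is comparable with [a C]. *)
  - apply: is_chainU1 => // G GC; have [GX _ GF _] := CP G GC; have [_ _ /(_ _ gC)[gX _ gF _]] := LP C CL.
    rewrite /Order.comparable; case: (boolP (v <= G)%O) => vG; first by rewrite (le_trans ag) // gm.
    have /orP[gG|Gg] := is_chainP _ chC _ _ gC GC; first by rewrite (le_trans vg gG) in vG.
    apply/orP; right; rewrite (vertices_of_le lbX gX) // va; apply/subsetP => w wG.
    rewrite in_setD1 (subsetP (vertices_ofS X Gg)) // andbT; apply: contraNneq vG => <-.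
    by move: wG; rewrite inE => /andP[].
  - by apply/subsetP => G /setU1P[->|/CP[GX Ge _ _]]; rewrite in_setD1 ?ae ?aX ?Ge ?GX.
  - by rewrite in_setU1 FC orbT.
  apply/forall_inP => G /setU1P[->|/CP[_ _ -> ->]//].
  by rewrite aF /=; apply: contraNneq nva => ->.
have LL : lower_ideal (sdlink F) (sdlink F) by split.
(* Dropping members of a chain can only raise its least face through [v]. If the rank of that face
   stays the same, so does the face, and with it the face to toggle. *)
apply: (@toggle_acyclic _ _ _ _ _ (incidence_orientation K lbL) _ id 1 (sdlink F) a tau
  (fun C => rank X (g C)) LL) => //.
- by move=> C CL; rewrite rank_sdlink.
- move=> C CL; have tL := tauL C CL; have e1 := gtau C CL tL; rewrite /a e1; split=> //.
  rewrite {1}/tau /a e1 -/(a C) /tau; case: (boolP (a C \in C)) => aC.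
    by rewrite setD11 setD1K.
  by rewrite setU11 setU1K.
- by move=> C CL aC; rewrite /tau (negbTE aC) leEsubset subsetUr.
- move=> C D CL DL; rewrite leEsubset => /subsetP DC.
  have [gC vgC gmC] := gP C CL; have [gD vgD gmD] := gP D DL.
  have [_ _ /(_ _ gC)[gX _ _ _]] := LP C CL; have [_ _ /(_ _ gD)[gX' _ _ _]] := LP D DL.
  by rewrite !(rank_card lbX) // subset_leq_card // vertices_ofS // gmC // DC.
move=> C D CL DL; rewrite leEsubset => DC er.
have [gC vgC gmC] := gP C CL; have [gD vgD gmD] := gP D DL.
have [_ _ /(_ _ gC)[gX _ _ _]] := LP C CL; have [_ _ /(_ _ gD)[gX' _ _ _]] := LP D DL.
have le_g : (g C <= g D)%O by rewrite gmC // (subsetP DC).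
have eg : g D = g C.
  apply/esym/(vertices_of_inj lbX gX') => //; apply/eqP.
  by rewrite eqEcard vertices_ofS //= -!(rank_card lbX) // er.
rewrite /tau /a eg; split=> // <-; rewrite leEsubset.
by case: ifP => _; [apply: setSD | apply: setUS].
Qed.

(** If [F] is in [Y], so are all its faces, and the relative complex is zero; otherwise no chain
    through [F] lies in [Y], and absolute acyclicity applies. *)
Lemma sdlink_face_betti v F r : v \in s -> F \in b v ->
  reduced_betti_pred K (sdlink F) (sdlinkY F) r = 0%N.
Proof.
move=> vs_ Fb; have F1 := sdlink_set1_face vs_ Fb; have lbL := sdlink_locally_boolean F1.
have cL := incidence_complex (K := K) lbL.
rewrite reduced_betti_predE; have [FY|FY] := boolP (F \in Y).
  have -> : sdlinkY F = sdlink F.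
    apply/setP => C; rewrite mem_sdlinkY; case: (boolP (C \in sdlink F)) => //=.
    rewrite (mem_sdlink_face _ vs_ Fb) => /and4P[_ /subsetP CX _ /forall_inP CF].
    apply/subsetP => G GC; have /andP[GF _] := CF G GC; apply: (YX.2) FY GF.
    by have := CX G GC; rewrite in_setD1 => /andP[].
  have sub : subcomplex (incidence K (sdlink F)) (sdlink F) (sdlink F).
    by split=> // C D _; rewrite incidence_neq0 => /and4P[].
  have := cbetti_brank r cL sub; rewrite setDv.
  have -> : cells (rank (sdlink F)) finset.set0 r = finset.set0.
    by apply/setP => C; rewrite !inE.
  by rewrite cards0 => /eqP; rewrite !addn_eq0 => /andP[/andP[/eqP-> _] _].
have -> : sdlinkY F = finset.set0.
  apply/setP => C; rewrite mem_sdlinkY in_set0; apply/negP => /andP[].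
  by rewrite (mem_sdlink_face _ vs_ Fb) => /and4P[_ _ FC _] /subsetP/(_ F FC); apply/negP.
apply/eqP; rewrite subn_eq0; apply/dimvS/subvP => z.
rewrite memv_cap -memv_preim => /andP[zr /mem_cell_span bz].
have bz0 : bd (incidence K (sdlink F)) z = 0.
  by apply/ffunP => C; rewrite bz ?ffunE // in_set0.
have [w wr <-] := sdlink_face_acyclic vs_ Fb zr bz0.
by apply: (subvP (addvSl _ _)); apply: memv_img.
Qed.

Lemma sd_mu_ord i : mu_ord K (sd X) (sd Y) t i = mu_ord K X Y s i.
Proof.
rewrite /mu_ord {1}/t {1}/faces big_map big_flatten big_map; apply: eq_big_seq => v vs_.
rewrite -cats1 big_cat big_seq1 big1_seq ?add0n; last by move=> F /= Fb; apply: (sdlink_face_betti _ vs_).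
exact: sdlink_vertex_betti.
Qed.

End Subdivision.

Lemma sd_mu_ord_eq {disp : Order.disp_t} {P : finPOrderType disp} (K : fieldType)
    (X Y : {set P}) (s : seq P) (t : seq {set P}) i :
  relative_simplicial_poset X Y -> vertex_ordering X s -> sd_ordering X s t ->
  mu_ord K X Y s i = mu_ord K (sd X) (sd Y) t i.
Proof.
move=> [sX YX] sP [b [bP ->]]; have lbX := simplicial_locally_boolean sX; have [e minX _] := sX.
by apply/esym; apply: sd_mu_ord minX YX sP bP i.
Qed.

(** * Components of vertex links *)

Section LinkGraph.
Context {disp : Order.disp_t} {P : finPOrderType disp}.
Variables (X : {set P}) (e0 : P) (s : seq P).
Hypothesis lbX : locally_boolean X.
Hypothesis minX : minimals X = [set e0].
Hypothesis sP : vertex_ordering X s.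
Implicit Types (e F G v w : P).
Local Notation vs := (vertices_of X).
Local Notation vlink := (vlink X s).
Local Notation last_index := (last_index X s).

Definition ledges v : {set P} := [set e in vlink v | rank X e == 2].

Definition ladj v : rel P := [rel e e' | [&& e \in ledges v, e' \in ledges v &
  [exists F in vlink v, [&& rank X F == 3, (e <= F)%O & (e' <= F)%O]]]].

(** The edges of [X] with last vertex [v] are the vertices of its link; a root is the representative
    of a component. *)
Definition lroots v : {set P} := [set fingraph.root (ladj v) e | e in ledges v].

Lemma ladj_sym v : symmetric (ladj v).
Proof.
move=> e e'; rewrite /ladj /= andbCA; do 2!congr (_ && _); apply: eq_existsb => F.
by rewrite [(e <= F)%O && _]andbC.
Qed.

Lemma ladj_connect_sym v : connect_sym (ladj v).
Proof. exact/sym_connect_sym/ladj_sym. Qed.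

Lemma connect_ledges v e e' : e \in ledges v -> connect (ladj v) e e' -> e' \in ledges v.
Proof.
move=> eL /connectP[p]; elim: p e eL => [|e1 p IHp] e eL /=; first by move=> _ ->.
by move=> /andP[/and3P[_ e1L _]]; apply: IHp.
Qed.

Lemma lroots_ledges v : lroots v \subset ledges v.
Proof.
apply/subsetP => _ /imsetP[e eL ->]; apply: connect_ledges eL _.
exact: fingraph.connect_root.
Qed.

Lemma root_lroot v e : e \in lroots v -> fingraph.root (ladj v) e = e.
Proof. by case/imsetP => e' _ ->; rewrite (fingraph.root_root (ladj_connect_sym v)). Qed.

Section Betti.
Variables (K : fieldType) (v : P).
Hypothesis vs_ : v \in s.
Local Notation L := (vlink v).
Local Notation inc := (incidence K L).
Local Notation b r := (cbetti inc L set0 (rank L) r).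

Let lbL : locally_boolean L. Proof. exact: vlink_locally_boolean. Qed.
Let cL : complex inc L (rank L). Proof. exact: incidence_complex. Qed.
Let vL : v \in L. Proof. exact: vlink_vertex. Qed.

Let bettiE r : (b r + brank inc L (rank L) r + brank inc L (rank L) r.+1 = #|cells (rank L) L r|)%N.
Proof.
have := cbetti_brank (Y := set0) r cL; rewrite setD0; apply.
by split; [exact: sub0set | move=> F G; rewrite inE].
Qed.

Let cells0 : cells (rank L) L 0 = [set v].
Proof.
apply/setP => F; rewrite in_set in_set1; apply/andP/eqP => [[FL /eqP r0]|->].
  exact: (vlink_rank0 lbX sP vs_ FL).
by rewrite vL rank_vlink_vertex.
Qed.

Let cells1 : cells (rank L) L 1 = ledges v.
Proof.
apply/setP => F; rewrite [LHS]inE [RHS]inE; have [FL|//] := boolP (F \in L).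
by rewrite (rank_vlink lbX sP vs_ FL) eqSS.
Qed.

Let maskE F G : mask inc L F G = inc F G.
Proof.
rewrite /mask; case: ifP => // /negbT; rewrite negb_and => FG.
apply/esym/eqP; rewrite -[_ == 0]negbK incidence_neq0; apply/negP => /and4P[FL GL _ _].
by rewrite FL GL in FG.
Qed.

Let bd_mask : bd (mask inc L) = bd inc.
Proof. by apply: eq_lfun_cell => F; apply/ffunP => G; rewrite !bd_cell maskE. Qed.

Let inc_ledge e : e \in ledges v -> inc e v != 0.
Proof.
rewrite -cells1 inE => /andP[eL /eqP r1]; rewrite incidence_neq0 /facet eL vL r1.
rewrite (rank_vlink_vertex lbX sP) // andbT lt_neqAle (vlink_le eL) andbT.
by apply: contra_eqN r1 => /eqP<-; rewrite rank_vlink_vertex.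
Qed.

(* Weighting each edge by its incidence with [v] and sending it to the root of its
   component kills the boundaries of triangles. *)
Lemma brank2_lroots : (brank inc L (rank L) 2 + #|lroots v| <= #|ledges v|)%N.
Proof.
pose q : 'End({ffun P -> K^o}) := lin_ext (fun e => inc e v *: cell K (fingraph.root (ladj v) e)).
rewrite -(dim_cell_span (K := K) (ledges v)) -[leqRHS](limg_ker_dim q) leq_add //.
  apply/dimvS/subvP => _ /memv_imgP[c cc ->]; rewrite bd_mask memv_cap -cells1.
  rewrite (complex_bd_cells cL cc) memv_ker /=.
  suff : (q \o bd inc)%VF c = (0 : 'End({ffun P -> K^o})) c by rewrite comp_lfunE zero_lfunE => ->.
  apply: lfun_eq_span cc => F; rewrite inE => /andP[FL /eqP r2].
  rewrite comp_lfunE zero_lfunE lfun_sum_cell.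
  have inc0 e : inc F e != 0 -> e \in ledges v.
    rewrite -cells1 inE incidence_neq0 => /and4P[_ -> _]; rewrite r2 eqSS => /eqP<-.
    by rewrite eqxx.
  have adj e e' : inc F e != 0 -> inc F e' != 0 -> ladj v e e'.
    move=> n1 n2; rewrite /ladj /= !inc0 //=; apply/exists_inP; exists F => //.
    rewrite (rank_vlink lbX sP vs_ FL) r2 eqxx.
    by move: n1 n2; rewrite !incidence_neq0 => /and4P[_ _ /ltW-> _] /and4P[_ _ /ltW-> _].
  have [e ne|none] := pickP (fun e => inc F e != 0); last first.
    rewrite big1 // => e _; rewrite bd_cell.
    by have /negbFE/eqP-> := none e; rewrite scale0r.
  (* All edges through [v] of the triangle have the same root, so the image of its boundary is one
     cell times the coefficient of [v] in [bd (bd F)], which is 0. *)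
  rewrite (eq_bigr (fun e' => (inc F e' * inc e' v) *: cell K (fingraph.root (ladj v) e))) => [|e' _].
    by rewrite -scaler_suml cL.2 scale0r.
  rewrite bd_cell lin_ext_cell scalerA; have [->|ne'] := eqVneq (inc F e') 0.
    by rewrite mul0r !scale0r.
  by rewrite (fingraph.rootP (ladj_connect_sym v) (connect1 (adj e e' ne ne'))).
(* Conversely every root is in the image of [q], because [inc e v] is invertible. *)
rewrite -(dim_cell_span (K := K)); apply/dimvS/span_subvP => _ /mapP[e eR ->]; rewrite mem_enum in eR.
have eL := subsetP (lroots_ledges v) e eR.
have -> : cell K e = q ((inc e v)^-1 *: cell K e).
  by rewrite linearZ /= lin_ext_cell root_lroot // scalerA mulVf ?scale1r // inc_ledge.
by apply/memv_img/memvZ/cell_in_span.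
Qed.

(** [b 0] and [b 1] are the reduced Betti numbers in dimensions -1 and 0. If the link has a vertex,
    then [b 0] vanishes and the boundary in rank 1 accounts for the summand 1; if not, there are no
    roots and [b 0] is at most 1. *)
Lemma lroots_betti : (#|lroots v| + b 0 <= b 1 + 1)%N.
Proof.
have b0 := bettiE 0%N; have b1 := bettiE 1%N; rewrite cells0 cards1 in b0; rewrite cells1 in b1.
have bq := brank2_lroots.
have [E0|/set0Pn[e eE]] := eqVneq (ledges v) set0.
  by move: bq; rewrite E0 cards0 => bq; lia.
have : (0 < brank inc L (rank L) 1)%N.
  rewrite lt0n dimv_eq0 -subv0 bd_mask; apply/negP => /subvP/(_ (bd inc (cell K e))).
  rewrite memv_img; last by apply: cell_in_span; rewrite cells1.
  rewrite memv0 => /(_ isT)/eqP/(congr1 (fun f : {ffun P -> K^o} => f v)); rewrite bd_cell ffunE.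
  by apply/eqP; apply: inc_ledge.
lia.
Qed.

End Betti.

Definition redges : {set P} := \bigcup_(v in vertices X) lroots v.

Lemma mem_ledges e v : v \in s -> (e \in ledges v) = [&& e \in X, rank X e == 2 & last_index e == index v s].
Proof.
move=> vs_; rewrite inE (vlink_last_index lbX minX sP) // -!andbA; case: (boolP (e \in X)) => //= eX.
case: (boolP (rank X e == 2)) => /= r2; rewrite ?andbF ?andbT //.
have -> // : e != e0.
by rewrite -(vs_eq0 lbX minX) // -cards_eq0 -(rank_card lbX) // (eqP r2).
Qed.

Lemma edge_last e : e \in X -> rank X e = 2 -> exists2 v, v \in s & e \in ledges v.
Proof.
move=> eX r2; have ne : e != e0.
  by rewrite -(vs_eq0 lbX minX) // -cards_eq0 -(rank_card lbX) // r2.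
have [v [vs_ _ lv]] := last_index_vertex lbX minX sP eX ne.
by exists v; rewrite // mem_ledges // eX r2 lv !eqxx.
Qed.

Lemma redges_edge e : e \in redges -> e \in X /\ rank X e = 2.
Proof.
case/bigcupP => v; rewrite -(mem_ordering sP) => vs_ /(subsetP (lroots_ledges v)).
by rewrite mem_ledges // => /and3P[-> /eqP].
Qed.

(** The summands 1 of the bounds for the single links add up to the number of vertices. *)
Lemma card_redges_le (K : fieldType) :
  (#|redges| + mu_ord K X set0 s 0 <= mu_ord K X set0 s 1 + #|vertices X|)%N.
Proof.
have le1 : (#|redges| <= \sum_(v <- s) #|lroots v|)%N.
  rewrite /redges (perm_big _ sP) /= big_enum /=.
  elim/big_rec2: _ => [|v n A _ IH]; first by rewrite cards0.
  by apply: leq_trans (leq_card_setU _ _) _; rewrite leq_add2l.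
have sz : #|vertices X| = (\sum_(v <- s) 1)%N by rewrite sum1_size (perm_size sP) -cardE.
apply: leq_trans (leq_add le1 (leqnn _)) _; rewrite sz /mu_ord -!big_split /=.
rewrite !big_seq; apply: leq_sum => v vs_; rewrite !reduced_betti_predE.
have -> : link (restrict set0 (upto s v)) v = set0 by apply/setP => F; rewrite !inE.
exact: lroots_betti.
Qed.

Lemma last_index_edge_lt e G v : v \in s -> e \in X -> G \in X -> (e <= G)%O ->
  G \in vlink v -> v \notin vs e -> e != e0 -> (last_index e < index v s)%N.
Proof.
move=> vs_ eX GX eG GL ve ne; have [w [ws we ->]] := last_index_vertex lbX minX sP eX ne.
have : (index w s <= index v s)%N.
  move: GL; rewrite mem_vlink // => /and3P[_ _ /forall_inP]; apply.
  exact: (subsetP (vertices_ofS X eG)).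
rewrite leq_eqVlt => /orP[/eqP ewv|//]; move: we ve.
by rewrite -(nth_index v ws) ewv nth_index // => ->.
Qed.

(** Applied both to the connectedness of the graph of kept edges and to homotopies. The induction is
    on the last vertex: two edges at [v] in a common triangle differ by its third edge, which avoids
    [v] and has an earlier last vertex. *)
Lemma edge_induction (Good : P -> Prop) :
  (forall e, e \in redges -> Good e) ->
  (forall F a b c e1 e2 e3, F \in X -> vs F = [set a; b; c] ->
     a != b -> b != c -> a != c ->
     [/\ e1 \in X, (e1 <= F)%O & vs e1 = [set a; b]] ->
     [/\ e2 \in X, (e2 <= F)%O & vs e2 = [set b; c]] ->
     [/\ e3 \in X, (e3 <= F)%O & vs e3 = [set a; c]] ->
     Good e1 -> Good e2 -> Good e3) ->
  forall e, e \in X -> rank X e = 2 -> Good e.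
Proof.
move=> Groot Gtri; suff main n e : (last_index e < n)%N -> e \in X -> rank X e = 2 -> Good e.
  by move=> e; apply: main (ltnSn _).
elim: n e => // n IHn e; rewrite ltnS => le_n eX r2.
have [v vs_ eL] := edge_last eX r2.
have vV : v \in vertices X by rewrite -(mem_ordering sP).
have idxv : (index v s <= n)%N by move: eL; rewrite mem_ledges // => /and3P[_ _ /eqP<-].
have other f : f \in ledges v -> exists2 a, a != v & vs f = [set v; a].
  move=> fL; have := fL; rewrite inE => /andP[]; rewrite mem_vlink // => /and3P[fX vf _].
  rewrite (rank_card lbX) // (cardsD1 v) vf eqSS => /cards1P[a ea]; exists a.
    have : a \in vs f :\ v by rewrite ea set11.
    by rewrite in_setD1 => /andP[].
  by rewrite -(setD1K vf) ea.
have step f g : ladj v f g -> Good g -> Good f.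
  move=> /and3P[fL gL /exists_inP[F FL /and3P[/eqP r3 fF gF]]] Gg.
  have [a av vf] := other f fL; have [b bv vg] := other g gL.
  have FX : F \in X by move: FL; rewrite mem_vlink // => /and3P[].
  have fX : f \in X by move: fL; rewrite mem_ledges // => /and3P[].
  have gX : g \in X by move: gL; rewrite mem_ledges // => /and3P[].
  (* Distinct edges may have the same ends, but not when both lie below the one face [F]. *)
  have [eab|ab] := eqVneq a b.
    by have -> : f = g by apply: (vertices_of_inj lbX FX) => //; rewrite vf vg eab.
  have sub : [set v; b; a] \subset vs F.
    rewrite !subUset !sub1set -!andbA; apply/and3P; split.
    - by apply: (subsetP (vertices_ofS X fF)); rewrite vf set21.
    - by apply: (subsetP (vertices_ofS X gF)); rewrite vg set22.
    by apply: (subsetP (vertices_ofS X fF)); rewrite vf set22.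
  have vF : vs F = [set v; b; a].
    apply/esym/eqP; rewrite eqEcard sub -(rank_card lbX) // r3.
    by rewrite -setUA cardsU1 !inE negb_or eq_sym bv eq_sym av cards2 eq_sym ab.
  have [|h [hX hF vh]] := face_exists lbX FX (A := [set b; a]).
    by rewrite vF -setUA subsetUr.
  have vnh : v \notin vs h by rewrite vh !inE negb_or eq_sym bv eq_sym av.
  have hr2 : rank X h = 2 by rewrite (rank_card lbX) // vh cards2 eq_sym ab.
  have he0 : h != e0 by rewrite -(vs_eq0 lbX minX) // -cards_eq0 -(rank_card lbX) // hr2.
  have Gh : Good h.
    apply: IHn => //; apply: leq_trans idxv.
    exact: (last_index_edge_lt vs_ hX FX hF FL vnh he0).
  by apply: (Gtri F v b a g h f) => //; rewrite eq_sym // ab.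
have rR : fingraph.root (ladj v) e \in redges.
  by apply/bigcupP; exists v => //; apply: imset_f.
(* The property spreads back from the root to [e] along a path in the component. *)
have /connectP[p pth er] := fingraph.connect_root (ladj v) e.
have := Groot _ rR; rewrite er; elim: p e pth {le_n eX r2 eL rR er} => [|f p IHp] e //= /andP[ef pth] Gp.
exact: step ef (IHp _ pth Gp).
Qed.

End LinkGraph.

From mathcomp Require Import all_classical all_reals all_analysis.
Import numFieldNormedType.Exports.

(** * Homotopies of paths *)

Section RealContinuity.
Context {R : realType} {Z : topologicalType}.
Implicit Types f g : Z -> R.

Lemma contD f g : continuous f -> continuous g -> continuous (fun z => f z + g z).
Proof. by move=> cf cg z; apply: cvgD; [exact: cf | exact: cg]. Qed.

Lemma contN f : continuous f -> continuous (fun z => - f z).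
Proof. by move=> cf z; apply: cvgN; exact: cf. Qed.

Lemma contM f g : continuous f -> continuous g -> continuous (fun z => f z * g z).
Proof. by move=> cf cg z; apply: cvgM; [exact: cf | exact: cg]. Qed.

Lemma contmin f g : continuous f -> continuous g -> continuous (fun z => Num.min (f z) (g z)).
Proof. by move=> cf cg z; apply: continuous_min; [exact: cf | exact: cg]. Qed.

Lemma contmax f g : continuous f -> continuous g -> continuous (fun z => Num.max (f z) (g z)).
Proof. by move=> cf cg z; apply: continuous_max; [exact: cf | exact: cg]. Qed.

Lemma cont_cst (U : topologicalType) (a : U) : continuous (fun _ : Z => a).
Proof. by move=> z; apply: cvg_cst. Qed.

Lemma cont_comp (U V : topologicalType) (h : Z -> U) (k : U -> V) :
  continuous k -> continuous h -> continuous (fun z => k (h z)).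
Proof. by move=> ck ch z; apply: continuous_comp; [exact: ch | exact: ck]. Qed.

Lemma cont_pair (U V : topologicalType) (h : Z -> U) (k : Z -> V) :
  continuous h -> continuous k -> continuous (fun z => (h z, k z)).
Proof. by move=> ch ck z; apply: cvg_pair; [exact: ch | exact: ck]. Qed.

Lemma cont_glue (U : topologicalType) (c : Z -> R) (h k : Z -> U) :
  continuous c -> continuous h -> continuous k -> (forall z, c z = 0 -> h z = k z) ->
  continuous (fun z => if c z <= 0 then h z else k z).
Proof.
move=> cc ch ck hk z A /= Anb.
have half (B : set U) (m : Z -> U) : continuous m -> nbhs (m z) B -> nbhs z (m @^-1` B)%classic by move=> cm; apply: cm.
have [c0|c0|c0] := ltgtP (c z) 0.
- move: Anb; rewrite ltW // => /(half _ _ ch) Ah.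
  have : nbhs z (c @^-1` [set x | x < 0])%classic by apply: cc; apply: lt_nbhsl.
  by apply: filterS2 Ah => w /= Aw /ltW->.
- move: Anb; rewrite leNgt c0 /= => /(half _ _ ck) Ak.
  have : nbhs z (c @^-1` [set x | 0 < x])%classic by apply: cc; apply: lt_nbhsr.
  by apply: filterS2 Ak => w /= Aw cw; rewrite leNgt cw.
move: Anb; rewrite c0 lexx => Anb.
have Ah := half _ _ ch Anb; rewrite (hk _ c0) in Anb; have Ak := half _ _ ck Anb.
by apply: filterS2 Ah Ak => w /= ? ?; case: ifP.
Qed.

End RealContinuity.

Lemma cont_fst (U V : topologicalType) : continuous (fun z : U * V => z.1).
Proof. by move=> z; apply: cvg_fst. Qed.

Lemma cont_snd (U V : topologicalType) : continuous (fun z : U * V => z.2).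
Proof. by move=> z; apply: cvg_snd. Qed.

Lemma cont_id (U : topologicalType) : continuous (fun z : U => z).
Proof. by move=> z; apply: cvg_id. Qed.

Ltac real_cont := repeat first [ assumption | lazymatch goal with
  | |- continuous (fun z => z) => exact: cont_id
  | |- continuous (fun _ => ?c) => exact: cont_cst
  | |- continuous (fun z => z.1) => exact: cont_fst
  | |- continuous ( *%R ?c) => change (continuous (fun z => c * z))
  | |- continuous (+%R ?c) => change (continuous (fun z => c + z))
  | |- continuous fst => exact: cont_fst
  | |- continuous snd => exact: cont_snd
  | |- continuous (fun z => z.2) => exact: cont_snd
  | |- continuous (fun z => @?f z + @?g z) => apply: (@contD _ _ f g)
  | |- continuous (fun z => - @?f z) => apply: (@contN _ _ f)
  | |- continuous (fun z => @?f z * @?g z) => apply: (@contM _ _ f g)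
  | |- continuous (fun z => Num.min (@?f z) (@?g z)) => apply: (@contmin _ _ f g)
  | |- continuous (fun z => Num.max (@?f z) (@?g z)) => apply: (@contmax _ _ f g)
  | |- continuous (fun z => (@?f z, @?g z)) => apply: (@cont_pair _ _ _ f g)
  end].

Section Clamp.
Context {R : realType}.

Definition clamp (t : R) : R := Num.max 0 (Num.min t 1).

Lemma clampI t : 0 <= clamp t <= 1.
Proof. by rewrite /clamp /Num.max /Num.min; do 2!case: ifP; lra. Qed.

Lemma clampE (t : R) : 0 <= t <= 1 -> clamp t = t.
Proof. by rewrite /clamp /Num.max /Num.min; do 2!case: ifP; lra. Qed.

Lemma clamp_comp (Z : topologicalType) (f : Z -> R) :
  continuous f -> continuous (fun z => clamp (f z)).
Proof. by move=> cf; rewrite /clamp; real_cont. Qed.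

End Clamp.

Ltac rlra := repeat match goal with H : @eq (Topological.sort _) _ _ |- _ => clear H end; lra.

Section Paths.
Context {R : realType} {T : topologicalType}.
Implicit Types (f g h p q : R -> T) (x y : T) (a b : R -> R).

(** Continuity is required on the whole line and plane, which spares subspace topologies; [clamp]
    extends what is given only on the unit interval. *)
Definition path_homotopic f g : Prop := exists2 H : R * R -> T, continuous H &
  [/\ forall t : R, 0 <= t <= 1 -> H (0, t) = f t,
      forall t : R, 0 <= t <= 1 -> H (1, t) = g t,
      forall u : R, 0 <= u <= 1 -> H (u, 0) = f 0 &
      forall u : R, 0 <= u <= 1 -> H (u, 1) = f 1].

Local Notation "f ~~ g" := (path_homotopic f g) (at level 70).
Local Notation "f ** g" := (loop_concat f g) (at level 50, left associativity).
Local Notation rev := loop_reverse.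

Let I0 : 0 <= (0 : R) <= 1. Proof. by rewrite ?lexx ?ler01. Qed.
Let I1 : 0 <= (1 : R) <= 1. Proof. by rewrite ?lexx ?ler01. Qed.

Lemma homotopic_ends f g : f ~~ g -> f 0 = g 0 /\ f 1 = g 1.
Proof.
move=> [H _ [H0 H1 H2 H3]]; split; first by rewrite -(H1 0 I0) H2.
by rewrite -(H1 1 I1) H3.
Qed.

(** The two parameters are joined linearly in [R]. Associativity, units and inverses are instances:
    both sides are one path followed with different parameters. *)
Lemma homotopic_reparam f a b : continuous f -> continuous a -> continuous b ->
  a 0 = b 0 -> a 1 = b 1 -> (fun t => f (a t)) ~~ (fun t => f (b t)).
Proof.
move=> cf ca cb ab0 ab1; exists (fun z => f ((1 - z.1) * a z.2 + z.1 * b z.2)).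
  apply: (cont_comp cf); real_cont; apply: cont_comp => //; exact: cont_snd.
by split=> [t _|t _|u _|u _] /=; congr f; rewrite ?ab0 ?ab1; ring.
Qed.

Lemma homotopic_ext f g : continuous f -> (forall t : R, 0 <= t <= 1 -> f t = g t) -> f ~~ g.
Proof.
move=> cf fg; exists (fun z => f z.2); first by apply: cont_comp => //; exact: cont_snd.
by split=> // t tI; rewrite /= fg.
Qed.

Lemma homotopic_refl f : continuous f -> f ~~ f.
Proof. by move=> cf; apply: homotopic_ext. Qed.

Lemma homotopic_sym f g : f ~~ g -> g ~~ f.
Proof.
move=> fg; have [e0 e1] := homotopic_ends fg; case: fg => H cH [H0 H1 H2 H3].
exists (fun z => H (1 - z.1, z.2)).
  by apply: (cont_comp cH); apply: cont_pair; real_cont.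
have uI u : 0 <= u <= 1 -> 0 <= 1 - u <= (1 : R) by rlra.
split=> [t tI|t tI|u /uI uI'|u /uI uI'] /=.
- by rewrite subr0 H1.
- by rewrite subrr H0.
- by rewrite H2.
by rewrite H3.
Qed.

Lemma homotopic_trans g f h : f ~~ g -> g ~~ h -> f ~~ h.
Proof.
move=> fg; have [e0 e1] := homotopic_ends fg.
case: fg => H cH [H0 H1 H2 H3] [H' cH' [H'0 H'1 H'2 H'3]].
exists (fun z => if 2 * z.1 - 1 <= 0 then H (2 * z.1, clamp z.2) else H' (2 * z.1 - 1, clamp z.2)).
  apply: cont_glue.
  - by real_cont.
  - by apply: (cont_comp cH); apply: cont_pair; real_cont; apply: clamp_comp; real_cont.
  - by apply: (cont_comp cH'); apply: cont_pair; real_cont; apply: clamp_comp; real_cont.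
  by move=> z e; rewrite e (_ : 2 * z.1 = 1) ?H1 ?H'0 ?clampI //; rlra.
split=> [t tI|t tI|u uI|u uI] /=.
- by rewrite clampE //; case: ifP => h0; [rewrite mulr0 H0 | exfalso; rlra].
- by rewrite clampE //; case: ifP => h0; [exfalso; rlra | rewrite (_ : 2 * 1 - 1 = 1) ?H'1 //; ring].
- by rewrite clampE //; case: ifP => h0; [rewrite H2 //; rlra | rewrite H'2 //; rlra].
by rewrite clampE //; case: ifP => h0; [rewrite H3 //; rlra | rewrite H'3 //; rlra].
Qed.

Lemma concat_cont f g : continuous f -> continuous g -> f 1 = g 0 -> continuous (f ** g).
Proof.
move=> cf cg e.
have -> : f ** g = fun t => if t - 2^-1 <= 0 then f (2 * t) else g (2 * t - 1).
  by apply/funext => t; rewrite /loop_concat subr_le0.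
apply: cont_glue; first by real_cont.
- by apply: (cont_comp cf); real_cont.
- by apply: (cont_comp cg); real_cont.
by move=> t h; rewrite (_ : 2 * t = 1) ?subrr //; rlra.
Qed.

Lemma concat0 f g : (f ** g) 0 = f 0.
Proof. by rewrite /loop_concat; case: ifP => h; [rewrite mulr0|exfalso; rlra]. Qed.

Lemma concat1 f g : (f ** g) 1 = g 1.
Proof. by rewrite /loop_concat; case: ifP => h; [exfalso; rlra|congr g; ring]. Qed.

Lemma rev_cont f : continuous f -> continuous (rev f).
Proof. by move=> cf; apply: (cont_comp cf); real_cont. Qed.

Lemma rev0 f : rev f 0 = f 1. Proof. by rewrite /loop_reverse subr0. Qed.
Lemma rev1 f : rev f 1 = f 0. Proof. by rewrite /loop_reverse subrr. Qed.
Lemma revK f : rev (rev f) = f.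
Proof. by apply/funext => t; rewrite /loop_reverse; congr f; ring. Qed.

Lemma homotopic_concat f f' g g' : f ~~ f' -> g ~~ g' -> f 1 = g 0 -> f ** g ~~ f' ** g'.
Proof.
move=> [H cH [H0 H1 H2 H3]] [H' cH' [H'0 H'1 H'2 H'3]] fg.
exists (fun z => if z.2 - 2^-1 <= 0 then H (clamp z.1, 2 * z.2) else H' (clamp z.1, 2 * z.2 - 1)).
  apply: cont_glue.
  - by real_cont.
  - by apply: (cont_comp cH); apply: cont_pair; real_cont; apply: clamp_comp; real_cont.
  - by apply: (cont_comp cH'); apply: cont_pair; real_cont; apply: clamp_comp; real_cont.
  by move=> z e; rewrite (_ : 2 * z.2 = 1) ?subrr ?H3 ?H'2 ?clampI //; rlra.
split=> [t tI|t tI|u uI|u uI] /=; rewrite ?concat0 ?concat1 clampE //.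
- by rewrite /loop_concat subr_le0; case: ifP => h; [rewrite H0|rewrite H'0] => //; rlra.
- by rewrite /loop_concat subr_le0; case: ifP => h; [rewrite H1|rewrite H'1] => //; rlra.
- by case: ifP => h; [rewrite mulr0 H2|exfalso; rlra].
by case: ifP => h; [exfalso; rlra|rewrite (_ : 2 * 1 - 1 = 1) ?H'3 //; ring].
Qed.

Lemma homotopic_assoc f g h : continuous f -> continuous g -> continuous h ->
  f 1 = g 0 -> g 1 = h 0 -> f ** (g ** h) ~~ f ** g ** h.
Proof.
move=> cf cg ch fg gh; pose k := f ** g ** h.
have ck : continuous k by apply: concat_cont; rewrite ?concat1 //; apply: concat_cont.
(* The reparametrization has slopes 1/2, 1 and 2 and breaks at 1/2 and 3/4; being convex, it is the
   maximum of three affine functions. *)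
pose b (t : R) := Num.max (t / 2) (Num.max (t - 4^-1) (2 * t - 1)).
have cb : continuous b by rewrite /b; real_cont.
have b0 : b 0 = 0 by rewrite /b /Num.max; do 2!case: ifP; rlra.
have b1 : b 1 = 1 by rewrite /b /Num.max; do 2!case: ifP; rlra.
have := homotopic_reparam ck cb (@cont_id R) b0 b1.
apply: homotopic_trans; apply: homotopic_ext.
  by apply: concat_cont; rewrite ?concat0 //; apply: concat_cont.
move=> t tI; rewrite /k /loop_concat.
have [h1|h1] := leP t (2^-1).
  have -> : b t = t / 2 by rewrite /b /Num.max; do 2!case: ifP; rlra.
  do 2?[case: ifP => ?; last by exfalso; rlra]; congr f; rlra.
have [h2|h2] := leP (2 * t - 1) (2^-1).
  have -> : b t = t - 4^-1 by rewrite /b /Num.max; do 2!case: ifP; rlra.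
  case: ifP => ?; last by exfalso; rlra.
  case: ifP => h3; last by congr g; rlra.
  have -> : 2 * (2 * (t - 4^-1)) = 1 by rlra.
  by rewrite fg; congr g; rlra.
have -> : b t = 2 * t - 1 by rewrite /b /Num.max; do 2!case: ifP; rlra.
by case: ifP => ?; [exfalso; rlra|congr h; rlra].
Qed.

Lemma homotopic_concat_cst f : continuous f -> f ** cst (f 1) ~~ f.
Proof.
move=> cf; pose b (t : R) := Num.min (2 * t) 1.
have cb : continuous b by rewrite /b; real_cont.
have b0 : b 0 = 0 by rewrite /b /Num.min; case: ifP; rlra.
have b1 : b 1 = 1 by rewrite /b /Num.min; case: ifP; rlra.
have := homotopic_reparam cf cb (@cont_id R) b0 b1.
apply: homotopic_trans; apply: homotopic_ext; first by apply: concat_cont => //; exact: cont_cst.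
move=> t tI; rewrite /loop_concat; case: ifP => h; rewrite /b /Num.min; case: ifP => h' //.
  by congr f; rlra.
by exfalso; rlra.
Qed.

Lemma homotopic_cst_concat f : continuous f -> cst (f 0) ** f ~~ f.
Proof.
move=> cf; pose b (t : R) := Num.max (2 * t - 1) 0.
have cb : continuous b by rewrite /b; real_cont.
have b0 : b 0 = 0 by rewrite /b /Num.max; case: ifP; rlra.
have b1 : b 1 = 1 by rewrite /b /Num.max; case: ifP; rlra.
have := homotopic_reparam cf cb (@cont_id R) b0 b1.
apply: homotopic_trans; apply: homotopic_ext; first by apply: concat_cont => //; exact: cont_cst.
move=> t tI; rewrite /loop_concat; case: ifP => h; rewrite /b /Num.max; case: ifP => h' //.
  by rewrite /cst; congr f; rlra.
by exfalso; rlra.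
Qed.

Lemma homotopic_concat_rev f : continuous f -> f ** rev f ~~ cst (f 0).
Proof.
move=> cf; pose b (t : R) := Num.min (2 * t) (2 - 2 * t).
have cb : continuous b by rewrite /b; real_cont.
have b0 : b 0 = 0 by rewrite /b /Num.min; case: ifP; rlra.
have b1 : b 1 = 0 by rewrite /b /Num.min; case: ifP; rlra.
have c0 : continuous (fun _ : R => 0 : R) by exact: cont_cst.
have := homotopic_reparam cf cb c0 b0 b1.
apply: homotopic_trans; apply: homotopic_ext; first by apply: concat_cont; rewrite ?rev0 //; exact: rev_cont.
move=> t tI; rewrite /loop_concat /loop_reverse; case: ifP => h; rewrite /b /Num.min; case: ifP => h'; congr f; rlra.
Qed.

Lemma homotopic_rev_concat f : continuous f -> rev f ** f ~~ cst (f 1).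
Proof.
by move=> cf; have := homotopic_concat_rev (rev_cont cf); rewrite revK rev0.
Qed.

(** The two ways around the boundary of the square, parametrized by [(m, M)] and [(M, m)], are
    joined by straight lines inside it. *)
Lemma homotopic_square (H : R * R -> T) : continuous H ->
  (fun t => H (t, 0)) ** (fun t => H (1, t)) ~~ (fun t => H (0, t)) ** (fun t => H (t, 1)).
Proof.
move=> cH; pose m (t : R) : R := Num.min (2 * t) 1; pose M (t : R) : R := Num.max (2 * t - 1) 0.
have cm : continuous m by rewrite /m; real_cont.
have cM : continuous M by rewrite /M; real_cont.
have [m0 m1] : m 0 = 0 /\ m 1 = 1 by rewrite /m /Num.min; split; case: ifP; rlra.
have [M0 M1] : M 0 = 0 /\ M 1 = 1 by rewrite /M /Num.max; split; case: ifP; rlra.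
have cl a : continuous a -> continuous (fun z : R * R => a z.2).
  by move=> ca; apply: (cont_comp ca); exact: cont_snd.
have horizontal (x : R) : continuous (fun t => H (t, x)).
  by apply: (cont_comp cH); apply: cont_pair; real_cont.
have vertical (x : R) : continuous (fun t => H (x, t)).
  by apply: (cont_comp cH); apply: cont_pair; real_cont.
apply: (@homotopic_trans (fun t => H (m t, M t))).
  apply: homotopic_ext; first exact: concat_cont.
  move=> t tI; rewrite /loop_concat; case: ifP => h; congr (H (_, _)); rewrite /m /M /Num.min /Num.max; case: ifP => h'; rlra.
apply: (@homotopic_trans (fun t => H (M t, m t))); last first.
  apply: homotopic_sym; apply: homotopic_ext; first exact: concat_cont.
  move=> t tI; rewrite /loop_concat; case: ifP => h; congr (H (_, _)); rewrite /m /M /Num.min /Num.max; case: ifP => h'; rlra.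
exists (fun z => H ((1 - z.1) * m z.2 + z.1 * M z.2, (1 - z.1) * M z.2 + z.1 * m z.2)).
  by apply: (cont_comp cH); apply: cont_pair; have := cl _ cm; have := cl _ cM => ? ?; real_cont.
by split=> [t _|t _|u _|u _] /=; congr (H (_, _)); rewrite ?m0 ?m1 ?M0 ?M1; ring.
Qed.

End Paths.

Local Notation "f ~~ g" := (path_homotopic f g) (at level 70).
Local Notation "f ** g" := (loop_concat f g) (at level 50, left associativity).

(** * Paths modulo a subgroup of the fundamental group *)

Section Groupoid.
Context {R : realType} {T : topologicalType}.
Implicit Types (f g h p q r e : R -> T) (x y z w : T).
Local Notation rev := loop_reverse.

Definition is_path y z p : Prop := [/\ continuous p, p 0 = y & p 1 = z].

Lemma path_cst y : is_path y y (cst y).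
Proof. by split=> //; apply: cont_cst. Qed.

Lemma path_concat y z w p q : is_path y z p -> is_path z w q -> is_path y w (p ** q).
Proof.
move=> [cp p0 p1] [cq q0 q1]; split; rewrite ?concat0 ?concat1 //.
by apply: concat_cont; rewrite // p1 q0.
Qed.

Lemma path_rev y z p : is_path y z p -> is_path z y (rev p).
Proof. by move=> [cp p0 p1]; split; rewrite ?rev0 ?rev1 //; apply: rev_cont. Qed.

Lemma homotopic_rev_of_concat y z w p q : is_path y z p -> is_path z w q ->
  rev (p ** q) ~~ rev q ** rev p.
Proof.
move=> pp pq; have [cpq _ _] := path_rev (path_concat pp pq); apply: homotopic_ext => //.
case: pp pq => [cp p0 p1] [cq q0 q1] t tI; rewrite /loop_reverse /loop_concat.
case: leP => h1; case: leP => h2.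
- have -> : 2 * (1 - t) = 1 by rlra.
  have -> : 1 - 2 * t = 0 by rlra.
  by rewrite p1 q0.
- by congr p; rlra.
- by congr q; rlra.
by exfalso; rlra.
Qed.

Lemma homotopic_cancel y z w u p e q : is_path y z p -> is_path z w e -> is_path z u q ->
  (p ** e) ** (rev e ** q) ~~ p ** q.
Proof.
move=> pp pe pq; have [cp p0 p1] := pp; have [ce e0 e1] := pe; have [cq q0 q1] := pq.
have pr := path_rev pe; have [cr r0 r1] := pr.
have [ceq _ _] := path_concat pr pq.
apply: (homotopic_trans (g := p ** (e ** (rev e ** q)))).
  by apply: homotopic_sym; apply: homotopic_assoc; rewrite ?concat0 ?p1 ?e0 ?e1 ?r0.
apply: homotopic_concat; rewrite ?concat0 ?p1 ?e0 //; first exact: homotopic_refl.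
apply: (homotopic_trans (g := e ** rev e ** q)).
  by apply: homotopic_assoc; rewrite ?r0 ?r1 ?q0 ?e1.
apply: (homotopic_trans (g := cst z ** q)); last first.
  by rewrite -q0; apply: homotopic_cst_concat.
apply: homotopic_concat; rewrite ?concat1 ?r1 ?q0 //; last exact: homotopic_refl.
by rewrite -e0; apply: homotopic_concat_rev.
Qed.

Lemma homotopic_path y z p q : p ~~ q -> continuous q -> is_path y z p -> is_path y z q.
Proof. by move=> /homotopic_ends[e0 e1] cq [cp p0 p1]; split; rewrite -?e0 -?e1. Qed.

Section Generation.
Variables (x : T) (n : nat) (gens : 'I_n -> R -> T).
Local Notation gen := (generated_loop x gens).

Lemma path_is_loop p : is_path x x p -> is_loop x p.
Proof. by case=> cp p0 p1; split=> //; apply: continuous_subspaceT. Qed.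

Lemma homotopic_loop p q : p ~~ q -> is_path x x p -> loop_homotopic x p q.
Proof.
move=> [H cH [H0 H1 H2 H3]] [cp p0 p1]; exists H; first exact: continuous_subspaceT.
split=> t; rewrite inE /= in_itv /= => tI; rewrite ?H0 ?H1 ?H2 ?H3 //.
Qed.

Lemma gen_homotopic_path p q : gen p -> p ~~ q -> is_path x x p -> continuous q -> gen q.
Proof.
move=> gp pq pp cq; apply: (gen_homotopic gp); last exact: homotopic_loop.
exact/path_is_loop/(homotopic_path pq).
Qed.

(** For paths from [x] with a common end: equality of their cosets modulo the subgroup generated by
    [gens], an equivalence that survives prolonging both paths. *)
Definition genrel p q : Prop := gen (p ** rev q).

Lemma genrel_homotopic y p q : is_path x y p -> is_path x y q -> p ~~ q -> genrel p q.
Proof.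
move=> pp pq hpq; have [cp p0 p1] := pp; have [cq q0 q1] := pq.
apply: (@gen_homotopic_path (cst x)).
- exact: gen_cst.
- apply: homotopic_sym; apply: (homotopic_trans (g := q ** rev q)).
    apply: homotopic_concat => //; last by rewrite rev0 q1.
    by apply: homotopic_refl; apply: rev_cont.
  by rewrite -q0; apply: homotopic_concat_rev.
- exact: path_cst.
by case: (path_concat pp (path_rev pq)).
Qed.

Lemma genrel_sym y p q : is_path x y p -> is_path x y q -> genrel p q -> genrel q p.
Proof.
move=> pp pq gpq; apply: (@gen_homotopic_path (rev (p ** rev q))).
- exact: gen_reverse.
- by have := homotopic_rev_of_concat pp (path_rev pq); rewrite revK.
- exact: path_rev (path_concat pp (path_rev pq)).
by case: (path_concat pq (path_rev pp)).
Qed.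

Lemma genrel_trans y q p r : is_path x y p -> is_path x y q -> is_path x y r ->
  genrel p q -> genrel q r -> genrel p r.
Proof.
move=> pp pq pr gpq gqr; apply: (@gen_homotopic_path ((p ** rev q) ** (q ** rev r))).
- exact: gen_concat.
- by have := homotopic_cancel pp (path_rev pq) (path_rev pr); rewrite revK.
- exact: path_concat (path_concat pp (path_rev pq)) (path_concat pq (path_rev pr)).
by case: (path_concat pp (path_rev pr)).
Qed.

Lemma genrel_concat y z p q e : is_path x y p -> is_path x y q -> is_path y z e ->
  genrel p q -> genrel (p ** e) (q ** e).
Proof.
move=> pp pq pe gpq.
have ppe := path_concat pp pe; have pqe := path_concat pq pe.
have [c1 _ _] := path_concat ppe (path_rev pqe).
have [c2 _ _] := path_concat pp (path_rev pq).
apply: (@gen_homotopic_path (p ** rev q)) => //.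
  apply: homotopic_sym; apply: (homotopic_trans (g := (p ** e) ** (rev e ** rev q))).
    apply: homotopic_concat; last by have [_ _ ->] := ppe; have [_ -> _] := path_rev pqe.
      by apply: homotopic_refl; case: ppe.
    exact: homotopic_rev_of_concat pq pe.
  exact: homotopic_cancel pp pe (path_rev pq).
exact: path_concat pp (path_rev pq).
Qed.

Lemma genrel_cst p : is_path x x p -> genrel p (cst x) -> gen p.
Proof.
move=> pp gp; apply: (gen_homotopic_path gp).
- have -> : rev (cst x) = cst x :> (R -> T) by [].
  by have [cp _ p1] := pp; rewrite -[in cst _]p1; apply: homotopic_concat_cst.
- exact: path_concat pp (path_rev (path_cst x)).
by case: pp.
Qed.

Lemma clamp_path f : is_loop x f -> is_path x x (fun t => f (clamp t)).
Proof.
move=> [cf f0 f1]; split; rewrite ?clampE ?f0 ?f1 ?lexx ?ler01 //.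
move=> t; have := @clampI R t => cI.
have cft : (f @ within `[0, 1]%classic (nbhs (clamp t)) --> f (clamp t))%classic.
  by move/subspace_continuousP : cf; apply; rewrite /= in_itv.
move=> A /cft /= An; have := @clamp_comp R R id (@cont_id R) t _ An.
rewrite /= !nbhs_simpl /=; apply: filterS => s /=; apply.
by rewrite /= in_itv /=; exact: clampI.
Qed.

Lemma gen_clamp f : is_loop x f -> gen (fun t => f (clamp t)) -> gen f.
Proof.
move=> lf gf; apply: (gen_homotopic gf lf); have [cf f0 f1] := clamp_path lf.
exists (fun z : R * R => f (clamp z.2)).
  by apply: continuous_subspaceT; apply: (cont_comp cf); exact: cont_snd.
by split=> t; rewrite inE /= in_itv /= => tI; rewrite ?clampE ?lexx ?ler01 //; case: lf.
Qed.

End Generation.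

(** The line is connected, and both [S] and its complement are open. *)
Lemma locally_constant_real (S : R -> Prop) :
  (forall t, (\forall s \near t, S s <-> S t)%classic) -> S 0 -> S 1.
Proof.
move=> loc S0; have co : connected [set: R]%classic by apply/connected_intervalP => ? ?.
suff e : S = [set: R]%classic by rewrite e.
apply: co; first by exists 0.
  exists S; rewrite ?setTI //; rewrite openE => t St; have := loc t.
  by apply: filterS => s -[_]; apply.
exists S; rewrite ?setTI // -(setCK S); apply: open_closedC; rewrite openE => t St.
by have := loc t; apply: filterS => s -[h _] /h.
Qed.

End Groupoid.

(** * The geometric realization *)

Section RealizationTopology.
Context {disp : Order.disp_t} {P : finPOrderType disp} {R : realType}.
Variable X : {set P}.
Local Notation rz := (realization R X).
Local Notation coord := Defs.coord.
Local Notation vs := (vertices_of X).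
Implicit Types (y : rz) (F G u v : P).

Lemma closed_preimage (U V : topologicalType) (f : U -> V) (D : set V) :
  continuous f -> closed D -> closed (f @^-1` D)%classic.
Proof. by move=> cf; apply: preimage_closed => y _; apply: cf. Qed.

Lemma open_realizationE (U : set rz) : open U = realization_open U.
Proof. by []. Qed.

Lemma coord_cont : continuous (@Defs.coord disp P R X).
Proof. by apply/continuousP => A oA; rewrite open_realizationE => F FX; exists A. Qed.

Lemma ptws_cont (Z : topologicalType) (f : Z -> {ptws P -> R}) :
  (forall v, continuous (fun z => f z v)) -> continuous f.
Proof.
move=> cf z; apply/cvg_sup => v; apply/cvg_image.
  rewrite eqEsubset; split=> // r _; exists (fun _ => r) => //.
move=> A /= An; exists ((fun c : P -> R => c v) @^-1` A)%classic; first exact: cf An.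
by apply/seteqP; split=> [_ [c Ac <-]//|r Ar]; exists (fun _ => r).
Qed.

Lemma coord_at_cont v : continuous (fun y : rz => coord y v).
Proof.
apply: (cont_comp (k := fun c : {ptws P -> R} => c v) _ coord_cont).
exact: (@proj_continuous P (fun _ => R) v).
Qed.

Lemma ptws_at_cont v : continuous (fun c : {ptws P -> R} => c v).
Proof. exact: (@proj_continuous P (fun _ => R) v). Qed.

(** Coordinates do not separate faces with the same vertices, so their continuity alone is too weak.
    A finite closed cover whose members land in closed cells reduces the question to coordinates. *)
Lemma realization_cont (Z : topologicalType) (h : Z -> rz) (A : P -> set Z) :
  continuous (fun z => coord (h z)) -> (forall F, closed (A F)) ->
  (forall z, exists2 F, F \in X & A F z) ->
  (forall F z, A F z -> (carrier (h z) <= F)%O) -> continuous h.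
Proof.
move=> ch cA covA leA; apply/continuousP => U oU.
have [B BP] : exists B : P -> set {ptws P -> R}, forall F, F \in X ->
    open (B F) /\ (closed_cell F `&` U = closed_cell F `&` (@Defs.coord disp P R X) @^-1` (B F))%classic.
  apply: (@fin_all_exists _ (fun _ => set {ptws P -> R}) (fun F B => F \in X ->
    open B /\ (closed_cell F `&` U = closed_cell F `&` (@Defs.coord disp P R X) @^-1` B)%classic)) => F.
  have [FX|FX] := boolP (F \in X); last by exists classical_sets.set0.
  by move: oU; rewrite open_realizationE => /(_ F FX)[B oB BE]; exists B.
rewrite -(setCK (h @^-1` U)%classic); apply: closed_openC.
(* The complement of the preimage is a finite union of closed sets, one for each face. *)
have -> : (~` (h @^-1` U) = \bigcup_(F in [set F | F \in X])
    (A F `&` (fun z => coord (h z)) @^-1` (~` B F)))%classic.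
  apply/seteqP; split=> z /=.
    move=> nU; have [F FX AF] := covA z; exists F => //; split=> // BF; apply: nU.
    have : (closed_cell F `&` (@Defs.coord disp P R X) @^-1` (B F))%classic (h z).
      by split=> //; apply: leA.
    by rewrite -(BP F FX).2 => -[].
  move=> [F FX [AF nB]] Uz; apply: nB.
  have : (closed_cell F `&` U)%classic (h z) by split=> //; apply: leA.
  by rewrite (BP F FX).2 => -[].
apply: closed_bigcup; first exact: finite_finset.
move=> F FX; apply: closedI; first exact: cA.
by apply: closed_preimage => //; apply: open_closedC; case: (BP F FX).
Qed.

Lemma carrier_vertex y v : (v \in vs (carrier y)) = (coord y v != 0).
Proof.
have [vF|vF] := boolP (v \in vs (carrier y)); first by rewrite gt_eqF // coord_gt0.
by rewrite coord_eq0 // eqxx.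
Qed.

Lemma coord_ge0 y v : 0 <= coord y v.
Proof.
have [vF|vF] := boolP (v \in vs (carrier y)); first by rewrite ltW // coord_gt0.
by rewrite coord_eq0.
Qed.

Lemma point_eq (y z : rz) : carrier y = carrier z -> coord y = coord z -> y = z.
Proof.
case: y z => [F c h1 h2 h3 h4] [F' c' h1' h2' h3' h4'] /= eF ec; subst F' c'.
by congr Point; apply: Prop_irrelevance.
Qed.

Lemma carrier_nonempty y : exists v, v \in vs (carrier y).
Proof.
apply/existsP; apply: contraT => /existsPn h; have := coord_sum y; rewrite big1 => [/eqP|v _].
  by rewrite eq_sym oner_eq0.
by rewrite coord_eq0 // h.
Qed.

(** * Straight lines in closed cells *)

Section LocallyBoolean.
Hypothesis lbX : locally_boolean X.

Lemma point_face_eq F (y z : rz) : F \in X -> (carrier y <= F)%O -> (carrier z <= F)%O ->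
  coord y = coord z -> y = z.
Proof.
move=> FX yF zF e; apply: point_eq => //; apply: (vertices_of_inj lbX FX) => //; try exact: carrier_face.
by apply/setP => v; rewrite !carrier_vertex e.
Qed.

Lemma closed_cell_closed F : closed (closed_cell F : set rz).
Proof.
rewrite -(setCK (closed_cell F : set rz)); apply: open_closedC; rewrite open_realizationE => G GX.
(* Inside the cell of [G], the cell of [F] is the union of the cells of their finitely many common
   faces, each cut out by the vanishing of coordinates. *)
exists (~` \bigcup_(H in [set H | [&& H \in X, (H <= F)%O & (H <= G)%O]])
  [set c : {ptws P -> R} | forall v, v \in vs G -> v \notin vs H -> c v = 0])%classic.
  apply: closed_openC; apply: closed_bigcup; first exact: finite_finset.
  move=> H _; rewrite (_ : mkset _ = (\bigcap_(v in [set v | (v \in vs G) && (v \notin vs H)])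
     (fun c : {ptws P -> R} => c v) @^-1` [set 0])%classic); last first.
    apply/seteqP; split=> c /= h v; first by move=> /andP[]; apply: h.
    by move=> vG vH; apply: h; rewrite /= vG.
  apply: closed_bigI => v _; apply: closed_preimage; first exact: ptws_at_cont.
  exact: closed_eq.
apply/seteqP; split=> y [yG nF]; split=> //; apply: contra_not nF => /=.
  move=> [H /and3P[HX HF HG] c0]; rewrite /closed_cell /=; apply: le_trans HF.
  rewrite (vertices_of_le lbX GX) //; try exact: carrier_face.
  apply/fintype.subsetP => v vy; apply: contraT => vH.
  have vG : v \in vs G by apply: (fintype.subsetP (vertices_ofS X yG)).
  by move: vy; rewrite carrier_vertex c0 ?eqxx.
move=> yF; exists (carrier y); first by rewrite /= carrier_face yF yG.
by move=> v _ vy /=; rewrite coord_eq0.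
Qed.

Lemma point_exists F (c : P -> R) : F \in X -> (forall v, 0 <= c v) ->
  (forall v, v \notin vs F -> c v = 0) -> \sum_v c v = 1 ->
  exists y, coord y = c /\ (carrier y <= F)%O.
Proof.
move=> FX c_ge0 c0 c1; have sub : [set v in vs F | c v != 0] \subset vs F.
  by apply/fintype.subsetP => v; rewrite inE => /andP[].
have [G [GX GF vG]] := face_exists lbX FX sub.
have gt0 v : v \in vs G -> 0 < c v by rewrite vG inE => /andP[_ nz]; rewrite lt_neqAle eq_sym nz c_ge0.
have eq0 v : v \notin vs G -> c v = 0.
  rewrite vG inE negb_and => /orP[/c0//|]; by rewrite negbK => /eqP.
by exists (Point GX gt0 eq0 c1).
Qed.

(** The segment from [y] to [z] in the closed cell of [F], stationary outside [[0, 1]]. Within the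
    cell a point is determined by its coordinates; the default is never taken when both ends lie in
    the cell of a face [F] of [X]. *)
Definition comb F (y z : rz) (s : R) : rz := xget y [set w : rz | (carrier w <= F)%O /\
  coord w = (fun v => (1 - clamp s) * coord y v + clamp s * coord z v) :> (P -> R)]%classic.

Lemma combP F (y z : rz) s : F \in X -> (carrier y <= F)%O -> (carrier z <= F)%O ->
  (carrier (comb F y z s) <= F)%O /\
  coord (comb F y z s) = (fun v => (1 - clamp s) * coord y v + clamp s * coord z v) :> (P -> R).
Proof.
move=> FX yF zF; rewrite /comb; case: xgetP => [w _ [//]|none].
pose c v := (1 - clamp s) * coord y v + clamp s * coord z v.
have /andP[s0 s1] := clampI s.
have [|||w [wc wF]] := @point_exists F c FX.
- by move=> v; rewrite /c addr_ge0 // mulr_ge0 ?coord_ge0 ?subr_ge0.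
- move=> v vF; rewrite /c !coord_eq0 ?mulr0 ?addr0 //; apply: contra vF.
    exact: (fintype.subsetP (vertices_ofS X zF)).
  exact: (fintype.subsetP (vertices_ofS X yF)).
- by rewrite /c big_split /= -!mulr_sumr !coord_sum !mulr1 subrK.
by have := none w; case.
Qed.

Lemma comb0 F (y z : rz) : F \in X -> (carrier y <= F)%O -> (carrier z <= F)%O -> comb F y z 0 = y.
Proof.
move=> FX yF zF; have [cF cc] := combP 0 FX yF zF; apply: (point_face_eq FX) => //.
by rewrite cc; apply/funext => v; rewrite clampE ?lexx ?ler01 // subr0 mul1r mul0r addr0.
Qed.

Lemma comb1 F (y z : rz) : F \in X -> (carrier y <= F)%O -> (carrier z <= F)%O -> comb F y z 1 = z.
Proof.
move=> FX yF zF; have [cF cc] := combP 1 FX yF zF; apply: (point_face_eq FX) => //.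
by rewrite cc; apply/funext => v; rewrite clampE ?lexx ?ler01 // subrr mul1r mul0r add0r.
Qed.

(** The cell [G z] may jump with [z], controlled by the closed sets [A F]. This lets segments to a
    moving point pass from cell to cell. *)
Lemma comb_cont (Z : topologicalType) (G : Z -> P) (p q : Z -> rz) (s : Z -> R) (A : P -> set Z) :
  continuous p -> continuous q -> continuous s -> (forall F, closed (A F)) ->
  (forall z, A (G z) z) -> (forall F z, A F z -> (G z <= F)%O) ->
  (forall z, [/\ G z \in X, (carrier (p z) <= G z)%O & (carrier (q z) <= G z)%O]) ->
  continuous (fun z => comb (G z) (p z) (q z) (s z)).
Proof.
move=> cp cq cs clA AG leA GP; apply: (@realization_cont _ _ A) => //.
- apply: ptws_cont => v.
  have -> : (fun z => coord (comb (G z) (p z) (q z) (s z)) v) =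
      (fun z => (1 - clamp (s z)) * coord (p z) v + clamp (s z) * coord (q z) v).
    apply/funext => z; have [GX pG qG] := GP z.
    by have [_ ->] := combP (s z) GX pG qG.
  have := cont_comp (@coord_at_cont v) cp; have := cont_comp (@coord_at_cont v) cq.
  by have := clamp_comp cs => c1 c2 c3; real_cont.
- by move=> z; exists (G z) => //; case: (GP z).
move=> F z AF; have [GX pG qG] := GP z; have [cG _] := combP (s z) GX pG qG.
exact: le_trans cG (leA _ _ AF).
Qed.

Lemma comb_cell_cont (Z : topologicalType) F (p q : Z -> rz) (s : Z -> R) :
  F \in X -> continuous p -> continuous q -> continuous s ->
  (forall z, (carrier (p z) <= F)%O) -> (forall z, (carrier (q z) <= F)%O) ->
  continuous (fun z => comb F (p z) (q z) (s z)).
Proof.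
move=> FX cp cq cs pF qF; apply: (@comb_cont _ (fun _ => F) p q s (fun G => [set z | (F <= G)%O]%classic)) => //=.
move=> G; case: (F <= G)%O.
  suff -> : [set _ : Z | true]%classic = [set: Z]%classic by exact: closedT.
  by apply/seteqP; split.
suff -> : [set _ : Z | false]%classic = classical_sets.set0 by exact: closed0.
by apply/seteqP; split.
Qed.

Lemma cell_homotopic F (p q : R -> rz) : F \in X -> continuous p -> continuous q ->
  (forall t, (carrier (p t) <= F)%O) -> (forall t, (carrier (q t) <= F)%O) ->
  p 0 = q 0 -> p 1 = q 1 -> p ~~ q.
Proof.
move=> FX cp cq pF qF e0 e1; exists (fun z : R * R => comb F (p z.2) (q z.2) z.1).
  by apply: comb_cell_cont => //; [apply: (cont_comp cp)|apply: (cont_comp cq)|]; real_cont.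
split=> t tI /=; first by rewrite comb0.
- by rewrite comb1.
- have [cF cc] := combP t FX (pF 0) (qF 0); apply: (point_face_eq FX) => //.
  by rewrite cc; apply/funext => v; rewrite e0 -mulrDl subrK mul1r.
have [cF cc] := combP t FX (pF 1) (qF 1); apply: (point_face_eq FX) => //.
by rewrite cc; apply/funext => v; rewrite e1 -mulrDl subrK mul1r.
Qed.

Lemma line_path F (y z : rz) : F \in X -> (carrier y <= F)%O -> (carrier z <= F)%O ->
  is_path y z (comb F y z).
Proof.
move=> FX yF zF; split; [|exact: comb0|exact: comb1].
have := @comb_cell_cont R F (fun _ => y) (fun _ => z) (fun t => t) FX.
by apply=> //; real_cont.
Qed.

Lemma line_cell F (y z : rz) s : F \in X -> (carrier y <= F)%O -> (carrier z <= F)%O ->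
  (carrier (comb F y z s) <= F)%O.
Proof. by move=> FX yF zF; have [] := combP s FX yF zF. Qed.

Lemma point_of_face F v : F \in X -> v \in vs F -> exists y, carrier y = F.
Proof.
move=> FX vF; pose N : R := #|vs F|%:R.
have N0 : 0 < N by rewrite ltr0n; apply/card_gt0P; exists v.
(* The barycenter: equal weights on the vertices of [F]. *)
have [|||y [yc yF]] := @point_exists F (fun w => if w \in vs F then N^-1 else 0) FX.
- by move=> w; case: ifP => // _; rewrite invr_ge0 ltW.
- by move=> w /negbTE->.
- by rewrite -big_mkcond /= sumr_const -mulr_natl mulfV // gt_eqF.
exists y; apply: (vertices_of_inj lbX FX) => //; try exact: carrier_face.
apply/setP => w; rewrite carrier_vertex yc; case: (w \in vs F); rewrite ?eqxx // .
by rewrite invr_eq0 gt_eqF.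
Qed.

(** * Segments from a vertex to the points of its open star *)

Section BasePoint.
Variable x0 : rz.

(** Some point of the open cell of [F], for a vertex the vertex itself. The default [x0] is never
    taken on a nonempty face of [X]. *)
Definition face_point F : rz := xget x0 [set y | carrier y = F]%classic.

Lemma carrier_face_point F v : F \in X -> v \in vs F -> carrier (face_point F) = F.
Proof.
move=> FX vF; rewrite /face_point; case: xgetP => [y _ //|none].
by have [y /none] := point_of_face FX vF.
Qed.

Lemma vertex_face v y : v \in vs (carrier y) -> [/\ v \in X, v \in vs v & (v <= carrier y)%O].
Proof. by rewrite !inE => /andP[/andP[-> ->] ->]; rewrite lexx. Qed.

Definition ray u y : R -> rz := comb (carrier y) (face_point u) y.

Lemma vertex_point_le u y : u \in vs (carrier y) -> (carrier (face_point u) <= carrier y)%O.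
Proof. by move=> uy; have [uX uu uF] := vertex_face uy; rewrite (carrier_face_point uX uu). Qed.

Lemma ray_path u y : u \in vs (carrier y) -> is_path (face_point u) y (ray u y).
Proof. by move=> uy; apply: line_path; rewrite ?carrier_face ?vertex_point_le. Qed.

Lemma ray_cell u y s : u \in vs (carrier y) -> (carrier (ray u y s) <= carrier y)%O.
Proof. by move=> uy; apply: line_cell; rewrite ?carrier_face ?vertex_point_le. Qed.

Lemma ray_line F u (y z : rz) : F \in X -> (carrier y <= F)%O -> (carrier z <= F)%O ->
  u \in vs (carrier y) -> u \in vs (carrier z) -> ray u y ** comb F y z ~~ ray u z.
Proof.
move=> FX yF zF uy uz; have py := ray_path uy; have pz := ray_path uz; have pl := line_path FX yF zF.
have [cc c0 c1] := path_concat py pl; have [cz z0 z1] := pz.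
apply: (cell_homotopic FX) => //; rewrite ?c0 ?c1 ?z0 ?z1 //.
  move=> t; rewrite /loop_concat; case: ifP => _; last exact: line_cell.
  exact: le_trans (ray_cell _ uy) yF.
by move=> t; apply: le_trans (ray_cell _ uz) zF.
Qed.

(** The segments from [u] to the moving point [g t] sweep a square with one side constant at [u];
    comparing the two ways around it gives the claim. The carrier may change along [g], and
    closedness of the closed cells keeps the square continuous. *)
Lemma ray_star u (g : R -> rz) : continuous g -> (forall t, u \in vs (carrier (g t))) ->
  ray u (g 0) ** g ~~ ray u (g 1).
Proof.
move=> cg ug; pose H (z : R * R) := ray u (g z.1) z.2.
have cg1 : continuous (fun z : R * R => g z.1) by apply: (cont_comp cg); real_cont.
have cH : continuous H.
  apply: (@comb_cont _ (fun z : R * R => carrier (g z.1)) (fun _ => face_point u)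
    (fun z => g z.1) (fun z => z.2) (fun F => (fun z : R * R => g z.1) @^-1` closed_cell F)%classic) => //=.
  - exact: cont_cst.
  - exact: cont_snd.
  - by move=> F; apply: closed_preimage => //; apply: closed_cell_closed.
  - by move=> z; rewrite /closed_cell /= lexx.
  by move=> z; rewrite carrier_face vertex_point_le.
have := homotopic_square cH; rewrite /H /=.
have [c0 r00 r01] := ray_path (ug 0); have [c1 r10 r11] := ray_path (ug 1).
have -> : (fun t => ray u (g t) 0) = cst (face_point u).
  by apply/funext => t; have [_ -> _] := ray_path (ug t).
have -> : (fun t => ray u (g t) 1) = g.
  by apply/funext => t; have [_ _ ->] := ray_path (ug t).
move=> sq; apply: homotopic_trans (homotopic_sym sq) _.
by rewrite -r10; apply: homotopic_cst_concat.
Qed.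

End BasePoint.

Lemma star_open u : open [set y : rz | u \in vs (carrier y)]%classic.
Proof.
rewrite (_ : mkset _ = (fun y : rz => coord y u) @^-1` [set r | 0 < r])%classic.
  by apply: open_comp => [y _|]; [exact: coord_at_cont | exact: open_gt].
apply/seteqP; split=> y /=; first exact: coord_gt0.
by rewrite carrier_vertex => h; rewrite gt_eqF.
Qed.

(** If no face had vertices on both sides, the open stars of the vertices in [W] and those of the
    others would split the realization into two nonempty open sets. *)
Lemma connected_crossing (W : {set P}) a b : connected [set: rz]%classic ->
  a \in vertices X -> b \in vertices X -> a \in W -> b \notin W ->
  exists F u w, [/\ F \in X, u \in vs F, w \in vs F, u \in W & w \notin W].
Proof.
move=> co aV bV aW bW; apply: contrapT => none.
have pt v : v \in vertices X -> exists y, carrier y = v.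
  by move=> vV; apply: (@point_of_face v v); move: vV; rewrite ?inE ?lexx ?andbT // => /andP[].
have [ya ea] := pt a aV; have [yb eb] := pt b bV.
have self v y : carrier y = v -> v \in vertices X -> v \in vs (carrier y).
  by move=> -> vV; rewrite inE vV lexx.
pose U := [set y : rz | exists2 v, v \in W & v \in vs (carrier y)]%classic.
pose U' := [set y : rz | exists2 v, v \notin W & v \in vs (carrier y)]%classic.
have openU (Q : pred P) : open [set y : rz | exists2 v, Q v & v \in vs (carrier y)]%classic.
  rewrite (_ : mkset _ = \bigcup_(v in [set v | Q v]) [set y : rz | v \in vs (carrier y)])%classic.
    by apply: bigcup_open => v _; apply: star_open.
  by apply/seteqP; split=> y /= [v Qv vy]; exists v.
have UC : (~` U = U')%classic.
  apply/seteqP; split=> y /=.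
    move=> nU; have [v vy] := carrier_nonempty y; exists v => //; apply/negP => vW.
    by apply: nU; exists v.
  move=> [w wW wy] [u uW uy]; apply: none; exists (carrier y), u, w; split=> //.
  exact: carrier_face.
have UT : U = [set: rz]%classic.
  apply: co.
  - by exists ya; exists a => //; apply: self.
  - by exists U; rewrite ?setTI //; apply: openU.
  exists U; rewrite ?setTI // -(setCK U) UC; apply: open_closedC.
  exact: (openU (fun v => v \notin W)).
have : U' yb by exists b => //; apply: self.
by rewrite -UC UT; apply.
Qed.

End LocallyBoolean.
End RealizationTopology.

(** * Generators of the fundamental group *)

From mathcomp Require Import fintype finset.

Section Generators.
Context {disp : Order.disp_t} {P : finPOrderType disp} {R : realType}.
Variables (X : {set P}) (e0 : P) (s : seq P) (x0 : realization R X).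
Hypothesis lbX : locally_boolean X.
Hypothesis minX : minimals X = [set e0].
Hypothesis sP : vertex_ordering X s.
Hypothesis connX : connected [set: realization R X]%classic.
Local Notation rz := (realization R X).
Local Notation vs := (vertices_of X).
Local Notation redges := (redges X s).
Local Notation pt := (face_point x0).
Local Notation ray := (ray x0).
Local Notation rev := loop_reverse.
Implicit Types (e F G u v w : P) (W T : {set P}) (y : rz).

Let carrier_pt F v : F \in X -> v \in vs F -> carrier (pt F) = F.
Proof. exact: carrier_face_point. Qed.

Lemma edge_of_face F u w : F \in X -> u \in vs F -> w \in vs F -> u != w ->
  exists e, [/\ e \in X, (e <= F)%O, vs e = [set u; w] & rank X e = 2].
Proof.
move=> FX uF wF uw; have sub : [set u; w] \subset vs F by rewrite subUset !sub1set uF.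
have [e [eX eF ve]] := face_exists lbX FX sub; exists e; split=> //.
by rewrite (rank_card lbX) // ve cards2 uw.
Qed.

Lemma edge_vertices e u w : e \in X -> rank X e = 2 -> u \in vs e -> w \in vs e -> u != w ->
  vs e = [set u; w].
Proof.
move=> eX r2 ue we uw; apply/esym/eqP.
by rewrite eqEcard subUset !sub1set ue we -(rank_card lbX) // r2 cards2 uw.
Qed.

(** Otherwise membership in [W] would be constant on each kept edge, then by [edge_induction] on
    every edge, against the existence of a face with vertices on both sides. *)
Lemma crossing_redge W a b : a \in vertices X -> b \in vertices X -> a \in W -> b \notin W ->
  exists e u w, [/\ e \in redges, vs e = [set u; w], u \in W & w \notin W].
Proof.
move=> aV bV aW bW; apply: contrapT => none.
have good e : e \in X -> rank X e = 2 -> forall u w, u \in vs e -> w \in vs e -> (u \in W) = (w \in W).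
  apply: (edge_induction lbX minX sP (Good := fun e => forall u w, u \in vs e -> w \in vs e -> (u \in W) = (w \in W))).
    move=> f fR; have [fX r2] := redges_edge lbX minX sP fR.
    have cross u w : u \in vs f -> w \in vs f -> u \in W -> w \in W.
      move=> uf wf uW; apply: contraT => wW; exfalso; apply: none; exists f, u, w; split=> //.
      by apply: edge_vertices => //; apply: contraNneq wW => <-.
    by move=> u w uf wf; apply/idP/idP; apply: cross.
  move=> F p q r e1 e2 e3 FX vF pq qr pr [e1X _ v1] [e2X _ v2] [e3X _ v3] g1 g2 u w.
  have pq' : (p \in W) = (q \in W) by apply: g1; rewrite v1 !inE eqxx ?orbT.
  have qr' : (q \in W) = (r \in W) by apply: g2; rewrite v2 !inE eqxx ?orbT.
  by rewrite v3 !inE => /orP[]/eqP-> /orP[]/eqP->; rewrite ?pq' ?qr'.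
have [F [u [w [FX uF wF uW wW]]]] := connected_crossing lbX connX aV bV aW bW.
have uw : u != w by apply: contraNneq wW => <-.
have [e [eX _ ve r2]] := edge_of_face FX uF wF uw.
by move: wW; rewrite -(good e eX r2 u w) ?uW // ve !inE eqxx ?orbT.
Qed.

Definition base_path (gam : P -> R -> rz) u y : R -> rz := gam u ** ray u y.

(** A tree [T] of kept edges on the vertices [W], recorded by its edge count and by paths [gam u]
    from the base point. That these follow the tree is expressed by homotopy: on an edge of [T] the
    routes through its two ends agree. As [x0] may not be a vertex, the initial path is the reversed
    ray from a vertex of its carrier. *)
Definition spanning W T (gam : P -> R -> rz) : Prop :=
  [/\ W \subset vertices X, T \subset redges, #|T|.+1 = #|W| &
  [/\ forall e, e \in T -> vs e \subset W,
      forall u, u \in W -> is_path x0 (pt u) (gam u),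
      forall e u w, e \in T -> u \in vs e -> w \in vs e ->
        base_path gam u (pt e) ~~ base_path gam w (pt e) &
      exists u, [/\ u \in vs (carrier x0), u \in W & gam u = rev (ray u x0)]]].

Lemma base_path_path (gam : P -> R -> rz) u y : is_path x0 (pt u) (gam u) ->
  u \in vs (carrier y) -> is_path x0 y (base_path gam u y).
Proof. by move=> pu uy; apply: path_concat pu _; apply: ray_path. Qed.

Lemma homotopic_concat_revK (T' : topologicalType) (a b c : T') (p q : R -> T') :
  is_path a b p -> is_path c b q -> (p ** rev q) ** q ~~ p.
Proof.
move=> pp pq; have [cp p0 p1] := pp; have [cq q0 q1] := pq; have [cr r0 r1] := path_rev pq.
apply: (homotopic_trans (g := p ** (rev q ** q))).
  by apply: homotopic_sym; apply: homotopic_assoc; rewrite ?p1 ?r0 ?r1.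
apply: (homotopic_trans (g := p ** cst b)); last by rewrite -p1; apply: homotopic_concat_cst.
apply: homotopic_concat; rewrite ?concat0 ?p1 //; first exact: homotopic_refl.
by rewrite -q1; apply: homotopic_rev_concat.
Qed.

Lemma spanning_exists : exists T gam, spanning (vertices X) T gam.
Proof.
have [u0 u0x] := carrier_nonempty x0.
have u0V : u0 \in vertices X by move: u0x; rewrite inE => /andP[].
have grow n : forall W T gam, (#|vertices X :\: W| <= n)%N -> spanning W T gam ->
    exists T gam, spanning (vertices X) T gam.
  elim: n => [|n IHn] W T gam.
    rewrite leqn0 cards_eq0 setD_eq0 => VW sp; exists T, gam.
    have [WV _ _ _] := sp; suff -> : vertices X = W by [].
    by apply/eqP; rewrite eqEsubset VW.
  move=> le_n sp; have [WV TR cT [TW gp gh [u1 [u1x u1W gu1]]]] := sp.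
  have [/eqP|[b]] := set_0Vmem (vertices X :\: W).
    by rewrite -cards_eq0 => /eqP c0; apply: (IHn W T gam) => //; rewrite c0.
  rewrite inE => /andP[bW bV].
  have u1V : u1 \in vertices X by apply: (subsetP WV).
  have [e [u [w [eR ve uW wW]]]] := crossing_redge u1V bV u1W bW.
  have [eX r2] := redges_edge lbX minX sP eR.
  have ue : u \in vs e by rewrite ve !inE eqxx.
  have we : w \in vs e by rewrite ve !inE eqxx orbT.
  have ce : carrier (pt e) = e by apply: carrier_pt ue.
  have eT : e \notin T by apply: contra wW => /TW/subsetP; apply.
  have uw : u != w by apply: contraNneq wW => <-.
  (* The new vertex is reached through [u] and the point [pt e] of the new edge, so that the two
     routes to [pt e] are homotopic by cancellation. *)
  pose gam' v := if v == w then base_path gam u (pt e) ** rev (ray w (pt e)) else gam v.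
  have gam'E v : v \in W -> gam' v = gam v.
    by move=> vW; rewrite /gam'; case: eqP => // evw; rewrite evw (negbTE wW) in vW.
  have pu : is_path x0 (pt e) (base_path gam u (pt e)) by apply: base_path_path; rewrite ?ce //; apply: gp.
  have prw : is_path (pt w) (pt e) (ray w (pt e)) by apply: ray_path; rewrite ?ce.
  have wV : w \in vertices X by move: we; rewrite inE => /andP[].
  apply: (IHn (w |: W) (e |: T) gam').
    rewrite -ltnS; apply: leq_trans le_n; apply: proper_card; apply/properP; split.
      by apply/subsetP => v; rewrite !inE negb_or => /andP[/andP[_ ->] ->].
    by exists w; rewrite in_setD ?in_setU1 ?eqxx ?wW ?wV.
  split; [| | |split].
  - by rewrite subUset sub1set wV.
  - by rewrite subUset sub1set eR.
  - by rewrite !cardsU1 eT wW -cT.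
  - move=> f /setU1P[->|/TW fW]; last exact: subset_trans fW (subsetUr _ _).
    by rewrite ve subUset !sub1set !inE uW eqxx orbT.
  - move=> v /setU1P[->|vW]; last by rewrite gam'E //; apply: gp.
    by rewrite /gam' eqxx; apply: path_concat pu (path_rev prw).
  - have huw : base_path gam' w (pt e) ~~ base_path gam' u (pt e).
      rewrite /base_path (gam'E u uW) /gam' eqxx.
      exact: homotopic_concat_revK pu prw.
    move=> f v v' /setU1P[->|fT].
      have ref z : z \in vs e -> base_path gam' z (pt e) ~~ base_path gam' z (pt e).
        rewrite ve => /set2P[]->; last exact: homotopic_trans huw (homotopic_sym huw).
        exact: homotopic_trans (homotopic_sym huw) huw.
      move=> ze z'e; have := ze; have := z'e; rewrite {1 2}ve.
      move=> /set2P[ez'|ez'] /set2P[ez|ez]; rewrite ez ez'; try exact: ref.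
        exact: huw.
      exact: homotopic_sym.
    move=> vf v'f; have fW := subsetP (TW f fT).
    by rewrite /base_path (gam'E v (fW _ vf)) (gam'E v' (fW _ v'f)); apply: gh.
  exists u1; rewrite gam'E // in_setU1 u1W orbT; split=> //.
apply: (grow #|vertices X| [set u0] set0 (fun _ => rev (ray u0 x0))).
  by apply: subset_leq_card; apply: subsetDl.
split; [by rewrite sub1set | exact: sub0set | by rewrite cards0 cards1 | split].
- by move=> e; rewrite inE.
- by move=> u /set1P->; apply: path_rev; apply: ray_path.
- by move=> e u w; rewrite inE.
by exists u0; rewrite set11.
Qed.

Section Spanned.
Variables (T : {set P}) (gam : P -> R -> rz).
Hypothesis sp : spanning (vertices X) T gam.
Local Notation NT := (redges :\: T).
Local Notation kap := (base_path gam).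

Let gam_path u F : u \in vs F -> is_path x0 (pt u) (gam u).
Proof. by move=> uF; have [_ _ _ [_ gp _ _]] := sp; apply: gp; move: uF; rewrite inE => /andP[]. Qed.

Let kap_path u y : u \in vs (carrier y) -> is_path x0 y (kap u y).
Proof. by move=> uy; apply: (base_path_path (gam_path uy) uy). Qed.

Lemma edge_ends : exists ab : P -> P * P, forall e, e \in X -> rank X e = 2 ->
  vs e = [set (ab e).1; (ab e).2].
Proof.
apply: (@fin_all_exists _ (fun _ => (P * P)%type) (fun e ab => e \in X -> rank X e = 2 -> vs e = [set ab.1; ab.2])) => e.
have [eX|_] := boolP (e \in X); last by exists (e, e).
have [r2|nr] := eqVneq (rank X e) 2; last by exists (e, e) => _ r2; rewrite r2 eqxx in nr.
have := r2; rewrite (rank_card lbX) // => /eqP/cards2P[u [w [_ ve]]].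
by exists (u, w).
Qed.

Lemma loops_generate : pi1_generated (R := R) x0 #|NT|.
Proof.
have [_ TR cT [_ _ gh [u0 [u0x _ gu0]]]] := sp.
have [ab abP] := edge_ends.
(* One generator for each kept edge outside [T]: out to a point of the edge through one end, back
   through the other. *)
pose gens (i : 'I_#|NT|) := let e := enum_val i in
  kap (ab e).1 (pt e) ** rev (kap (ab e).2 (pt e)).
have edgeP e : e \in redges -> [/\ e \in X, rank X e = 2, (ab e).1 \in vs e, (ab e).2 \in vs e & carrier (pt e) = e].
  move=> eR; have [eX r2] := redges_edge lbX minX sP eR.
  have v1 : (ab e).1 \in vs e by rewrite (abP e eX r2) !inE eqxx.
  have v2 : (ab e).2 \in vs e by rewrite (abP e eX r2) !inE eqxx orbT.
  by split=> //; apply: carrier_pt v1.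
exists gens; split.
  move=> i; apply: path_is_loop; rewrite /gens /=.
  have /setDP[eR _] := enum_valP i; have [eX r2 v1 v2 ce] := edgeP _ eR.
  by apply: path_concat (kap_path _) (path_rev (kap_path _)); rewrite ce.
pose E := genrel x0 gens.
have Erefl u y : u \in vs (carrier y) -> E (kap u y) (kap u y).
  move=> uy; have pk := kap_path uy; apply: (genrel_homotopic gens pk pk).
  by apply: homotopic_refl; case: pk.
have Esym u w y : u \in vs (carrier y) -> w \in vs (carrier y) -> E (kap u y) (kap w y) -> E (kap w y) (kap u y).
  by move=> uy wy; apply: genrel_sym (kap_path uy) (kap_path wy).
have Etrans u v w y : u \in vs (carrier y) -> v \in vs (carrier y) -> w \in vs (carrier y) ->
    E (kap u y) (kap v y) -> E (kap v y) (kap w y) -> E (kap u y) (kap w y).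
  by move=> uy vy wy; apply: genrel_trans (kap_path uy) (kap_path vy) (kap_path wy).
have kap_line F u (y z : rz) : F \in X -> (carrier y <= F)%O -> (carrier z <= F)%O ->
    u \in vs (carrier y) -> u \in vs (carrier z) -> kap u y ** comb F y z ~~ kap u z.
  move=> FX yF zF uy uz; have pg := gam_path uy; have pr := ray_path lbX x0 uy; have pl := line_path lbX FX yF zF.
  have [cg g0 g1] := pg; have [cr r0 r1] := pr; have [cl l0 l1] := pl.
  apply: (homotopic_trans (g := gam u ** (ray u y ** comb F y z))).
    by apply: homotopic_sym; apply: homotopic_assoc; rewrite ?g1 ?r0 ?r1 ?l0.
  apply: homotopic_concat; rewrite ?concat0 ?g1 ?r0 //; first exact: homotopic_refl.
  exact: ray_line.
(* Agreement of the routes through [u] and [w] passes between any two points of a closed cell whose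
   carriers both contain [u] and [w]: both routes are prolonged by the same segment. *)
have transfer F u w (y z : rz) : F \in X -> (carrier y <= F)%O -> (carrier z <= F)%O ->
    u \in vs (carrier y) -> w \in vs (carrier y) -> u \in vs (carrier z) -> w \in vs (carrier z) ->
    E (kap u y) (kap w y) -> E (kap u z) (kap w z).
  move=> FX yF zF uy wy uz wz Ey; have pl := line_path lbX FX yF zF.
  have pu := path_concat (kap_path uy) pl; have pw := path_concat (kap_path wy) pl.
  have E1 : E (kap u z) (kap u y ** comb F y z).
    by apply: (genrel_homotopic gens (kap_path uz) pu _); apply: homotopic_sym; apply: kap_line.
  have E2 : E (kap u y ** comb F y z) (kap w y ** comb F y z).
    exact: genrel_concat (kap_path uy) (kap_path wy) pl Ey.
  have E3 : E (kap w y ** comb F y z) (kap w z).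
    by apply: (genrel_homotopic gens pw (kap_path wz) _); apply: kap_line.
  apply: (genrel_trans (kap_path uz) pu (kap_path wz) E1 _).
  exact: genrel_trans pu pw (kap_path wz) E2 E3.
(* On a kept edge the two routes agree by the tree or by the generator of that edge; a triangle
   passes the relation from two sides to the third through a point of its interior. *)
have Eedge e : e \in X -> rank X e = 2 -> forall u w, u \in vs e -> w \in vs e -> E (kap u (pt e)) (kap w (pt e)).
  apply: (edge_induction lbX minX sP (Good := fun e => forall u w, u \in vs e -> w \in vs e -> E (kap u (pt e)) (kap w (pt e)))).
    move=> f fR; have [fX r2 v1 v2 cf] := edgeP f fR.
    have [fT|fT] := boolP (f \in T).
      move=> u w uf wf; by apply: (genrel_homotopic gens (kap_path _) (kap_path _) (gh f u w fT uf wf)); rewrite cf.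
    have fN : f \in NT by rewrite inE fT.
    have Eab : E (kap (ab f).1 (pt f)) (kap (ab f).2 (pt f)).
      have := gen_base x0 gens (enum_rank_in fN f); rewrite /gens /= enum_rankK_in //.
    move=> u w; rewrite (abP f fX r2) => /set2P[]-> /set2P[]->; rewrite -?(abP f fX r2).
    - by apply: Erefl; rewrite cf.
    - exact: Eab.
    - by apply: Esym; rewrite ?cf.
    by apply: Erefl; rewrite cf.
  move=> F a b c e1 e2 e3 FX vF ab_ bc ac [e1X e1F v1] [e2X e2F v2] [e3X e3F v3] g1 g2.
  have cF : carrier (pt F) = F by apply: (carrier_pt FX (v := a)); rewrite vF !inE eqxx.
  have c1 : carrier (pt e1) = e1 by apply: (carrier_pt e1X (v := a)); rewrite v1 !inE eqxx.
  have c2 : carrier (pt e2) = e2 by apply: (carrier_pt e2X (v := b)); rewrite v2 !inE eqxx.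
  have c3 : carrier (pt e3) = e3 by apply: (carrier_pt e3X (v := a)); rewrite v3 !inE eqxx.
  have Fa : a \in vs F by rewrite vF !inE eqxx.
  have Fb : b \in vs F by rewrite vF !inE eqxx orbT.
  have Fc : c \in vs F by rewrite vF !inE eqxx orbT.
  have Eac : E (kap a (pt F)) (kap c (pt F)).
    apply: (Etrans a b c); rewrite ?cF //.
      apply: (transfer F a b (pt e1) (pt F)); rewrite ?cF ?c1 ?lexx ?v1 ?set21 ?set22 //.
      by apply: g1; rewrite v1 ?set21 ?set22.
    apply: (transfer F b c (pt e2) (pt F)); rewrite ?cF ?c2 ?lexx ?v2 ?set21 ?set22 //.
    by apply: g2; rewrite v2 ?set21 ?set22.
  have Eac3 : E (kap a (pt e3)) (kap c (pt e3)).
    by apply: (transfer F a c (pt F) (pt e3)); rewrite ?cF ?c3 ?lexx ?v3 ?set21 ?set22.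
  move=> u w; rewrite v3 => /set2P[]-> /set2P[]->.
  - by apply: Erefl; rewrite c3 v3 set21.
  - exact: Eac3.
  - by apply: Esym; rewrite ?c3 ?v3 ?set21 ?set22.
  by apply: Erefl; rewrite c3 v3 set22.
have Epoint u w y : u \in vs (carrier y) -> w \in vs (carrier y) -> E (kap u y) (kap w y).
  move=> uy wy; have [->|uw] := eqVneq u w; first exact: Erefl.
  have cX := carrier_face y; have [e [eX ey ve r2]] := edge_of_face cX uy wy uw.
  have ue : u \in vs e by rewrite ve set21.
  have we : w \in vs e by rewrite ve set22.
  have ce := carrier_pt eX ue.
  by apply: (transfer (carrier y) u w (pt e) y); rewrite ?ce ?lexx //; apply: Eedge.
move=> f lf; apply: (gen_clamp lf _); set fc := fun t => f (clamp t).
have pfc : is_path x0 x0 fc by exact: clamp_path.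
have [cfc fc0 fc1] := pfc.
(* The loop up to time [t], run in unit time. It makes sense for every real [t], so connectedness of
   the line can be used. *)
pose ft t : R -> rz := fun r => fc (t * r).
have ft_path t : is_path x0 (fc t) (ft t).
  by split; rewrite /ft ?mulr0 ?mulr1 //; apply: (cont_comp cfc); real_cont.
pose S t := forall w, w \in vs (carrier (fc t)) -> E (ft t) (kap w (fc t)).
(* The times may come in either order, so this one step gives both directions of local constancy. *)
have step t1 t2 u : (forall r, u \in vs (carrier (fc (t1 + (t2 - t1) * clamp r)))) -> S t1 -> S t2.
  move=> ug S1 w wt2; pose g r := fc (t1 + (t2 - t1) * clamp r).
  have cl := @clamp_comp R R (fun r => r) (@cont_id R).
  have cg : continuous g by apply: (cont_comp cfc); real_cont.
  have g0 : g 0 = fc t1 by rewrite /g clampE ?lexx ?ler01 // mulr0 addr0.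
  have g1 : g 1 = fc t2 by rewrite /g clampE ?lexx ?ler01 // mulr1 addrC subrK.
  have pg : is_path (fc t1) (fc t2) g by [].
  have ut1 : u \in vs (carrier (fc t1)) by rewrite -g0; apply: ug.
  have ut2 : u \in vs (carrier (fc t2)) by rewrite -g1; apply: ug.
  have h1 : ft t2 ~~ ft t1 ** g.
    pose m (r : R) : R := Num.min (2 * r) 1; pose M (r : R) : R := Num.max (2 * r - 1) 0.
    have cm : continuous m by rewrite /m; real_cont.
    have cM : continuous M by rewrite /M; real_cont.
    (* [b] runs from 0 to [t1], then from [t1] to [t2], and agrees with [a] at both ends. *)
    pose a r := t2 * r; pose b r := t1 * m r + (t2 - t1) * M r.
    have ca : continuous a by rewrite /a; real_cont.
    have cb : continuous b by rewrite /b; real_cont.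
    have a0 : a 0 = b 0 by rewrite /a /b /m /M /Num.min /Num.max; do 2!case: ifP; rlra.
    have a1 : a 1 = b 1 by rewrite /a /b /m /M /Num.min /Num.max; do 2!case: ifP; rlra.
    apply: (homotopic_trans (homotopic_reparam cfc ca cb a0 a1)); apply: homotopic_ext.
      by apply: (cont_comp cfc).
    move=> r rI; rewrite /loop_concat /ft /g; case: ifP => hr.
      have mr : m r = 2 * r by rewrite /m /Num.min; case: ifP; rlra.
      have Mr : M r = 0 by rewrite /M /Num.max; case: ifP; rlra.
      by rewrite /b mr Mr mulr0 addr0.
    have mr : m r = 1 by rewrite /m /Num.min; case: ifP; rlra.
    have Mr : M r = 2 * r - 1 by rewrite /M /Num.max; case: ifP; rlra.
    by rewrite /b mr Mr mulr1 clampE //; rlra.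
  have pk1 := kap_path ut1; have pk2 := kap_path ut2.
  have h2 : kap u (fc t1) ** g ~~ kap u (fc t2).
    have pgu := gam_path ut1; have pr := ray_path lbX x0 ut1.
    have [cgu gu0' gu1] := pgu; have [cr r0 r1] := pr.
    apply: (homotopic_trans (g := gam u ** (ray u (fc t1) ** g))).
      by apply: homotopic_sym; apply: homotopic_assoc; rewrite ?gu1 ?r0 ?r1 ?g0.
    apply: homotopic_concat; rewrite ?concat0 ?gu1 ?r0 //; first exact: homotopic_refl.
    by rewrite -g0 -g1; apply: ray_star.
  have pfg := path_concat (ft_path t1) pg; have pkg := path_concat pk1 pg.
  apply: (genrel_trans (ft_path t2) pfg (kap_path wt2) (genrel_homotopic gens (ft_path t2) pfg h1) _).
  apply: (genrel_trans pfg pkg (kap_path wt2) (genrel_concat (ft_path t1) pk1 pg (S1 u ut1)) _).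
  apply: (genrel_trans pkg pk2 (kap_path wt2) (genrel_homotopic gens pkg pk2 h2) _).
  exact: Epoint.
have S1 : S 1.
  apply: (locally_constant_real (S := S)).
    move=> t; have [u ut] := carrier_nonempty (fc t).
    have nb : nbhs (fc t) [set y : rz | u \in vs (carrier y)]%classic.
      by apply: open_nbhs_nbhs; split=> //; apply: star_open.
    have [eps eps0 ballP] : exists2 eps : R, 0 < eps &
        (ball t eps `<=` fc @^-1` [set y : rz | u \in vs (carrier y)])%classic.
      by apply/nbhs_ballP; exact: cfc nb.
    have : nbhs t (ball t eps) by exact: nbhsx_ballx.
    apply: filterS => r rt; rewrite /ball /= in rt.
    (* The ball of times is convex, so between two of its times the path stays in the open star of
       [u]. *)
    have inb l q : `|t - l| < eps -> `|t - q| < eps -> forall k, u \in vs (carrier (fc (l + (q - l) * clamp k))).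
      move=> lt qt k; apply: ballP; rewrite /ball /=.
      have := clampI k; set c := clamp k => /andP[c0 c1].
      have -> : t - (l + (q - l) * c) = (1 - c) * (t - l) + c * (t - q) by ring.
      apply: le_lt_trans (ler_normD _ _) _; rewrite !normrM ger0_norm ?subr_ge0 // (ger0_norm c0).
      pose m := Num.max `|t - l| `|t - q|.
      have m_lt : m < eps by rewrite gt_max lt qt.
      have h1 : (1 - c) * `|t - l| <= (1 - c) * m by rewrite ler_wpM2l ?subr_ge0 // le_max lexx.
      have h2 : c * `|t - q| <= c * m by rewrite ler_wpM2l // le_max lexx orbT.
      apply: le_lt_trans (lerD h1 h2) _.
      by have -> : (1 - c) * m + c * m = m by ring.
    have tt : `|t - t| < eps by rewrite subrr normr0.
    by split; apply: step; apply: inb.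
  move=> w; rewrite fc0 => wx.
  have E0 : E (ft 0) (kap u0 x0).
    have p0 : is_path x0 x0 (ft 0) by have := ft_path 0; rewrite fc0.
    apply: (genrel_homotopic gens p0 (kap_path u0x)).
    have -> : ft 0 = cst x0 by apply/funext => r; rewrite /ft mul0r fc0.
    apply: homotopic_sym; rewrite /base_path gu0; have [cr _ r1] := ray_path lbX x0 u0x.
    by rewrite -[in cst _]r1; apply: homotopic_rev_concat.
  have p0 : is_path x0 x0 (ft 0) by have := ft_path 0; rewrite fc0.
  exact: genrel_trans p0 (kap_path u0x) (kap_path wx) E0 (Epoint _ _ _ u0x wx).
(* At time 1 the loop is equivalent to the route through [u0], a ray followed backwards and then
   forwards, hence to the constant loop. *)
have pk := kap_path u0x.
have E1 : E fc (kap u0 x0).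
  by have := S1 u0; rewrite fc1 => /(_ u0x); rewrite (_ : ft 1 = fc) //; apply/funext => r; rewrite /ft mul1r.
apply: (genrel_cst pfc _); apply: (genrel_trans pfc pk (path_cst x0) E1 _).
apply: (genrel_homotopic gens pk (path_cst x0) _).
rewrite /base_path gu0; have [cr _ r1] := ray_path lbX x0 u0x.
by rewrite -[in cst _]r1; apply: homotopic_rev_concat.
Qed.

End Spanned.

(** The tree takes up one kept edge fewer than there are vertices; subtracting this from
    [card_redges_le] turns the number of vertices into 1. *)
Lemma pi1_generated_mu (K : fieldType) : exists2 n, pi1_generated (R := R) x0 n &
  (n + mu_ord K X set0 s 0 <= mu_ord K X set0 s 1 + 1)%N.
Proof.
have [T [gam sp]] := spanning_exists; exists #|redges :\: T|; first exact: loops_generate sp.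
have [_ TR cT _] := sp; have := card_redges_le lbX sP K.
have := cardsID T redges; rewrite (setIidPr TR); lia.
Qed.

End Generators.

Lemma pi1_min_generators_le {disp : Order.disp_t} {P : finPOrderType disp} (R : realType)
    (K : fieldType) (X : {set P}) (x : realization R X) :
  simplicial_poset X -> connected [set: realization R X]%classic ->
  (pi1_min_generators (R := R) x
    <= (ratr (mu K X set0 1 - mu K X set0 0 + 1))%:E)%E.
Proof.
move=> sX connX; have lbX := simplicial_locally_boolean sX; have [e0 minX _] := sX.
(* The number of generators found depends on the ordering; the least number [m] does not, so its
   bound can be summed over all orderings. *)
pose good n := `[< pi1_generated (R := R) x n >].
have ex : exists n, good n.
  have sP : vertex_ordering X (enum (vertices X)) by exact: perm_refl.
  have [n gn _] := pi1_generated_mu x lbX minX sP connX K.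
  by exists n; apply/asboolP.
case: (ex_minnP ex) => m /asboolP gm min_m.
apply: (@le_trans _ _ (m%:R : R)%:E).
  by apply: ereal_inf_lbound; exists m.
rewrite lee_fin -(ratr_nat R m) ler_rat.
set V := enum (vertices X); set N : rat := ((#|vertices X|)`!)%:R.
have N_gt0 : 0 < N by rewrite ltr0n fact_gt0.
have szP : (size (permutations V))%:R = N.
  by rewrite /N size_permutations ?enum_uniq // -cardE.
have sumN (c : rat) : N * c = \sum_(s <- permutations V) c.
  by rewrite -szP big_const_seq count_predT iter_addr_0 mulr_natl.
have muN i : N * mu K X set0 i = \sum_(s <- permutations V) (mu_ord K X set0 s i)%:R.
  by rewrite /mu mulrA mulfV ?gt_eqF // mul1r.
have key : N * (m%:R + mu K X set0 0) <= N * (mu K X set0 1 + 1).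
  rewrite !mulrDr !muN !sumN -!big_split big_seq [leRHS]big_seq /=; apply: ler_sum => s.
  rewrite mem_permutations => sP; rewrite -natrD natr1 ler_nat -addn1.
  have [n gn le_n] := pi1_generated_mu x lbX minX sP connX K.
  by apply: leq_trans le_n; rewrite leq_add2r min_m //; apply/asboolP.
by move: key; rewrite ler_pM2l // -lerBrDr addrAC.
Qed.

Theorem lemma5p1 (disp : Order.disp_t) (P : finPOrderType disp)
    (Delta Gamma : {set P}) (R : realType) (K : fieldType) :
  relative_simplicial_poset Delta Gamma ->
  [/\ (forall (s : seq P) (t : seq {set P}) (i : nat),
         vertex_ordering Delta s -> sd_ordering Delta s t ->
         mu_ord K Delta Gamma s i = mu_ord K (sd Delta) (sd Gamma) t i),
      (forall (s : seq P) (i : nat), vertex_ordering Delta s ->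
         alt_sum (fun j => (betti K Delta Gamma j)%:R) i
         <= alt_sum (fun j => (mu_ord K Delta Gamma s j)%:R) i),
      (forall i : nat,
         alt_sum (fun j => (betti K Delta Gamma j)%:R) i
         <= alt_sum (fun j => mu K Delta Gamma j) i) &
      (connected [set: realization R Delta]%classic ->
       forall x : realization R Delta,
         (pi1_min_generators (R := R) x
          <= (ratr (mu K Delta finset.set0 1 - mu K Delta finset.set0 0 + 1))%:E)%E)].
Proof.
move=> rel; split.
- by move=> s t i sP tP; exact: sd_mu_ord_eq.
- by move=> s i sP; exact: morse_inequality.
- by move=> i; exact: mu_morse_inequality.
by move=> conn x; apply: pi1_min_generators_le => //; case: rel.
Qed.
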